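(* Let $\{(X_i,Y_i)\}_{i\ge1}$ be a sequence of i.i.d. random vectors whose generic vector $(X,Y)$ follows a bivariate Sarmanov distribution with marginals $F$ (of $X$) and $G$ (of $Y$), kernels $\phi_1,\phi_2$ and parameter $\theta$, satisfying $\lim_{x\to\infty}\phi_1(x)=d_1$ for some $d_1\in\mathbb{R}$. Assume $F\in\mathcal{D}$ and $\overline{G}(x)=o(\overline{F}(x))$ as $x\to\infty$. With $\overline{H}(x)=P[XY>x]$ and, for $v>0$, $\widetilde{H}(v)=\sup_{x>0}\frac{\overline{H}(x/v)}{\overline{H}(x)}$, assume that $\int_0^\infty\widetilde{H}(v)\,G(dv)<\infty$. Suppose $X$ is nonnegative, $\alpha>0$, $E[Y^{\alpha+\epsilon}]<1$ for some $\epsilon\in(0,\alpha)$, and $S=\sum_{i=1}^\infty X_i\prod_{j=1}^iY_j\in RV_{-\alpha}$. Assume further that for all $\beta\in\mathbb{R}$ $$E[Y^{\alpha+i\beta}]+\theta d_1E[\phi_2(Y)Y^{\alpha+i\beta}]\neq0\qquad\text{and}\qquad\sum_{k=0}^{\infty}\left\{E[Y^{\alpha+i\beta}]\right\}^k\neq0.$$ Then each $X_i\in RV_{-\alpha}$ and $$P[S>x]\sim\frac{E[Y^\alpha]+\theta d_1E[\phi_2(Y)Y^\alpha]}{1-E[Y^\alpha]}\,\overline{F}(x)\quad\text{as }x\to\infty.$$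
   Context: Notation: for a distribution function $F$, $\overline{F}(x)=1-F(x)$. For positive functions, $a(x)\sim b(x)$ as $x\to\infty$ means $\lim_{x\to\infty}a(x)/b(x)=1$. Bivariate Sarmanov distribution: $(X,Y)$ follows a bivariate Sarmanov distribution with marginals $F$ (of $X$) and $G$ (of $Y$), kernels $\phi_1,\phi_2$ and parameter $\theta$ if $$P(X\in dx,Y\in dy)=(1+\theta\phi_1(x)\phi_2(y))F(dx)G(dy),\quad x\in\mathbb{R},\ y\ge 0,$$ where $\phi_1,\phi_2$ are real valued functions and $\theta$ is a real constant satisfying $E\{\phi_1(X)\}=E\{\phi_2(Y)\}=0$ and $1+\theta\phi_1(x)\phi_2(y)\ge 0$ for all $x\in D_X$, $y\in D_Y$; here $D_X\subset\mathbb{R}$ and $D_Y\subset\mathbb{R}^+$ are the supports of $X$ and $Y$. Regular variation: a random variable $X$ with tail $\overline F(x)=P[X>x]$ has a regularly varying tail of index $-\alpha$, $\alpha>0$, written $X\in RV_{-\alpha}$, if for all $y>0$, $\overline{F}(xy)\sim y^{-\alpha}\overline{F}(x)$ as $x\to\infty$. Dominatedly-tail-varying class: $F\in\mathcal{D}$ if for all $0<y<1$, $\limsup_{x\to\infty}\overline{F}(xy)/\overline{F}(x)<\infty$. *)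

(* Defs.v *)
From HB Require Import structures.
From mathcomp Require Export all_boot all_order all_algebra.
From mathcomp Require Export complex.
From mathcomp Require Export all_classical all_reals all_analysis.
From mathcomp Require Export measurable_realfun.

Set Implicit Arguments.
Unset Strict Implicit.
Unset Printing Implicit Defensive.

Export Order.TTheory GRing.Theory Num.Theory.
Export numFieldNormedType.Exports.

Open Scope classical_set_scope.
Open Scope ring_scope.

Section Asymptotics.
Context {R : realType}.
Implicit Types (a b Fbar : R -> R).

(* Since r / 0 = 0 in R, the limit forces a and b to be eventually nonzero. *)
Definition asym_equiv a b : Prop := a x / b x @[x --> +oo] --> (1 : R).

Definition regularly_varying Fbar (alpha : R) : Prop :=
  forall y : R, 0 < y ->
    asym_equiv (fun x : R => Fbar (x * y)) (fun x => y `^ (- alpha) * Fbar x).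

(* Positivity of the tail is what makes the quotient meaningful; without it,
   the convention r / 0 = 0 would put every bounded distribution in the class. *)
Definition dominatedly_varying Fbar : Prop :=
  (forall x : R, 0 < Fbar x) /\
  forall y : R, 0 < y < 1 ->
    (limf_esup (fun x : R => (Fbar (x * y) / Fbar x)%:E) (pinfty_nbhs R) < +oo)%E.

(* The quotient is taken in the extended reals: c / 0 = +oo for c > 0. *)
Definition tail_ratio_sup (Hbar : R -> R) (v : R) : \bar R :=
  ereal_sup [set ((Hbar (x / v))%:E / (Hbar x)%:E)%E | x in [set x : R | 0 < x]].

End Asymptotics.

Section RandomVectors.
Context {d : measure_display} {T : measurableType d} {R : realType}.
Variable P : probability T R.

Definition tail (X : {RV P >-> R}) (x : R) : R := fine (ccdf X x).

Definition etail (S : T -> \bar R) (x : R) : R :=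
  fine (P [set w | (x%:E < S w)%E]).

Definition dist_support (X : {RV P >-> R}) : set R :=
  [set x | forall e : R, 0 < e -> (0 < distribution P X (ball x e))%E].

Definition mutually_independent {d' : measure_display} {T' : measurableType d'}
    (Z : nat -> T -> T') : Prop :=
  forall (J : seq nat) (A : nat -> set T'), uniq J ->
    (forall j, measurable (A j)) ->
    P (\bigcap_(j in [set` J]) (Z j @^-1` A j)) =
    (\prod_(j <- J) P (Z j @^-1` A j))%E.

Definition identically_distributed {d' : measure_display}
    {T' : measurableType d'} (Z : nat -> T -> T') : Prop :=
  forall (i j : nat) (A : set T'), measurable A ->
    P (Z i @^-1` A) = P (Z j @^-1` A).

Definition iid {d' : measure_display} {T' : measurableType d'}
    (Z : nat -> T -> T') : Prop :=
  mutually_independent Z /\ identically_distributed Z.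

Record sarmanov (X Y : {RV P >-> R}) (phi1 phi2 : R -> R) (theta : R) : Prop :=
  Sarmanov {
  sarmanov_supp_ge0 : dist_support Y `<=` [set y | 0 <= y];
  sarmanov_measurable1 : measurable_fun [set: R] phi1;
  sarmanov_measurable2 : measurable_fun [set: R] phi2;
  sarmanov_integrable1 : P.-integrable [set: T] (EFin \o (phi1 \o X));
  sarmanov_integrable2 : P.-integrable [set: T] (EFin \o (phi2 \o Y));
  sarmanov_centered1 : ('E_P[phi1 \o X] = 0)%E;
  sarmanov_centered2 : ('E_P[phi2 \o Y] = 0)%E;
  sarmanov_density_ge0 : forall x y, dist_support X x -> dist_support Y y ->
    0 <= 1 + theta * phi1 x * phi2 y;
  sarmanov_law : forall A : set (R * R), measurable A ->
    P [set w | A (X w, Y w)] =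
    (\int[distribution P X \x distribution P Y]_(z in A)
        (1 + theta * phi1 z.1 * phi2 z.2)%:E)%E }.

(* [fine] sends an infinite (or undefined) expectation to 0. For E[phi2(Y) Y^z]
   this only happens when theta * d1 = 0, where that term has coefficient 0:
   otherwise phi1 takes both signs on the support of X, so the positivity
   constraint on the density bounds phi2 on the support of Y. *)
Definition rexpectation (Z : T -> R) : R := fine 'E_P[Z]%E.

Definition cexpectation (Z : T -> R[i]) : R[i] :=
  Complex (rexpectation (fun w => complex.Re (Z w)))
          (rexpectation (fun w => complex.Im (Z w))).

End RandomVectors.

(* y ^ z for y >= 0 and a complex exponent z; it vanishes at y = 0 as soon as
   Re z != 0, since 0 `^ p = 0 for p != 0. *)
Definition cpowR {R : realType} (y : R) (z : R[i]) : R[i] :=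
  Complex (y `^ complex.Re z * cos (complex.Im z * ln y))
          (y `^ complex.Re z * sin (complex.Im z * ln y)).

(* The sum of sum_(k >= 0) z ^ k in the topology of C induced by the modulus. *)
Definition cgeometric_sum {R : realType} (z : R[i]) : R[i] :=
  let C : numFieldType := R[i] in
  limn (series (fun k : nat => ((z : C) ^+ k : C))).

(* Main.v *)
From HB Require Import structures.
Require Import Defs.
From mathcomp Require Import ring lra.

(** With [S'] the copy of the perpetuity started one step later,
    [S = Y0 * (X0 + S')] with [S'] independent of [(X0, Y0)].  As [S] has a
    regularly varying tail [K], so does [Y0 * S'], with Breiman's constant
    [m1 = E (Y0^alpha) < 1]; only one of [X0 * Y0] and [Y0 * S'] is large when [S] is,
    so the tail [H] of [X0 * Y0] satisfies [H / K -> 1 - m1] and is regularly varying.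

    The Sarmanov density turns [H] into a multiplicative convolution of the tail [F]
    of [X0] with a kernel which far out becomes [1 + theta * d1 * phi2 y].  Class D
    bounds [F] by a multiple of [H], so on the logarithmic scale [F / H] is a bounded,
    slowly decreasing function whose convolution with the measure of density
    [W y = y^alpha * (1 + theta * d1 * phi2 y)] tends to 1.  The nonvanishing condition
    says that the Fourier transform of that measure has no zero, so Wiener's Tauberian
    argument gives [F / H -> 1 / m] where [m] is the mass of [W].

    In the Tauberian step only a Fejer kernel has to be written as a convolution with
    the measure: [W] has two logarithmic moments, so its transform is of class C^2 and
    the Fourier transform of a compactly supported tent divided by it decays
    quadratically. *)

Set Implicit Arguments.
Unset Strict Implicit.
Unset Printing Implicit Defensive.

(** * Real-valued integrals *)

(** The copy [S'] is never constructed. The recursion is used for the partial sums [perp], whose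
    tails converge to [K] by monotonicity, and the inequalities between [H], [K] and the tail of
    [Y0 * S'] are limits of those for partial sums.

    Breiman's lemma is stated with a bounded weight [g x w] next to [K (x / Y0)]. The indicator of
    [X0 * Y0 > x] as weight shows that a joint exceedance is negligible although [X0] and [Y0] are
    dependent; a weight containing the unknown [F / H], which has no known limit yet, turns the
    equation for [H] into a convolution with the fixed measure [W].

    The quotient [F / H] may drop abruptly but cannot rise fast, since [F] is nonincreasing and [H]
    regularly varying. This one-sided control is enough to pass from Fejer means to values, as Fejer
    kernels are nonnegative, at most [4 / (la * t^2)], and of mass at least [cos 1] for every [la].

    The kernel [phi2] may be unbounded. Either [theta * phi1] vanishes almost everywhere, and [phi2]
    drops out of the equation, or [phi1] takes both signs and positivity of the density bounds
    [theta * phi2]. A bounded [pw] covers both cases. *)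

Section translation.
Context {R : realType}.
Notation mu := (@lebesgue_measure R).

Let shift (a : R) : measurableTypeR R -> measurableTypeR R := fun x => x + a.

Let mshift a : measurable_fun setT (shift a).
Proof. exact: measurable_funD. Qed.

HB.instance Definition _ a := isMeasurableFun.Build _ _ _ _ (shift a) (mshift a).

(** Uniqueness of the measure that gives half-open intervals their length. *)
Lemma lebesgue_measure_shift (a : R) (A : set (measurableTypeR R)) :
  measurable A -> pushforward mu (shift a) A = mu A.
Proof.
move=> mA; apply/esym.
apply: (lebesgue_measure_unique (mu := pushforward mu (shift a))) => // _ [[x y] _ <-].
rewrite /pushforward /=.
rewrite [X in _ = lebesgue_measure X](_ : _ = [set` `]x - a, y - a]]); last first.
  by apply/seteqP; split => z /=; rewrite /shift !in_itv/= ltrBlDr lerBrDr.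
rewrite !lebesgue_measure_itv /= !lte_fin ltrD2r; case: ifP => // _.
by rewrite -!EFinB; congr (_%:E); ring.
Qed.

Let ge0_integral_shift (a : R) (f : R -> \bar R) :
  measurable_fun setT f -> (forall x, 0 <= f x)%E ->
  (\int[mu]_x f (x + a)%R = \int[mu]_x f x)%E.
Proof.
move=> mf f0.
rewrite [RHS](_ : _ = \int[pushforward mu (shift a)]_x f x)%E; last first.
  by apply: eq_measure_integral => A mA _; apply/esym/lebesgue_measure_shift.
by rewrite ge0_integral_pushforward //= => x _; exact: f0.
Qed.

Lemma integral_shift (a : R) (f : R -> \bar R) :
  measurable_fun setT f ->
  (\int[mu]_x f (x + a)%R = \int[mu]_x f x)%E.
Proof.
move=> mf; rewrite integralE [RHS]integralE; congr (_ - _)%E.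
- rewrite -(ge0_integral_shift a (measurable_funepos mf) (funepos_ge0 f)).
  by rewrite (funepos_comp f (fun x => x + a)).
- rewrite -(ge0_integral_shift a (measurable_funeneg mf) (funeneg_ge0 f)).
  by rewrite (funeneg_comp f (fun x => x + a)).
Qed.

Lemma Rintegral_shift (a : R) (f : R -> R) :
  measurable_fun setT f ->
  \int[mu]_x f (x + a) = \int[mu]_x f x.
Proof.
move=> mf; rewrite /Rintegral (integral_shift a (f := EFin \o f)) //.
exact/measurable_EFinP.
Qed.

End translation.

Section rintegral.
Context d {T : measurableType d} {R : realType}.
Implicit Types mu : {measure set T -> \bar R}.

Lemma integrable_bounded_by mu (f h : T -> R) :
  measurable_fun setT f -> mu.-integrable setT (EFin \o h) ->
  {ae mu, forall w, `|f w| <= h w} -> mu.-integrable setT (EFin \o f).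
Proof.
move=> mf ih fh; apply/integrableP; split; first exact/measurable_EFinP.
have /integrableP[mh hoo] := ih.
apply: le_lt_trans hoo; apply: ae_ge0_le_integral => //.
- by apply: measurableT_comp => //; exact/measurable_EFinP.
- exact: measurableT_comp.
- by apply: filterS fh => w fw _ /=; rewrite lee_fin (le_trans fw)// ler_norm.
Qed.

Lemma ae_eq_Rintegral mu (f g : T -> R) :
  measurable_fun setT f -> measurable_fun setT g ->
  {ae mu, forall w, f w = g w} -> \int[mu]_w f w = \int[mu]_w g w.
Proof.
move=> mf mg fg; rewrite /Rintegral; congr fine; apply: ae_eq_integral => //.
- exact/measurable_EFinP.
- exact/measurable_EFinP.
- by apply: filterS fg => w -> _.
Qed.

(** The order holds only almost everywhere, so [g - f] is exchanged for its absolute value, which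
    has the same integral and is nonnegative at every point. *)
Lemma ae_le_Rintegral mu (f g : T -> R) :
  mu.-integrable setT (EFin \o f) -> mu.-integrable setT (EFin \o g) ->
  {ae mu, forall w, f w <= g w} -> \int[mu]_w f w <= \int[mu]_w g w.
Proof.
move=> If Ig fg; rewrite -subr_ge0 -RintegralB//.
have Igf : mu.-integrable setT (EFin \o (fun w => g w - f w)).
  rewrite [X in integrable _ _ X](_ : _ = (EFin \o g) \- (EFin \o f))%E; last exact/funext.
  exact: integrableB.
have mgf : measurable_fun setT (fun w => g w - f w) by apply/measurable_EFinP/measurable_int/Igf.
rewrite (_ : Rintegral _ _ _ = \int[mu]_w `|g w - f w|).
  by apply: Rintegral_ge0.
apply: ae_eq_Rintegral => //; first exact: measurableT_comp.
by apply: filterS fg => w fgw; rewrite ger0_norm // subr_ge0.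
Qed.

Lemma normr_Rintegral_le mu (f h : T -> R) :
  measurable_fun setT f -> mu.-integrable setT (EFin \o h) ->
  {ae mu, forall w, `|f w| <= h w} -> `|\int[mu]_w f w| <= \int[mu]_w h w.
Proof.
move=> mf ih fh; have If := integrable_bounded_by mf ih fh.
apply: (le_trans (le_normr_Rintegral _ If)) => //.
apply: ae_le_Rintegral => //.
exact: integrable_norm.
Qed.

Lemma Rintegral_cvg_seq mu (f : nat -> T -> R) (g h : T -> R) :
  (forall n, measurable_fun setT (f n)) -> measurable_fun setT g ->
  mu.-integrable setT (EFin \o h) ->
  (forall n, {ae mu, forall w, `|f n w| <= h w}) ->
  {ae mu, forall w, f n w @[n --> \oo] --> g w} ->
  \int[mu]_w f n w @[n --> \oo] --> \int[mu]_w g w.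
Proof.
move=> mf mg ih fh fg; apply: fine_cvg.
have [] := @dominated_convergence _ _ _ mu _ measurableT
  (fun n w => (f n w)%:E) (EFin \o g) (EFin \o h).
- by move=> n; exact/measurable_EFinP.
- exact/measurable_EFinP.
- by apply: filterS fg => w fgw _; apply: cvg_EFin => //; exact: nearW.
- exact: ih.
- by apply: filterS (ae_foralln fh) => w fw n _; rewrite lee_fin.
move=> /integrable_fin_num - /(_ measurableT) gfin _.
by rewrite [X in _ -> _ --> X]/= [X in _ -> _ --> X]fineK.
Qed.

(** Limits at [+oo] are tested along sequences, where dominated convergence applies. The bound holds
    only eventually, hence the shift of the sequence by [N]. *)
Lemma Rintegral_cvg_pinfty mu (f : R -> T -> R) (g h : T -> R) :
  (forall x, measurable_fun setT (f x)) -> measurable_fun setT g ->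
  mu.-integrable setT (EFin \o h) ->
  (\forall x \near +oo, {ae mu, forall w, `|f x w| <= h w}) ->
  {ae mu, forall w, f x w @[x --> +oo] --> g w} ->
  \int[mu]_w f x w @[x --> +oo] --> \int[mu]_w g w.
Proof.
move=> mf mg ih fh fg; apply/cvg_pinftyP => u uoo.
have [N _ uN] : \forall n \near \oo, {ae mu, forall w, `|f (u n) w| <= h w}.
  exact: (uoo _ fh).
rewrite -(cvg_shiftn N).
apply: (@Rintegral_cvg_seq _ (fun n => f (u (n + N)%N)) _ h) => //.
  by move=> n; apply: uN; rewrite /= leq_addl.
apply: filterS fg => w fgw; rewrite (cvg_shiftn N (fun n => f (u n) w)).
by move/cvg_pinftyP : fgw; apply.
Qed.

End rintegral.

Section integrableR.
Context d {T : measurableType d} {R : realType} (mu : {measure set T -> \bar R}).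
Implicit Types f g : T -> R.

Lemma integrableRD f g : mu.-integrable setT (EFin \o f) ->
  mu.-integrable setT (EFin \o g) ->
  mu.-integrable setT (EFin \o (fun w => f w + g w)).
Proof. by move=> If Ig; exact: (integrableD _ If Ig). Qed.

Lemma integrableRB f g : mu.-integrable setT (EFin \o f) ->
  mu.-integrable setT (EFin \o g) ->
  mu.-integrable setT (EFin \o (fun w => f w - g w)).
Proof. by move=> If Ig; exact: (integrableB _ If Ig). Qed.

Lemma integrableRZ (c : R) f : mu.-integrable setT (EFin \o f) ->
  mu.-integrable setT (EFin \o (fun w => c * f w)).
Proof. by move=> If; exact: (integrableZl _ c If). Qed.

End integrableR.

Section fubini_real.
Context d1 d2 {T1 : measurableType d1} {T2 : measurableType d2} {R : realType}.
Variables (m1 : {sigma_finite_measure set T1 -> \bar R})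
          (m2 : {sigma_finite_measure set T2 -> \bar R}) (f : T1 * T2 -> R).
Hypothesis If : (m1 \x m2)%E.-integrable setT (EFin \o f).
Hypothesis If1 : forall x, m2.-integrable setT (EFin \o (fun y => f (x, y))).
Hypothesis If2 : forall y, m1.-integrable setT (EFin \o (fun x => f (x, y))).

(** The inner real integral is the [fine] of an extended one. Integrability of every section, not
    just of almost every one, makes the two agree at each point. *)
Lemma Rintegral_prod1 :
  \int[m1]_x (\int[m2]_y f (x, y)) = \int[(m1 \x m2)%E]_z f z.
Proof.
rewrite /Rintegral -(integral12_prod_meas1 If).
congr fine; apply: eq_integral => x _; rewrite fineK//.
by apply: integrable_fin_num => //; (exact: If1 || exact: If2).
Qed.

Lemma Rintegral_prod2 :
  \int[m2]_y (\int[m1]_x f (x, y)) = \int[(m1 \x m2)%E]_z f z.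
Proof.
rewrite /Rintegral -(integral21_prod_meas1 If).
congr fine; apply: eq_integral => x _; rewrite fineK//.
by apply: integrable_fin_num => //; (exact: If1 || exact: If2).
Qed.

Lemma Rintegral_fubini :
  \int[m1]_x (\int[m2]_y f (x, y)) = \int[m2]_y (\int[m1]_x f (x, y)).
Proof. by rewrite Rintegral_prod1 Rintegral_prod2. Qed.

Lemma measurable_Rintegral2 : measurable_fun setT (fun y => \int[m1]_x f (x, y)).
Proof.
by apply: (measurableT_comp (fine_measurable measurableT)); exact: measurable_fubini_G If.
Qed.

End fubini_real.

Section fubini_dominated.
Context d1 d2 {T1 : measurableType d1} {T2 : measurableType d2} {R : realType}.
Variables (m1 : {sigma_finite_measure set T1 -> \bar R})
          (m2 : {sigma_finite_measure set T2 -> \bar R}).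
Variables (f : T1 * T2 -> R) (a : T1 -> R) (b : T2 -> R).
Hypothesis mf : measurable_fun setT f.
Hypothesis Ia : m1.-integrable setT (EFin \o a).
Hypothesis Ib : m2.-integrable setT (EFin \o b).
Hypothesis fab : forall x y, `|f (x, y)| <= a x * b y.

Lemma integrable_section1 x : m2.-integrable setT (EFin \o (fun y => f (x, y))).
Proof.
apply: (@integrable_bounded_by _ _ _ m2 _ (fun y => a x * b y)).
- exact: measurableT_comp.
- exact: integrableRZ.
- by apply: aeW => y; exact: fab.
Qed.

Lemma integrable_section2 y : m1.-integrable setT (EFin \o (fun x => f (x, y))).
Proof.
apply: (@integrable_bounded_by _ _ _ m1 _ (fun x => b y * a x)).
- exact: measurableT_comp.
- exact: integrableRZ.
- by apply: aeW => x; rewrite mulrC; exact: fab.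
Qed.

End fubini_dominated.

Section fubini_tonelli_real.
Context d1 d2 {T1 : measurableType d1} {T2 : measurableType d2} {R : realType}.
Variables (m1 : {sigma_finite_measure set T1 -> \bar R})
          (m2 : {sigma_finite_measure set T2 -> \bar R}).
Variables (f : T1 * T2 -> R) (a : T1 -> R).
Hypothesis mf : measurable_fun setT f.
Hypothesis If1 : forall x, m2.-integrable setT (EFin \o (fun y => f (x, y))).
Hypothesis Ia : m1.-integrable setT (EFin \o a).
Hypothesis fa : forall x, \int[m2]_y `|f (x, y)| <= a x.

(** Tonelli: the iterated integral of the absolute value is at most the integral of [a]. This form
    serves integrands that have no bound in product form. *)
Lemma integrable_prod_section : (m1 \x m2)%E.-integrable setT (EFin \o f).
Proof.
apply/integrable12ltyP; first exact/measurable_EFinP.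
have /integrableP[ma aoo] := Ia.
apply: le_lt_trans aoo; apply: ge0_le_integral => //.
- by move=> x _; exact: integral_ge0.
- apply: (@measurable_fun_fubini_tonelli_F _ _ _ _ _ m2 (fun z => `|(f z)%:E|%E)) => //.
  by apply: measurableT_comp => //; exact/measurable_EFinP.
- exact: measurableT_comp.
- move=> x _.
  have /integrable_fin_num h : m2.-integrable setT (EFin \o (fun y => `|f (x, y)|)).
    by have := integrable_norm (If1 x).
  rewrite [leLHS](_ : _ = (\int[m2]_y `|f (x, y)|)%:E); last first.
    by rewrite /Rintegral fineK //; exact: h.
  by rewrite lee_fin (le_trans (fa x)) // ler_norm.
Qed.

End fubini_tonelli_real.

Lemma integrable_prod_dominated d1 d2 {T1 : measurableType d1} {T2 : measurableType d2}
    {R : realType} (m1 : {sigma_finite_measure set T1 -> \bar R})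
    (m2 : {sigma_finite_measure set T2 -> \bar R})
    (f : T1 * T2 -> R) (a : T1 -> R) (b : T2 -> R) :
  measurable_fun setT f -> m1.-integrable setT (EFin \o a) ->
  m2.-integrable setT (EFin \o b) -> (forall x y, `|f (x, y)| <= a x * b y) ->
  (m1 \x m2)%E.-integrable setT (EFin \o f).
Proof.
move=> mf Ia Ib fab.
apply: (@integrable_prod_section _ _ _ _ _ _ _ _ (fun x => (\int[m2]_y b y) * a x)) => //.
- by move=> x; exact: (@integrable_section1 _ _ _ _ _ m2 _ _ _ mf Ib fab).
- exact: integrableRZ.
- move=> x; rewrite mulrC -RintegralZl //; apply: le_Rintegral => //.
  + have := integrable_norm (@integrable_section1 _ _ _ _ _ m2 _ _ _ mf Ib fab x); exact.
  + exact: integrableRZ.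
Qed.

Lemma Rintegral_swap d1 d2 {T1 : measurableType d1} {T2 : measurableType d2}
    {R : realType} (m1 : {sigma_finite_measure set T1 -> \bar R})
    (m2 : {sigma_finite_measure set T2 -> \bar R})
    (f : T1 * T2 -> R) (a : T1 -> R) (b : T2 -> R) :
  measurable_fun setT f -> m1.-integrable setT (EFin \o a) ->
  m2.-integrable setT (EFin \o b) -> (forall x y, `|f (x, y)| <= a x * b y) ->
  \int[m1]_x (\int[m2]_y f (x, y)) = \int[m2]_y (\int[m1]_x f (x, y)).
Proof.
move=> mf Ia Ib fab; apply: Rintegral_fubini.
- exact: integrable_prod_dominated fab.
- by move=> x; exact: (@integrable_section1 _ _ _ _ _ m2 _ _ _ mf Ib fab).
- by move=> x; exact: (@integrable_section2 _ _ _ _ _ m1 _ _ _ mf Ia fab).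
Qed.

(** * Fourier transforms of log-weights *)

Section real_derivatives.
Context {R : realType}.
Implicit Types (f g : R -> R) (x : R).

Lemma derR_id x : is_derive x (1 : R) (fun y : R => y) (1 : R).
Proof. exact: is_derive_id. Qed.

Lemma derR_cst (c x : R) : is_derive x (1 : R) (fun _ : R => c) (0 : R).
Proof. exact: is_derive_cst. Qed.

Lemma derRD f g x (f' g' : R) : is_derive x (1 : R) f f' -> is_derive x (1 : R) g g' ->
  is_derive x (1 : R) (fun y => f y + g y) (f' + g').
Proof. by move=> df dg; exact: (is_deriveD df dg). Qed.

Lemma derRN f x (f' : R) : is_derive x (1 : R) f f' ->
  is_derive x (1 : R) (fun y => - f y) (- f').
Proof. by move=> df; exact: (is_deriveN df). Qed.

Lemma derRM f g x (f' g' : R) : is_derive x (1 : R) f f' -> is_derive x (1 : R) g g' ->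
  is_derive x (1 : R) (fun y => f y * g y) (f' * g x + f x * g').
Proof.
move=> df dg; apply: is_derive_eq (is_deriveM df dg) _.
by rewrite /GRing.scale /= addrC (mulrC (g x)).
Qed.

Lemma derR_comp f g x (f' g' : R) : is_derive (g x) (1 : R) f f' ->
  is_derive x (1 : R) g g' -> is_derive x (1 : R) (fun y => f (g y)) (f' * g').
Proof. by move=> df dg; exact: (is_derive1_comp df dg). Qed.

Lemma derRV f x (f' : R) : f x != 0 -> is_derive x (1 : R) f f' ->
  is_derive x (1 : R) (fun y => (f y)^-1) (- f' / f x ^+ 2).
Proof.
move=> f0 df; apply: DeriveDef.
  by apply: derivableV => //; exact: ex_derive.
by rewrite deriveV// derive_val /GRing.scale /= mulrC mulrN mulNr.
Qed.

Lemma derR_continuous f x (f' : R) : is_derive x (1 : R) f f' -> {for x, continuous f}.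
Proof.
move=> df; apply: differentiable_continuous; apply/derivable1_diffP.
exact: ex_derive.
Qed.

End real_derivatives.
Arguments derR_comp {R} f g {x f' g'}.
Arguments derRM {R} f g {x f' g'}.
Arguments derRD {R} f g {x f' g'}.
Arguments derRV {R} f {x f'}.
Arguments derRN {R} f {x f'}.

Section transform.
Context d {T : measurableType d} {R : realType} (mu : {measure set T -> \bar R}).
Variables (V L : T -> R) (e : R -> R).
Hypotheses (mL : measurable_fun setT L) (mV : measurable_fun setT V).
Hypothesis IV : mu.-integrable setT (EFin \o V).
Hypotheses (ce : continuous e) (e1 : forall x, `|e x| <= 1).

(** With [e] the cosine and the sine, these are the real and imaginary parts of
    [b |-> \int V * exp (i b L)], the Fourier transform of the image under [L] of the signed measure
    of density [V]. *)
Definition transform (b : R) : R := \int[mu]_w (V w * e (b * L w)).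

Lemma measurable_transform_integrand b :
  measurable_fun setT (fun w => V w * e (b * L w)).
Proof.
apply: measurable_funM => //.
apply: (measurableT_comp (continuous_measurable_fun ce)).
exact: measurable_funM.
Qed.

Lemma integrable_transform b :
  mu.-integrable setT (EFin \o (fun w => V w * e (b * L w))).
Proof.
apply: (integrable_bounded_by (h := fun w => `|V w|)).
- exact: measurable_transform_integrand.
- exact: integrable_norm.
- by apply: aeW => w; rewrite normrM ler_piMr.
Qed.

Lemma continuous_transform : continuous transform.
Proof.
move=> b.
apply: (@continuity_under_integral _ _ _ mu (fun b w => V w * e (b * L w)) setT
  measurableT (b - 1) (b + 1) _ _ (fun w => `|V w|)).
- by move=> x _; exact: integrable_transform.
- apply: aeW => w _ x _.
  have h : continuous (fun b : R => V w * e (b * L w) : R).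
    move=> y; apply: continuousM; first exact: cvg_cst.
    apply: (@continuous_comp _ _ _ (fun b : R => b * L w) e); last exact: ce.
    by apply: continuousM; [exact: cvg_id|exact: cvg_cst].
  exact: h.
- exact: integrable_norm.
- by move=> x _; apply: aeW => w _; rewrite normrM ler_piMr.
- by rewrite inE /= in_itv /=; apply/andP; split; lra.
Qed.

Variable e' : R -> R.
Hypothesis IVL : mu.-integrable setT (EFin \o (fun w => V w * L w)).
Hypotheses (de : forall x : R, is_derive x (1 : R) e (e' x)) (e'1 : forall x, `|e' x| <= 1).

(** Differentiation under the integral sign: as [e'] is bounded by 1, the derivative of the
    integrand is dominated by [|V * L|] for all [b]. Each derivative costs one factor [L]. *)
Lemma is_derive_transform (b : R) :
  is_derive b (1 : R) transform (\int[mu]_w (V w * L w * e' (b * L w))).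
Proof.
have dw w (x : R) : is_derive x (1 : R) (fun b => V w * e (b * L w)) (V w * (L w * e' (x * L w))).
  have dl : is_derive x (1 : R) (fun b : R => b * L w) (L w).
    by apply: is_derive_eq (derRM id (fun=> L w) (derR_id x) (derR_cst (L w) x)) _; ring.
  apply: is_derive_eq (derRM (fun=> V w) (fun b => e (b * L w)) (derR_cst (V w) x)
    (derR_comp e (fun b => b * L w) (de (x * L w)) dl)) _.
  ring.
have E w x : partial1of2 (fun b w => V w * e (b * L w)) x w = V w * L w * e' (x * L w).
  by rewrite partial1of2E derive_val mulrA.
have h1 : (b - 1 < b < b + 1)%R by apply/andP; split; lra.
have D := @derivable_under_integral _ _ _ mu (fun b w => V w * e (b * L w)) setT
  measurableT b (b - 1) (b + 1) _ _ _ (fun w => `|V w * L w|).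
have D' := @differentiation_under_integral _ _ _ mu (fun b w => V w * e (b * L w)) setT
  measurableT b (b - 1) (b + 1) _ _ _ (fun w => `|V w * L w|).
apply: DeriveDef.
- apply: D => //.
  + by move=> x _; exact: integrable_transform.
  + exact: integrable_norm.
  + by move=> x w _ _; rewrite E normrM ler_piMr.
- rewrite -derive1E [LHS]D' //.
  + by apply: eq_Rintegral => w _; rewrite E.
  + by move=> x _; exact: integrable_transform.
  + exact: integrable_norm.
  + by move=> x w _ _; rewrite E normrM ler_piMr.
Qed.

End transform.

Section continuous_real.
Context {R : realType}.
Implicit Types f g e : R -> R.

Lemma continuousRM f g : continuous f -> continuous g -> continuous (fun x => f x * g x).
Proof. by move=> cf cg x; apply: continuousM; [exact: cf|exact: cg]. Qed.

Lemma continuousRD f g : continuous f -> continuous g -> continuous (fun x => f x + g x).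
Proof. by move=> cf cg x; apply: (@continuousD _ _ _ f g); [exact: cf|exact: cg]. Qed.

Lemma continuousRN f : continuous f -> continuous (fun x => - f x).
Proof. by move=> cf x; apply: (@continuousN _ _ _ f); exact: cf. Qed.

Lemma continuousRV f : (forall x, f x != 0) -> continuous f -> continuous (fun x => (f x)^-1).
Proof. by move=> f0 cf x; apply: (@continuousV _ _ f); [exact: f0|exact: cf]. Qed.

Lemma continuousR_scale (t : R) e : continuous e -> continuous (fun b : R => e (b * t)).
Proof.
move=> ce x; apply: (@continuous_comp _ _ _ (fun b : R => b * t) e); last exact: ce.
by apply: continuousM; [exact: cvg_id|exact: cvg_cst].
Qed.

Lemma continuousR_norm f : continuous f -> continuous (fun x => `|f x|).
Proof. by move=> cf x; apply: (continuous_comp (cf x)); exact: norm_continuous. Qed.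

End continuous_real.

(** * Oscillatory integrals and integration by parts *)

Section oscillation.
Context {R : realType}.
Notation mu := (@lebesgue_measure R).

Lemma continuous_integrable_itv (f : R -> R) (a b : R) : continuous f ->
  mu.-integrable `[a, b] (EFin \o f).
Proof.
move=> cf; apply: continuous_compact_integrable; first exact: segment_compact.
exact: continuous_subspaceT.
Qed.

Lemma Rintegral_FTC (F f : R -> R) (a b : R) : a < b ->
  (forall x : R, is_derive x (1 : R) F (f x)) -> continuous f ->
  \int[mu]_(x in `[a, b]) f x = F b - F a.
Proof.
move=> ab dF cf.
have cF : continuous F by move=> x; exact: (derR_continuous (dF x)).
rewrite /Rintegral (@continuous_FTC2 _ _ F) //.
- exact: continuous_subspaceT.
- split.
  + by move=> x _; have dFx := dF x; apply: ex_derive.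
  + by apply: cvg_at_right_filter; exact: cF.
  + by apply: cvg_at_left_filter; exact: cF.
- by move=> x _; rewrite derive1E; have dFx := dF x; apply: derive_val.
Qed.

Lemma normr_Rintegral_itv_le (f g : R -> R) (a b : R) : continuous f -> continuous g ->
  (forall x, `|f x| <= g x) ->
  `|\int[mu]_(x in `[a, b]) f x| <= \int[mu]_(x in `[a, b]) g x.
Proof.
move=> cf cg fg; apply: (le_trans (le_normr_Rintegral _ _)) => //.
  exact: continuous_integrable_itv.
apply: le_Rintegral => //.
- by apply: integrable_norm; exact: continuous_integrable_itv.
- exact: continuous_integrable_itv.
Qed.

Lemma normr_cos_le1 (x : R) : `|cos x| <= 1.
Proof. by rewrite ler_norml cos_geN1 cos_le1. Qed.

Lemma normr_sin_le1 (x : R) : `|sin x| <= 1.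
Proof. by rewrite ler_norml sin_geN1 sin_le1. Qed.

Variables (u u1 u2 : R -> R) (la : R).
Hypotheses (du : forall x : R, is_derive x (1 : R) u (u1 x))
  (du1 : forall x : R, is_derive x (1 : R) u1 (u2 x)) (cu2 : continuous u2).
Hypotheses (la0 : 0 < la) (ula : u la = 0).

Let cu : continuous u. Proof. by move=> x; exact: (derR_continuous (du x)). Qed.
Let dcos (t x : R) : is_derive x (1 : R) (fun b : R => cos (b * t)) (- (t * sin (x * t))).
Proof.
apply: is_derive_eq (derR_comp cos (fun b => b * t) (is_derive_cos _)
  (derRM id (fun=> t) (derR_id x) (derR_cst t x))) _; ring.
Qed.
Let dsin (t x : R) : is_derive x (1 : R) (fun b : R => sin (b * t)) (t * cos (x * t)).
Proof.
apply: is_derive_eq (derR_comp sin (fun b => b * t) (is_derive_sin _)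
  (derRM id (fun=> t) (derR_id x) (derR_cst t x))) _; ring.
Qed.

(** Two integrations by parts in one go, through the antiderivative
    [t * u b * sin (b t) + u1 b * cos (b t)]. Its first term vanishes at [la] because [u la = 0] and
    at 0 because [sin 0 = 0]. The factor [t ^+ 2] kept on the left spares the case [t = 0]. *)
Lemma oscillation_cos (t : R) :
  t ^+ 2 * (\int[mu]_(b in `[0, la]) (u b * cos (b * t))) =
  u1 la * cos (la * t) - u1 0 - \int[mu]_(b in `[0, la]) (u2 b * cos (b * t)).
Proof.
have cc : continuous (fun b : R => cos (b * t)) by apply: continuousR_scale; exact: continuous_cos.
rewrite -RintegralZl //; last by apply: continuous_integrable_itv; exact: continuousRM.
apply/eqP; rewrite -subr_eq opprK -RintegralD //; last 2 first.
- by apply: continuous_integrable_itv; apply: continuousRM; [exact: cst_continuous|exact: continuousRM].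
- by apply: continuous_integrable_itv; exact: continuousRM.
have dF (x : R) : is_derive x (1 : R) (fun b => t * u b * sin (b * t) + u1 b * cos (b * t))
    (t ^+ 2 * (u x * cos (x * t)) + u2 x * cos (x * t)).
  apply: is_derive_eq (derRD _ _
    (derRM _ _ (derRM (fun=> t) u (derR_cst t x) (du x)) (dsin t x))
    (derRM _ _ (du1 x) (dcos t x))) _.
  ring.
have cf : continuous (fun x : R => t ^+ 2 * (u x * cos (x * t)) + u2 x * cos (x * t)).
  apply: continuousRD; last exact: continuousRM.
  by apply: (continuousRM (f := fun=> t ^+ 2)); [exact: cst_continuous|exact: continuousRM].
apply/eqP; rewrite (Rintegral_FTC la0 dF cf).
by rewrite ula !mul0r sin0 cos0; ring.
Qed.

(** The antiderivative is now [- t * u b * cos (b t) + u1 b * sin (b t)]; its first term does not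
    vanish at 0 by itself, whence the condition [u 0 = 0]. *)
Lemma oscillation_sin (t : R) : u 0 = 0 ->
  t ^+ 2 * (\int[mu]_(b in `[0, la]) (u b * sin (b * t))) =
  u1 la * sin (la * t) - \int[mu]_(b in `[0, la]) (u2 b * sin (b * t)).
Proof.
move=> u0.
have cc : continuous (fun b : R => sin (b * t)) by apply: continuousR_scale; exact: continuous_sin.
rewrite -RintegralZl //; last by apply: continuous_integrable_itv; exact: continuousRM.
apply/eqP; rewrite -subr_eq opprK -RintegralD //; last 2 first.
- by apply: continuous_integrable_itv; apply: continuousRM; [exact: cst_continuous|exact: continuousRM].
- by apply: continuous_integrable_itv; exact: continuousRM.
have dF (x : R) : is_derive x (1 : R) (fun b => - (t * u b * cos (b * t)) + u1 b * sin (b * t))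
    (t ^+ 2 * (u x * sin (x * t)) + u2 x * sin (x * t)).
  apply: is_derive_eq (derRD _ _
    (derRN _ (derRM _ _ (derRM (fun=> t) u (derR_cst t x) (du x)) (dcos t x)))
    (derRM _ _ (du1 x) (dsin t x))) _.
  ring.
have cf : continuous (fun x : R => t ^+ 2 * (u x * sin (x * t)) + u2 x * sin (x * t)).
  apply: continuousRD; last exact: continuousRM.
  by apply: (continuousRM (f := fun=> t ^+ 2)); [exact: cst_continuous|exact: continuousRM].
apply/eqP; rewrite (Rintegral_FTC la0 dF cf).
by rewrite ula u0 mul0r sin0; ring.
Qed.

Let osc_le (v e : R -> R) (t : R) : continuous v -> continuous e -> (forall x, `|e x| <= 1) ->
  `|\int[mu]_(b in `[0, la]) (v b * e (b * t))| <= \int[mu]_(b in `[0, la]) `|v b|.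
Proof.
move=> cv ce e1; apply: normr_Rintegral_itv_le.
- by apply: continuousRM => //; exact: continuousR_scale.
- exact: continuousR_norm.
- by move=> x; rewrite normrM ler_piMr.
Qed.

Lemma oscillation_cos_decay : exists M : R,
  forall t, `|\int[mu]_(b in `[0, la]) (u b * cos (b * t))| <= M / (1 + t ^+ 2).
Proof.
(* The first three terms bound [t ^+ 2] times the integral after integration by parts, the last one
   bounds the integral itself; their sum bounds [1 + t ^+ 2] times it. *)
exists (`|u1 la| + `|u1 0| + \int[mu]_(b in `[0, la]) `|u2 b| + \int[mu]_(b in `[0, la]) `|u b|) => t.
have p : 0 < 1 + t ^+ 2 by rewrite ltr_pwDl // sqr_ge0.
rewrite ler_pdivlMr // -[X in _ * X](gtr0_norm p) -normrM mulrDr mulr1 mulrC oscillation_cos.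
apply: (le_trans (ler_normD _ _)); rewrite addrC; apply: lerD; last first.
  apply: (@osc_le _ cos t cu); [exact: continuous_cos|exact: normr_cos_le1].
apply: (le_trans (ler_normB _ _)); apply: lerD; last first.
  apply: (@osc_le _ cos t cu2); [exact: continuous_cos|exact: normr_cos_le1].
apply: (le_trans (ler_normB _ _)); apply: lerD => //.
by rewrite normrM ler_piMr // ?normr_cos_le1.
Qed.

Lemma oscillation_sin_decay : u 0 = 0 -> exists M : R,
  forall t, `|\int[mu]_(b in `[0, la]) (u b * sin (b * t))| <= M / (1 + t ^+ 2).
Proof.
move=> u0.
exists (`|u1 la| + \int[mu]_(b in `[0, la]) `|u2 b| + \int[mu]_(b in `[0, la]) `|u b|) => t.
have p : 0 < 1 + t ^+ 2 by rewrite ltr_pwDl // sqr_ge0.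
rewrite ler_pdivlMr // -[X in _ * X](gtr0_norm p) -normrM mulrDr mulr1 mulrC oscillation_sin //.
apply: (le_trans (ler_normD _ _)); rewrite addrC; apply: lerD; last first.
  apply: (@osc_le _ sin t cu); [exact: continuous_sin|exact: normr_sin_le1].
apply: (le_trans (ler_normB _ _)); apply: lerD; last first.
  apply: (@osc_le _ sin t cu2); [exact: continuous_sin|exact: normr_sin_le1].
by rewrite normrM ler_piMr // ?normr_sin_le1.
Qed.

End oscillation.

Section C2.
Context {R : realType}.
Implicit Types f g : R -> R.

(** The regularity used by two integrations by parts. It is stable under sums, products and
    inverses, so the quotient of a tent by a squared modulus inherits it from the transforms. *)
Definition C2 f : Prop := exists f1 f2 : R -> R,
  [/\ forall x : R, is_derive x (1 : R) f (f1 x),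
      forall x : R, is_derive x (1 : R) f1 (f2 x) & continuous f2].

Lemma C2_continuous f : C2 f -> continuous f.
Proof. by move=> [f1 [_ [df _ _]]] x; exact: derR_continuous (df x). Qed.

Lemma C2_cst (c : R) : C2 (fun=> c).
Proof.
exists (fun=> 0), (fun=> 0); split => [x|x|x]; [exact: derR_cst|exact: derR_cst|exact: cvg_cst].
Qed.

Lemma C2_id : C2 (fun x => x).
Proof.
exists (fun=> 1), (fun=> 0); split => [x|x|x]; [exact: derR_id|exact: derR_cst|exact: cvg_cst].
Qed.

Lemma C2D f g : C2 f -> C2 g -> C2 (fun x => f x + g x).
Proof.
move=> [f1 [f2 [df df1 cf]]] [g1 [g2 [dg dg1 cg]]].
exists (fun x => f1 x + g1 x), (fun x => f2 x + g2 x); split.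
- by move=> x; exact: derRD.
- by move=> x; exact: derRD.
- exact: continuousRD.
Qed.

Lemma C2M f g : C2 f -> C2 g -> C2 (fun x => f x * g x).
Proof.
move=> [f1 [f2 [df df1 cf2]]] [g1 [g2 [dg dg1 cg2]]].
have cf : continuous f by move=> x; exact: derR_continuous (df x).
have cf1 : continuous f1 by move=> x; exact: derR_continuous (df1 x).
have cg : continuous g by move=> x; exact: derR_continuous (dg x).
have cg1 : continuous g1 by move=> x; exact: derR_continuous (dg1 x).
exists (fun x => f1 x * g x + f x * g1 x),
       (fun x => (f2 x * g x + f1 x * g1 x) + (f1 x * g1 x + f x * g2 x)); split.
- by move=> x; exact: derRM.
- by move=> x; apply: derRD; exact: derRM.
- by do !apply: continuousRD; exact: continuousRM.
Qed.

Lemma C2V f : (forall x, f x != 0) -> C2 f -> C2 (fun x => (f x)^-1).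
Proof.
move=> f0 [f1 [f2 [df df1 cf2]]].
have cf : continuous f by move=> x; exact: derR_continuous (df x).
have cf1 : continuous f1 by move=> x; exact: derR_continuous (df1 x).
have dV (x : R) : is_derive x (1 : R) (fun x => (f x)^-1) (- f1 x * ((f x)^-1 * (f x)^-1)).
  by apply: is_derive_eq (derRV f (f0 x) (df x)) _; rewrite -invfM expr2.
exists (fun x => - f1 x * ((f x)^-1 * (f x)^-1)),
       (fun x => - f2 x * ((f x)^-1 * (f x)^-1) + - f1 x * 
          ((- f1 x * ((f x)^-1 * (f x)^-1)) * (f x)^-1 + (f x)^-1 * (- f1 x * ((f x)^-1 * (f x)^-1)))).
have cV : continuous (fun x => (f x)^-1) by exact: continuousRV.
split => //.
- by move=> x; exact: (derRM _ _ (derRN _ (df1 x)) (derRM _ _ (dV x) (dV x))).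
- have cf1N := continuousRN cf1.
  apply: continuousRD; first by do !apply: continuousRM => //; exact: continuousRN.
  by apply: continuousRM => //; apply: continuousRD; do !apply: continuousRM.
Qed.

End C2.

(** * The Fejer kernel *)

Section fejer.
Context {R : realType}.
Notation mu := (@lebesgue_measure R).

(** The Fourier transform of the tent [1 - |b| / la] on [[-la, la]], folded onto [b >= 0]. For
    [t != 0] it equals [2 * (1 - cos (la t)) / (la * t^2)]; it is not normalised. *)
Definition fejer (la t : R) : R :=
  \int[mu]_(b in `[0, la]) (2 * (1 - b / la) * cos (b * t)).

(** Such an integral is a [transform] for Lebesgue measure, with the truncated [u] as weight and the
    identity in the role of [L]. *)
Lemma continuous_osc_integral (u e : R -> R) (la : R) : continuous u -> continuous e ->
  (forall x, `|e x| <= 1) -> continuous (fun t => \int[mu]_(b in `[0, la]) (u b * e (b * t))).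
Proof.
move=> cu ce e1.
rewrite (_ : (fun t => _) = transform mu (u \_ `[0, la]) (fun b => b) e); last first.
  apply/funext => t; rewrite /transform Rintegral_mkcond; apply: eq_Rintegral => b _.
  by rewrite !patchE; case: ifP => _; rewrite ?mul0r // mulrC [t * b]mulrC mulrC.
have Iu : mu.-integrable setT (EFin \o (u \_ `[0, la])).
  rewrite -restrict_EFin; apply: (iffLR (integrable_mkcond _ _)) => //.
  exact: continuous_integrable_itv.
apply: continuous_transform => //.
by apply/measurable_EFinP; exact: measurable_int Iu.
Qed.

Variable la : R.
Hypothesis la0 : 0 < la.

Let u (b : R) : R := 2 * (1 - b / la).

Let du (x : R) : is_derive x (1 : R) u (- 2 / la).
Proof.
apply: is_derive_eq (derRM (fun=> 2) _ (derR_cst 2 x) (derRD (fun=> 1) _ (derR_cst 1 x)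
  (derRN _ (derRM _ (fun=> la^-1) (derR_id x) (derR_cst la^-1 x))))) _.
ring.
Qed.

Let cu : continuous u.
Proof. by move=> x; exact: derR_continuous (du x). Qed.

Let ula : u la = 0.
Proof. by rewrite /u divff ?gt_eqF // subrr mulr0. Qed.

(** The tent is affine on [[0, la]], so its second derivative is 0 and only the boundary terms of
    the integration by parts remain. *)
Lemma fejer_sqr t : t ^+ 2 * fejer la t = 2 / la * (1 - cos (la * t)).
Proof.
have du1 (x : R) := derR_cst (- 2 / la) x.
have c0 : continuous (fun _ : R => 0 : R) by move=> x; exact: cvg_cst.
rewrite [LHS](oscillation_cos du du1 c0 la0 ula).
have -> : \int[mu]_(b in `[0, la]) (0 * cos (b * t)) = 0.
  by under eq_Rintegral do rewrite mul0r; rewrite Rintegral_cst // mul0r.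
ring.
Qed.

Lemma continuous_fejer : continuous (fejer la).
Proof. by apply: continuous_osc_integral => //; [exact: continuous_cos|exact: normr_cos_le1]. Qed.

(** For [b] in [[0, la]] the angle [b * t] has modulus at most 1, where the cosine is at least
    [cos 1]; the weight [2 * (1 - b / la)] has integral [la]. *)
Lemma fejer_near0 t : `|t| <= la^-1 -> la * cos 1 <= fejer la t.
Proof.
move=> tla.
have pi1 : (1 : R) < pi by apply: lt_le_trans (@pi_ge2 R); lra.
have cle (b : R) : 0 <= b <= la -> cos 1 <= cos (b * t).
  move=> /andP[b0 bla].
  have h : `|b * t| <= 1.
    rewrite normrM (ger0_norm b0) (le_trans (ler_pM _ _ bla tla)) //.
    by rewrite divff // gt_eqF.
  have -> : cos (b * t) = cos `|b * t|.
    by case: (ger0P (b * t)) => // _; rewrite cosN.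
  rewrite leNgt; apply/negP; rewrite ltr_cos ?in_itv /=; first by rewrite ltNge h.
  + by rewrite ler01 ltW.
  + by rewrite normr_ge0 (le_trans h) // ltW.
have cc : continuous (fun b : R => cos (b * t)) by apply: continuousR_scale; exact: continuous_cos.
rewrite (_ : la * cos 1 = \int[mu]_(b in `[0, la]) (u b * cos 1)); last first.
  rewrite RintegralZr //; last exact: continuous_integrable_itv.
  congr (_ * _).
  have dU (x : R) : is_derive x (1 : R) (fun b => 2 * b - b * b / la) (u x).
    apply: is_derive_eq (derRD _ _ (derRM (fun=> 2) _ (derR_cst 2 x) (derR_id x))
      (derRN _ (derRM _ (fun=> la^-1) (derRM _ _ (derR_id x) (derR_id x)) (derR_cst la^-1 x)))) _.
    by rewrite /u; field; rewrite gt_eqF.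
  by rewrite (Rintegral_FTC la0 dU cu); field; rewrite gt_eqF.
apply: le_Rintegral => //.
- apply: continuous_integrable_itv; apply: continuousRM => //; exact: cst_continuous.
- by apply: continuous_integrable_itv; exact: continuousRM.
- move=> b /=; rewrite in_itv /= => bla; apply: ler_wpM2l; last exact: cle.
  rewrite /u mulr_ge0 // subr_ge0 ler_pdivrMr // mul1r; by case/andP: bla.
Qed.

(** For [t != 0] the closed form decides; [t = 0], where that form says nothing, is covered by the
    bound near 0. *)
Lemma fejer_ge0 t : 0 <= fejer la t.
Proof.
have [->|t0] := eqVneq t 0.
  apply: le_trans (fejer_near0 _); first by rewrite mulr_ge0 ?ltW // cos1_gt0.
  by rewrite normr0 invr_ge0 ltW.
have := fejer_sqr t; have t2 : 0 < t ^+ 2 by rewrite exprn_even_gt0.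
move=> h; rewrite -(pmulr_rge0 _ t2) h; apply: mulr_ge0.
  by apply: divr_ge0 => //; exact: ltW.
by rewrite subr_ge0 cos_le1.
Qed.

(** Since [1 - cos] is at most 2. For large [la] this leaves little mass away from 0. *)
Lemma fejer_tail t : t ^+ 2 * fejer la t <= 4 / la.
Proof.
rewrite fejer_sqr; have := cos_geN1 (la * t) => h.
have : 0 < la^-1 by rewrite invr_gt0.
nra.
Qed.

End fejer.

(** * The Wiener-Tauberian argument *)

Section cauchy_kernel.
Context {R : realType}.
Notation mu := (@lebesgue_measure R).

Lemma measurable_cauchy : measurable_fun [set: R] (fun t : R => (1 + t ^+ 2)^-1).
Proof.
apply: continuous_measurable_fun.
exact: (@continuous_oneDsqrV R).
Qed.

Lemma integrable_cauchy : mu.-integrable setT (EFin \o (fun t : R => (1 + t ^+ 2)^-1)).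
Proof.
apply/integrableP; split; first by apply/measurable_EFinP; exact: measurable_cauchy.
have p (t : R) : 0 <= (1 + t ^+ 2)^-1 by rewrite invr_ge0 addr_ge0 // sqr_ge0.
under eq_integral do rewrite /= ger0_norm //.
rewrite ge0_symfun_integralT //.
- have -> : [set x : R | 0 <= x] = `[0, +oo[%classic.
    by apply/seteqP; split => x /=; rewrite in_itv /= andbT.
  have := @integral0y_oneDsqr R; rewrite /oneDsqr => ->.
  by rewrite -EFinM ltry.
- exact: (@continuous_oneDsqrV R).
- by move=> x /=; rewrite sqrrN.
Qed.

Lemma integrable_fejer (la : R) : 0 < la -> mu.-integrable setT (EFin \o fejer la).
Proof.
move=> la0; pose K := \int[mu]_(b in `[0, la]) `|2 * (1 - b / la)|.
have cu : continuous (fun b : R => 2 * (1 - b / la)).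
  apply: continuousRM; first by move=> x; exact: cvg_cst.
  apply: continuousRD; first by move=> x; exact: cvg_cst.
  by apply: continuousRN; apply: continuousRM; move=> x; [exact: cvg_id|exact: cvg_cst].
have fK t : fejer la t <= K.
  apply: (le_trans (ler_norm _)); apply: normr_Rintegral_itv_le.
  - by apply: continuousRM => //; apply: continuousR_scale; exact: continuous_cos.
  - exact: continuousR_norm.
  - by move=> x; rewrite normrM ler_piMr // normr_cos_le1.
apply: (@integrable_bounded_by _ _ _ mu _ (fun t => (K + 4 / la) * (1 + t ^+ 2)^-1)).
- by apply: continuous_measurable_fun; exact: continuous_fejer.
- exact: integrableRZ integrable_cauchy.
- apply: aeW => t; rewrite ger0_norm ?fejer_ge0 //.
  have p : 0 < 1 + t ^+ 2 by rewrite ltr_pwDl // sqr_ge0.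
  rewrite ler_pdivlMr // mulrDr mulr1 lerD // mulrC; exact: fejer_tail.
Qed.

End cauchy_kernel.

(** * Dividing the tent by the transform of the weight *)

Section division_kernel.
Context d {T : measurableType d} {R : realType} (P : {sigma_finite_measure set T -> \bar R}).
Variables (W L : T -> R).
Hypotheses (mL : measurable_fun setT L) (mW : measurable_fun setT W).
Hypothesis IW : P.-integrable setT (EFin \o W).
Hypothesis IWL : P.-integrable setT (EFin \o (fun w => W w * L w)).
Hypothesis IWLL : P.-integrable setT (EFin \o (fun w => W w * L w * L w)).
Notation C := (transform P W L cos).
Notation S := (transform P W L sin).
Notation mu := (@lebesgue_measure R).
Hypothesis CS0 : forall b, C b ^+ 2 + S b ^+ 2 != 0.

Let mWL : measurable_fun setT (fun w => W w * L w).
Proof. exact: measurable_funM. Qed.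
Let ccos : continuous (@cos R). Proof. exact: continuous_cos. Qed.
Let csin : continuous (@sin R). Proof. exact: continuous_sin. Qed.
Let cos1 := @normr_cos_le1 R.
Let sin1 := @normr_sin_le1 R.
Let cNsin : continuous (fun x : R => - sin x). Proof. exact: continuousRN. Qed.
Let Nsin1 (x : R) : `|- sin x| <= 1. Proof. by rewrite normrN. Qed.
Let cNcos : continuous (fun x : R => - cos x). Proof. exact: continuousRN. Qed.
Let Ncos1 (x : R) : `|- cos x| <= 1. Proof. by rewrite normrN. Qed.
Let dNsin (x : R) : is_derive x (1 : R) (fun x : R => - sin x) (- cos x).
Proof. exact: derRN (is_derive_sin x). Qed.

(** Two differentiations under the integral, dominated by [|W * L|] and [|W * L * L|]: this is where
    the two logarithmic moments enter. *)
Lemma C2_transform_cos : C2 C.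
Proof.
exists (transform P (fun w => W w * L w) L (fun x => - sin x)).
exists (transform P (fun w => W w * L w * L w) L (fun x => - cos x)).
split.
- by move=> b; exact: (is_derive_transform mL mW IW ccos cos1 IWL (@is_derive_cos R) Nsin1).
- by move=> b; exact: (is_derive_transform mL mWL IWL cNsin Nsin1 IWLL dNsin Ncos1).
- by apply: continuous_transform => //; exact: measurable_funM.
Qed.

Lemma C2_transform_sin : C2 S.
Proof.
exists (transform P (fun w => W w * L w) L cos).
exists (transform P (fun w => W w * L w * L w) L (fun x => - sin x)).
split.
- by move=> b; exact: (is_derive_transform mL mW IW csin sin1 IWL (@is_derive_sin R) cos1).
- by move=> b; exact: (is_derive_transform mL mWL IWL ccos cos1 IWLL (@is_derive_cos R) Nsin1).
- by apply: continuous_transform => //; exact: measurable_funM.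
Qed.

Variable la : R.
Hypothesis la0 : 0 < la.

Let tri (b : R) : R := 2 * (1 - b / la).
Let den (b : R) : R := C b ^+ 2 + S b ^+ 2.
(** In complex notation [ca + i cs = tri / (C - i S)]: the tent over the conjugate of the transform,
    written with the squared modulus [den] as denominator. *)
Let ca (b : R) : R := tri b * C b * (den b)^-1.
Let cs (b : R) : R := tri b * S b * (den b)^-1.

Let C2tri : C2 tri.
Proof.
have -> : tri = fun b => 2 * (1 + (- la^-1) * b) by apply/funext => b; rewrite /tri; ring.
by apply: C2M; [exact: C2_cst|apply: C2D; [exact: C2_cst|apply: C2M; [exact: C2_cst|exact: C2_id]]].
Qed.
Let C2den : C2 den.
Proof. by apply: C2D; apply: C2M; exact: C2_transform_cos || exact: C2_transform_sin. Qed.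
Let C2ca : C2 ca.
Proof. by apply: C2M; [apply: C2M => //; exact: C2_transform_cos|exact: C2V]. Qed.
Let C2cs : C2 cs.
Proof. by apply: C2M; [apply: C2M => //; exact: C2_transform_sin|exact: C2V]. Qed.

(* The function whose Fourier transform is that of [fejer la] divided by that
   of the image of [W P] under [L]. *)
Definition division_kernel (t : R) : R :=
  \int[mu]_(b in `[0, la]) (ca b * cos (b * t) - cs b * sin (b * t)).

Let cca : continuous ca := C2_continuous C2ca.
Let ccs : continuous cs := C2_continuous C2cs.

Let division_kernelE t : division_kernel t =
  \int[mu]_(b in `[0, la]) (ca b * cos (b * t)) - \int[mu]_(b in `[0, la]) (cs b * sin (b * t)).
Proof.
by rewrite /division_kernel RintegralB //; apply: continuous_integrable_itv;
   apply: continuousRM => //; exact: continuousR_scale.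
Qed.

Lemma continuous_division_kernel : continuous division_kernel.
Proof.
rewrite (funext division_kernelE).
by apply: continuousRD; last apply: continuousRN; exact: continuous_osc_integral.
Qed.

(** The boundary values required by the oscillation bounds vanish: [tri la = 0] annihilates both
    coefficients at [la], and the sine transform is 0 at 0, hence so is [cs]. *)
Lemma division_kernel_decay : exists2 M : R, 0 <= M &
  forall t, `|division_kernel t| <= M / (1 + t ^+ 2).
Proof.
have tla : tri la = 0 by rewrite /tri divff ?gt_eqF // subrr mulr0.
have S0 : S 0 = 0.
  by rewrite /transform; under eq_Rintegral do rewrite mul0r sin0 mulr0; rewrite Rintegral_cst // mul0r.
have [a1 [a2 [da da1 ca2]]] := C2ca.
have [s1 [s2 [ds ds1 cs2]]] := C2cs.
have [|M1 hM1] := oscillation_cos_decay da da1 ca2 la0.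
  by rewrite /ca tla !mul0r.
have [||M2 hM2] := oscillation_sin_decay ds ds1 cs2 la0.
- by rewrite /cs tla !mul0r.
- by rewrite /cs S0 mulr0 mul0r.
have p (t : R) : 0 < 1 + t ^+ 2 by rewrite ltr_pwDl // sqr_ge0.
have M10 : 0 <= M1.
  by have := hM1 0; rewrite expr0n addr0 divr1; exact: le_trans.
have M20 : 0 <= M2.
  by have := hM2 0; rewrite expr0n addr0 divr1; exact: le_trans.
exists (M1 + M2); first exact: addr_ge0.
move=> t; rewrite division_kernelE (le_trans (ler_normB _ _)) // mulrDl.
by apply: lerD.
Qed.

Lemma integrable_division_kernel : mu.-integrable setT (EFin \o division_kernel).
Proof.
have [M M0 hM] := division_kernel_decay.
apply: (@integrable_bounded_by _ _ _ mu _ (fun t => M * (1 + t ^+ 2)^-1)).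
- exact: continuous_measurable_fun continuous_division_kernel.
- exact: integrableRZ integrable_cauchy.
- exact: aeW.
Qed.

(** The kernel is the integral of the real part of [(ca + i cs) * exp (i b t)]. Replacing [t] by
    [t - L w] and integrating over [w] first multiplies this by [C - i S], which cancels the
    denominator and leaves the tent times [cos (b t)]. *)
Lemma transform_division_kernel t :
  \int[P]_w (W w * division_kernel (t - L w)) = fejer la t.
Proof.
pose D : set R := `[0, la]%classic.
pose MR : measurableType _ := measurableTypeR R.
pose g (z : T * MR) : R := W z.1 * (\1_D z.2 *
  (ca z.2 * cos (z.2 * (t - L z.1)) - cs z.2 * sin (z.2 * (t - L z.1)))).
have rD (f : R -> R) : \int[mu]_(b in `[0, la]) f b = \int[mu]_b (\1_D b * f b).
  rewrite Rintegral_mkcond; apply: eq_Rintegral => b _.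
  by rewrite patchE indicE /D; case: (b \in _); rewrite ?mul1r ?mul0r.
have mD : measurable_fun setT (\1_D : MR -> R) by apply: measurable_indic; exact: measurable_itv.
have msnd (f : MR -> R) : measurable_fun setT f -> measurable_fun setT (fun z : T * MR => f z.2).
  by move=> mf; exact: measurableT_comp mf measurable_snd.
have marg : measurable_fun setT (fun z : T * MR => z.2 * (t - L z.1)).
  apply: measurable_funM => //; apply: measurable_funB => //.
  exact: measurableT_comp mL measurable_fst.
have mca : measurable_fun setT (ca : MR -> R) by exact: continuous_measurable_fun cca.
have mcs : measurable_fun setT (cs : MR -> R) by exact: continuous_measurable_fun ccs.
have mg : measurable_fun setT g.
  apply: measurable_funM; first exact: measurableT_comp mW measurable_fst.
  apply: measurable_funM; first exact: msnd.
  apply: measurable_funB; apply: measurable_funM.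
  - exact: msnd.
  - exact: measurableT_comp (continuous_measurable_fun ccos) marg.
  - exact: msnd.
  - exact: measurableT_comp (continuous_measurable_fun csin) marg.
have cK : continuous (fun b => `|ca b| + `|cs b|).
  by apply: continuousRD; exact: continuousR_norm.
have IK : mu.-integrable setT (EFin \o (fun b => \1_D b * (`|ca b| + `|cs b|))).
  rewrite (_ : _ \o _ = (EFin \o (fun b => `|ca b| + `|cs b|)) \_ D); last first.
    apply/funext => b; rewrite patchE /= indicE; case: (b \in _); rewrite ?mul1r ?mul0r //.
  rewrite /D; apply: (iffLR (integrable_mkcond _ _)) => //.
  exact: continuous_integrable_itv.
have gle w b : `|g (w, b)| <= `|W w| * (\1_D b * (`|ca b| + `|cs b|)).
  rewrite /g /= normrM ler_wpM2l // normrM ger0_norm ?ler_wpM2l //; last first.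
  rewrite (le_trans (ler_normB _ _)) // !normrM lerD // ler_piMr //.
transitivity (\int[P]_w (\int[mu]_b g (w, b))).
  apply: eq_Rintegral => w _.
  rewrite /division_kernel -RintegralZl //; last first.
    apply: continuous_integrable_itv; apply: continuousRD; last apply: continuousRN.
    - by apply: continuousRM => //; exact: continuousR_scale.
    - by apply: continuousRM => //; exact: continuousR_scale.
  by rewrite rD; apply: eq_Rintegral => b _; rewrite /g /= mulrCA.
rewrite (Rintegral_swap mg (integrable_norm IW) IK gle).
rewrite /fejer rD; apply: eq_Rintegral => b _.
(* The coefficients of [cos (b * L w)] and [sin (b * L w)] once the addition formulas have been
   applied to [b * (t - L w)]. *)
pose k1 := \1_D b * (ca b * cos (b * t) - cs b * sin (b * t)).
pose k2 := \1_D b * (ca b * sin (b * t) + cs b * cos (b * t)).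
have Ic := integrable_transform mL mW IW ccos cos1 b.
have Is := integrable_transform mL mW IW csin sin1 b.
transitivity (\int[P]_w (k1 * (W w * cos (b * L w)) + k2 * (W w * sin (b * L w)))).
  apply: eq_Rintegral => w _; rewrite /g /= (mulrBr b) cosB sinB /k1 /k2; ring.
rewrite RintegralD //; [|exact: integrableRZ|exact: integrableRZ].
rewrite !RintegralZl // -/(transform P W L cos b) -/(transform P W L sin b).
by rewrite /k1 /k2 /ca /cs /den -/(tri b); have := CS0 b => h; field.
Qed.

(** Writing [fejer la v] as the average of [division_kernel (v - L w)] and substituting
    [v = r + L w] moves the measure from the kernel to [Q]. *)
Lemma fejer_convolution (Q : R -> R) (B t : R) :
  measurable_fun setT Q -> (forall x, `|Q x| <= B) ->
  \int[mu]_v (fejer la v * Q (t - v)) =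
  \int[mu]_r (division_kernel r * \int[P]_w (W w * Q (t - r - L w))).
Proof.
move=> mQ QB.
have B0 : 0 <= B by exact: le_trans (normr_ge0 _) (QB 0).
pose MR : measurableType _ := measurableTypeR R.
have mK : measurable_fun setT (division_kernel : MR -> R).
  exact: continuous_measurable_fun continuous_division_kernel.
have mQ' : measurable_fun setT (Q : MR -> R) by exact: mQ.
have IK := integrable_division_kernel.
have [M M0 hM] := division_kernel_decay.
have KM x : `|division_kernel x| <= M.
  apply: (le_trans (hM x)); rewrite ler_pdivrMr ?ltr_pwDl ?sqr_ge0 //.
  by rewrite ler_peMr // lerDl sqr_ge0.
have mW1 : measurable_fun setT (fun z : T * MR => W z.1).
  exact: measurableT_comp mW measurable_fst.
have mL1 : measurable_fun setT (fun z : T * MR => L z.1).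
  exact: measurableT_comp mL measurable_fst.
(* The function [g] is dominated by a product of functions of [w] and of [r]; [h] is its translate
   in [r] by [L w] and has no such bound. Integrability of [h] is therefore carried over from [g],
   section by section, by translation invariance. *)
pose g (z : T * MR) : R := W z.1 * (division_kernel z.2 * Q (t - z.2 - L z.1)).
pose h (z : T * MR) : R := W z.1 * (division_kernel (z.2 - L z.1) * Q (t - z.2)).
have mg : measurable_fun setT g.
  apply: measurable_funM => //; apply: measurable_funM.
    exact: measurableT_comp mK measurable_snd.
  apply: (measurableT_comp mQ'); apply: measurable_funB => //.
  by apply: measurable_funB => //; exact: measurable_snd.
have mh : measurable_fun setT h.
  apply: measurable_funM => //; apply: measurable_funM.
    apply: (measurableT_comp mK); apply: measurable_funB => //; exact: measurable_snd.
  by apply: (measurableT_comp mQ'); apply: measurable_funB => //; exact: measurable_snd.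
have gle w r : `|g (w, r)| <= `|W w| * (B * `|division_kernel r|).
  by rewrite /g !normrM ler_wpM2l // mulrC ler_wpM2r.
have IBK : mu.-integrable setT (EFin \o (fun r => B * `|division_kernel r|)).
  by apply: integrableRZ; exact: integrable_norm.
have gh w r : g (w, r + - L w) = h (w, r).
  by rewrite /g /h /=; congr (_ * (_ * Q _)); ring.
have mgw w : measurable_fun setT (fun r => g (w, r)) by exact: measurableT_comp mg _.
have Ih1 w : mu.-integrable setT (EFin \o (fun r => h (w, r))).
  have := @integrable_section1 _ _ _ _ _ mu _ _ _ mg IBK gle w.
  move=> /integrableP[_ hoo]; apply/integrableP; split.
    by apply/measurable_EFinP; exact: measurableT_comp mh _.
  rewrite (_ : integral _ _ _ = \int[mu]_r `|(g (w, r))%:E|)%E //.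
  rewrite -(integral_shift (- L w) (f := fun r => `|(g (w, r))%:E|%E)).
    by apply: eq_integral => r _; rewrite /= gh.
  by apply: measurableT_comp => //; apply/measurable_EFinP; exact: (mgw w).
have Ih2 r : P.-integrable setT (EFin \o (fun w => h (w, r))).
  apply: (@integrable_bounded_by _ _ _ P _ (fun w => M * B * `|W w|)).
  - exact: measurableT_comp mh _.
  - by apply: integrableRZ; exact: integrable_norm.
  - by apply: aeW => w; rewrite /h !normrM mulrC ler_wpM2r // ler_pM.
transitivity (\int[mu]_r \int[P]_w h (w, r)).
  apply: eq_Rintegral => v _.
  rewrite -(transform_division_kernel v) -RintegralZr //; last first.
    apply: (@integrable_bounded_by _ _ _ P _ (fun w => M * `|W w|)).
    + apply: measurable_funM => //; apply: (measurableT_comp mK); exact: measurable_funB.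
    + by apply: integrableRZ; exact: integrable_norm.
    + by apply: aeW => w; rewrite normrM mulrC ler_wpM2r.
  by apply: eq_Rintegral => w _; rewrite /h /= mulrA.
transitivity (\int[P]_w \int[mu]_r h (w, r)).
  apply/esym/Rintegral_fubini => //.
  apply: (integrable_prod_section mh Ih1 (a := fun w => (\int[mu]_r (B * `|division_kernel r|)) * `|W w|)).
    by apply: integrableRZ; exact: integrable_norm.
  move=> w; rewrite (_ : Rintegral _ _ _ = \int[mu]_r `|g (w, r)|); last first.
    rewrite -(Rintegral_shift (- L w) (f := fun r => `|g (w, r)|)).
      by apply: eq_Rintegral => r _; rewrite gh.
    by apply: measurableT_comp => //; exact: (mgw w).
  rewrite mulrC -RintegralZl //; apply: le_Rintegral => //.
  - have := integrable_norm (@integrable_section1 _ _ _ _ _ mu _ _ _ mg IBK gle w); exact.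
  - exact: integrableRZ.
transitivity (\int[P]_w \int[mu]_r g (w, r)).
  apply: eq_Rintegral => w _.
  rewrite -(Rintegral_shift (- L w) (f := fun r => g (w, r))).
    by apply: eq_Rintegral => r _; rewrite gh.
  exact: (mgw w).
rewrite (Rintegral_swap mg (integrable_norm IW) IBK gle).
apply: eq_Rintegral => r _; rewrite -RintegralZl //; last first.
  apply: (@integrable_bounded_by _ _ _ P _ (fun w => B * `|W w|)).
  - apply: measurable_funM => //; apply: (measurableT_comp mQ); exact: measurable_funB.
  - by apply: integrableRZ; exact: integrable_norm.
  - by apply: aeW => w; rewrite normrM mulrC ler_wpM2r.
by apply: eq_Rintegral => w _; rewrite /g /= mulrCA.
Qed.

End division_kernel.

(** * From Fejer means to the limit *)

Section wiener.
Context d {T : measurableType d} {R : realType} (P : {sigma_finite_measure set T -> \bar R}).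
Variables (W L : T -> R).
Hypotheses (mL : measurable_fun setT L) (mW : measurable_fun setT W).
Hypothesis IW : P.-integrable setT (EFin \o W).
Hypothesis IWL : P.-integrable setT (EFin \o (fun w => W w * L w)).
Hypothesis IWLL : P.-integrable setT (EFin \o (fun w => W w * L w * L w)).
Notation mu := (@lebesgue_measure R).
Hypothesis CS0 : forall b, transform P W L cos b ^+ 2 + transform P W L sin b ^+ 2 != 0.

(** The convolution identity for the constant function 1. *)
Let integral_fejer la : 0 < la ->
  \int[mu]_v fejer la v = (\int[P]_w W w) * \int[mu]_r division_kernel P W L la r.
Proof.
move=> la0.
have h := @fejer_convolution _ _ _ P W L mL mW IW IWL IWLL CS0 la la0 (fun=> 1) 1 0.
transitivity (\int[mu]_v (fejer la v * 1)); first by apply: eq_Rintegral => v _; rewrite mulr1.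
rewrite h //; last by move=> x; rewrite normr1.
rewrite -RintegralZl //; last exact: integrable_division_kernel.
apply: eq_Rintegral => r _; rewrite mulrC; congr (_ * _).
by apply: eq_Rintegral => w _; rewrite mulr1.
Qed.

Variables (Q : R -> R) (B c : R).
Hypotheses (mQ : measurable_fun setT Q) (QB : forall x, `|Q x| <= B).
Hypothesis WQc : \int[P]_w (W w * Q (t - L w)) @[t --> +oo] --> c.

(** After the convolution identity, the average against [W] tends to [c] for each fixed shift [r];
    dominated convergence in [r] applies since the division kernel is integrable and the averages
    are bounded by [V]. *)
Lemma fejer_convolution_cvg la : 0 < la ->
  \int[mu]_v (fejer la v * Q (t - v)) @[t --> +oo] -->
  c * \int[mu]_r division_kernel P W L la r.
Proof.
move=> la0; pose psi := division_kernel P W L la.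
have B0 : 0 <= B by exact: le_trans (normr_ge0 _) (QB 0).
rewrite (funext (fun t => fejer_convolution mL mW IW IWL IWLL CS0 la0 t mQ QB)).
rewrite -/psi.
have Ipsi : mu.-integrable setT (EFin \o psi) by exact: integrable_division_kernel.
pose MR : measurableType _ := measurableTypeR R.
have cpsi : continuous psi by exact: continuous_division_kernel.
have mpsi : measurable_fun setT (psi : MR -> R) by exact: continuous_measurable_fun cpsi.
rewrite -RintegralZl //.
pose V := \int[P]_w (B * `|W w|).
have IBW : P.-integrable setT (EFin \o (fun w => B * `|W w|)).
  by apply: integrableRZ; exact: integrable_norm.
have mWQ s : measurable_fun setT (fun w => W w * Q (s - L w)).
  by apply: measurable_funM => //; apply: (measurableT_comp mQ); exact: measurable_funB.
have WQV s : `|\int[P]_w (W w * Q (s - L w))| <= V.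
  apply: normr_Rintegral_le => //.
  by apply: aeW => w; rewrite normrM mulrC ler_wpM2r.
apply: (@Rintegral_cvg_pinfty _ _ _ mu
   (fun t r => psi r * \int[P]_w (W w * Q (t - r - L w))) _ (fun r => V * `|psi r|)).
- move=> t; pose g (z : T * MR) : R := W z.1 * (psi z.2 * Q (t - z.2 - L z.1)).
  have mg : measurable_fun setT g.
    apply: measurable_funM; first exact: measurableT_comp mW measurable_fst.
    apply: measurable_funM; first exact: measurableT_comp mpsi measurable_snd.
    apply: (measurableT_comp mQ); apply: measurable_funB.
      by apply: measurable_funB => //; exact: measurable_snd.
    exact: measurableT_comp mL measurable_fst.
  have gle w r : `|g (w, r)| <= `|W w| * (B * `|psi r|).
    by rewrite /g !normrM ler_wpM2l // mulrC ler_wpM2r.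
  have IBK : mu.-integrable setT (EFin \o (fun r => B * `|psi r|)).
    by apply: integrableRZ; exact: integrable_norm.
  have := measurable_Rintegral2 (integrable_prod_dominated mg (integrable_norm IW) IBK gle).
  apply: eq_measurable_fun => r _; rewrite -RintegralZl //.
    by apply: eq_Rintegral => w _; rewrite /g /= mulrCA.
  apply: (integrable_bounded_by _ IBW) => //.
  by apply: aeW => w; rewrite normrM mulrC ler_wpM2r.
- by apply: measurable_funM => //; exact: mpsi.
- by apply: integrableRZ; exact: integrable_norm.
- by apply: nearW => t; apply: aeW => r; rewrite normrM mulrC ler_wpM2r.
- apply: aeW => r; rewrite [c * _]mulrC; apply: cvgM; first exact: cvg_cst.
  apply: (cvg_comp (fun t => t - r) (fun s => \int[P]_w (W w * Q (s - L w)))); last exact: WQc.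
  exact: cvg_addrr.
Qed.

(** The integral of the division kernel is eliminated through [integral_fejer], so neither integral
    has to be computed. *)
Lemma fejer_mean_cvg la : 0 < la -> \int[P]_w W w != 0 ->
  \int[mu]_v (fejer la v * Q (t - v)) @[t --> +oo] -->
  c / (\int[P]_w W w) * \int[mu]_v fejer la v.
Proof.
move=> la0 m0; rewrite integral_fejer // mulrA divfK //.
exact: fejer_convolution_cvg.
Qed.

(** On [[0, la^-1]] the kernel is at least [la * cos 1]. A lower bound free of [la] is all that the
    concentration argument asks of the mass. *)
Lemma integral_fejer_ge la : 0 < la -> cos 1 <= \int[mu]_v fejer la v.
Proof.
move=> la0.
have -> : cos 1 = \int[mu]_(v in `[0, la^-1]) (la * cos 1).
  rewrite Rintegral_cst //= lebesgue_measure_itv /= lte_fin invr_gt0 la0 /= subr0.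
  by rewrite mulrAC divff ?mul1r // gt_eqF.
rewrite Rintegral_mkcond; apply: le_Rintegral => //.
- rewrite -restrict_EFin; apply: (iffLR (integrable_mkcond _ _)) => //.
  by apply: continuous_integrable_itv; exact: cst_continuous.
- exact: integrable_fejer.
- move=> v _; rewrite patchE; case: ifPn; last by rewrite fejer_ge0.
  rewrite inE /= in_itv /= => /andP[v0 vla].
  by apply: fejer_near0 => //; rewrite ger0_norm.
Qed.

Hypothesis Q0 : forall x, 0 <= Q x.
Hypothesis Qslow : forall k : R, 1 < k -> exists2 eta : R, 0 < eta & exists t0 : R,
  forall t s, t0 <= t -> 0 <= s <= eta -> Q (t + s) <= k * Q t.

(** On an interval of length [eta] the function [Q] rises at most by a factor [1 + del]. Hence [Q t]
    is at most [1 + del] times each value of [Q] on [[t - eta, t]], and each value on [[t, t + eta]]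
    is at most [1 + del] times [Q t]. Fejer means centred at the middle of these two windows tend to
    [q] times the mass of the kernel, and for large [la] what lies outside a window is
    negligible. *)
Lemma wiener_tauberian : 0 < \int[P]_w W w ->
  Q t @[t --> +oo] --> c / (\int[P]_w W w).
Proof.
move=> m0; set q := c / _.
have mn0 : \int[P]_w W w != 0 by rewrite gt_eqF.
have B0 : 0 <= B by exact: le_trans (normr_ge0 _) (QB 0).
have cos1 : 0 < cos (1 : R) := cos1_gt0 R.
have QleB x : Q x <= B by exact: le_trans (ler_norm _) (QB x).
have Ifej la : 0 < la -> forall t, mu.-integrable setT (EFin \o (fun v => fejer la v * Q (t - v))).
  move=> la0 t; apply: (@integrable_bounded_by _ _ _ mu _ (fun v => B * fejer la v)).
  - apply: measurable_funM.
      by apply: continuous_measurable_fun; exact: continuous_fejer.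
    by apply: (measurableT_comp mQ); exact: measurable_funB.
  - by apply: integrableRZ; exact: integrable_fejer.
  - apply: aeW => v; rewrite normrM ger0_norm ?fejer_ge0 // mulrC.
    by apply: ler_wpM2r => //; exact: fejer_ge0.
have q0 : 0 <= q.
  have l1 : (0 : R) < 1 := ltr01.
  have J0 : 0 <= q * \int[mu]_v fejer 1 v.
    apply: (cvgr_to_ge (fejer_mean_cvg l1 mn0)); apply: nearW => t.
    by apply: Rintegral_ge0 => v _; rewrite mulr_ge0 // fejer_ge0.
  by rewrite -(pmulr_lge0 q (lt_le_trans cos1 (integral_fejer_ge l1))).
apply/cvgrPdist_le => e e0.
(* With [e = del * D], the constant [D] exceeds the total coefficient of [del] in both final
   estimates; its summand [e] also forces [del <= 1]. *)
pose D := 3 + 2 * q + e + B.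
have D0 : 0 < D by rewrite /D; lra.
pose del := e / D.
have del0 : 0 < del by rewrite divr_gt0.
have delD : del * D = e by rewrite /del divfK // gt_eqF.
have del1 : del <= 1 by rewrite /del ler_pdivrMr // mul1r /D; lra.
have [|eta eta0 [t0 slow]] := Qslow (k := 1 + del); first lra.
pose Z := \int[mu]_v (1 + v ^+ 2)^-1.
(* By [fejer_tail], [la * v^2 * fejer] is at most 4, and for [|v| > eta / 2] so [la * fejer] is at
   most [4 * (4 / eta^2)]; the sum of the two bounds is [A]. *)
pose A := 4 * (1 + 4 / eta ^+ 2).
have A0 : 0 <= A by rewrite mulr_ge0 // addr_ge0 // divr_ge0 // sqr_ge0.
have Z0 : 0 <= Z by apply: Rintegral_ge0 => v _; rewrite invr_ge0 addr_ge0 // sqr_ge0.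
(* Large enough for the integral [A * Z / la] of [tau] to be at most [del * cos 1], hence at most
   [del * I]; the summand 1 only makes it positive. *)
pose la := A * Z / (del * cos 1) + 1.
have dc : 0 < del * cos 1 by exact: mulr_gt0.
have la0 : 0 < la by apply: ltr_wpDl => //; apply: divr_ge0; [exact: mulr_ge0|exact: ltW].
pose I := \int[mu]_v fejer la v.
have I0 : cos 1 <= I by exact: integral_fejer_ge.
have Igt0 : 0 < I by exact: lt_le_trans I0.
pose tau v := A / la * (1 + v ^+ 2)^-1.
have Itau : mu.-integrable setT (EFin \o tau) by apply: integrableRZ; exact: integrable_cauchy.
have tau0 v : 0 <= tau v.
  apply: mulr_ge0; first by apply: divr_ge0 => //; exact: ltW.
  by rewrite invr_ge0 addr_ge0 // sqr_ge0.
have tauI : \int[mu]_v tau v <= del * I.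
  rewrite RintegralZl //; last exact: integrable_cauchy.
  rewrite -/Z mulrAC ler_pdivrMr //.
  have : A * Z <= del * cos 1 * la.
    rewrite /la mulrDr mulr1 [X in _ <= X + _]mulrC divfK ?gt_eqF //.
    by rewrite lerDl ltW.
  move=> h; apply: (le_trans h); apply: ler_wpM2r; first exact: ltW.
  by apply: ler_wpM2l => //; exact: ltW.
have fejtau v : eta / 2 < `|v| -> fejer la v <= tau v.
  move=> hv; have p : 0 < 1 + v ^+ 2 by rewrite ltr_pwDl // sqr_ge0.
  have v2 : eta ^+ 2 <= 4 * v ^+ 2.
    have : (eta / 2) ^+ 2 <= `|v| ^+ 2.
      by apply: lerXn2r; rewrite ?nnegrE //; [apply: divr_ge0 => //|]; exact: ltW.
    rewrite real_normK ?num_real // => h; nra.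
  have e2 : 0 < eta ^+ 2 by rewrite exprn_gt0.
  rewrite /tau ler_pdivlMr // ler_pdivlMr //.
  have h4 := fejer_tail la0 v.
  have h4' : v ^+ 2 * fejer la v * la <= 4 by rewrite -ler_pdivlMr.
  have f0 := fejer_ge0 la0 v.
  have : fejer la v * la <= 4 * (4 / eta ^+ 2).
    rewrite mulrA ler_pdivlMr //.
    apply: (@le_trans _ _ (fejer la v * la * (4 * v ^+ 2))).
      by apply: ler_wpM2l => //; apply: mulr_ge0 => //; exact: ltW.
    by rewrite [leLHS](_ : _ = 4 * (v ^+ 2 * fejer la v * la)); [exact: ler_wpM2l|ring].
  rewrite /A => h5; nra.
(* In [key] and [key2] the pointwise hypothesis is used for [|v| <= eta / 2]; elsewhere the kernel
   is below [tau] and [B] bounds the values compared, at a total cost of [B * (del * I)]. *)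
have key (t x k : R) : (forall v, `|v| <= eta / 2 -> x <= k * Q (t - v)) -> x <= B -> 0 <= k ->
    x * I <= k * \int[mu]_v (fejer la v * Q (t - v)) + B * (del * I).
  move=> hx xB k0.
  apply: (@le_trans _ _ (\int[mu]_v (k * (fejer la v * Q (t - v)) + B * tau v))); last first.
    rewrite RintegralD //; [|exact: integrableRZ (Ifej _ la0 t)|exact: integrableRZ].
    rewrite [X in X + _ <= _]RintegralZl //; last exact: Ifej.
    rewrite [X in _ + X <= _]RintegralZl //.
    by apply: lerD => //; apply: ler_wpM2l.
  rewrite -RintegralZl //; last exact: integrable_fejer.
  apply: le_Rintegral => //.
  - by apply: integrableRZ; exact: integrable_fejer.
  - by apply: integrableRD; apply: integrableRZ => //; exact: Ifej.
  - move=> v _; have f0 := fejer_ge0 la0 v; have [hv|hv] := leP `|v| (eta / 2).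
      apply: (@le_trans _ _ (k * (fejer la v * Q (t - v)))); last by rewrite lerDl mulr_ge0.
      by rewrite mulrC mulrCA; apply: ler_wpM2l => //; exact: hx.
    apply: (@le_trans _ _ (B * tau v)).
      apply: (@le_trans _ _ (B * fejer la v)); first exact: ler_wpM2r.
      by apply: ler_wpM2l => //; exact: fejtau.
    by rewrite lerDr !mulr_ge0.
have key2 (t x : R) : (forall v, `|v| <= eta / 2 -> Q (t - v) <= x) -> 0 <= x ->
    \int[mu]_v (fejer la v * Q (t - v)) <= x * I + B * (del * I).
  move=> hx x0.
  apply: (@le_trans _ _ (\int[mu]_v (x * fejer la v + B * tau v))); last first.
    rewrite RintegralD //; [|by apply: integrableRZ; exact: integrable_fejer|exact: integrableRZ].
    rewrite [X in X + _ <= _]RintegralZl //; last exact: integrable_fejer.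
    rewrite [X in _ + X <= _]RintegralZl //.
    by apply: lerD => //; apply: ler_wpM2l.
  apply: le_Rintegral => //.
  - exact: Ifej.
  - by apply: integrableRD; apply: integrableRZ => //; exact: integrable_fejer.
  - move=> v _; have f0 := fejer_ge0 la0 v; have [hv|hv] := leP `|v| (eta / 2).
      apply: (@le_trans _ _ (x * fejer la v)); last by rewrite lerDl mulr_ge0.
      by rewrite mulrC; apply: ler_wpM2r => //; exact: hx.
    apply: (@le_trans _ _ (B * tau v)).
      apply: (@le_trans _ _ (B * fejer la v)); first by rewrite mulrC; exact: ler_wpM2r.
      by apply: ler_wpM2l => //; exact: fejtau.
    by rewrite lerDr !mulr_ge0.
have [t1 [_ ht1]] : \forall t \near +oo, `|q * I - \int[mu]_v (fejer la v * Q (t - v))| <= del * I.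
  have := fejer_mean_cvg la0 mn0; rewrite -/q -/I => /cvgrPdist_le; apply.
  exact: mulr_gt0.
near=> t.
have eta2 : 0 < eta / 2 by rewrite divr_gt0.
have tt0 : t0 + 2 * eta <= t by near: t; apply: nbhs_pinfty_ge; exact: num_real.
have tt1 : t1 + eta < t by near: t; apply: nbhs_pinfty_gt; exact: num_real.
have absle v : `|v| <= eta / 2 -> - (eta / 2) <= v <= eta / 2 by rewrite ler_norml.
(* The window lies to the left of [t], with centre [t - eta / 2]. *)
have up : Q t <= q + e.
  have J : \int[mu]_v (fejer la v * Q (t - eta / 2 - v)) <= (q + del) * I.
    have /ht1 : t1 < t - eta / 2 by lra.
    by rewrite ler_norml => /andP[h _]; lra.
  have hx v : `|v| <= eta / 2 -> Q t <= (1 + del) * Q (t - eta / 2 - v).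
    move=> /absle /andP[v1 v2].
    have {1}-> : t = (t - eta / 2 - v) + (eta / 2 + v) by ring.
    by apply: slow; [lra|apply/andP; split; lra].
  have k0 : 0 <= 1 + del by lra.
  have h := key _ _ _ hx (QleB t) k0.
  have h2 : Q t * I <= ((1 + del) * (q + del) + B * del) * I.
    apply: (le_trans h).
    rewrite [leRHS](_ : _ = (1 + del) * ((q + del) * I) + B * (del * I)); last ring.
    by rewrite lerD2r; exact: ler_wpM2l.
  have h3 : Q t <= (1 + del) * (q + del) + B * del by rewrite -(ler_pM2r Igt0).
  by apply: (le_trans h3); rewrite -delD /D; nra.
(* The window lies to the right of [t], with centre [t + eta / 2]. *)
have low : q - e <= Q t.
  have J : (q - del) * I <= \int[mu]_v (fejer la v * Q (t + eta / 2 - v)).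
    have /ht1 : t1 < t + eta / 2 by lra.
    by rewrite ler_norml => /andP[_ h]; lra.
  have hx v : `|v| <= eta / 2 -> Q (t + eta / 2 - v) <= (1 + del) * Q t.
    move=> /absle /andP[v1 v2].
    rewrite [X in Q X](_ : _ = t + (eta / 2 - v)); last ring.
    by apply: slow; [lra|apply/andP; split; lra].
  have k0 : 0 <= (1 + del) * Q t by apply: mulr_ge0 => //; lra.
  have h := key2 _ _ hx k0.
  have h2 : (q - del) * I <= ((1 + del) * Q t + B * del) * I.
    apply: (le_trans J).
    by rewrite [leRHS](_ : _ = (1 + del) * Q t * I + B * (del * I)); last ring.
  have h3 : q - del <= (1 + del) * Q t + B * del by rewrite -(ler_pM2r Igt0).
  rewrite -(ler_pM2l (x := 1 + del)); last lra.
  by rewrite -delD /D; nra.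
by rewrite ler_norml; apply/andP; split; lra.
Unshelve. all: by end_near. Qed.

End wiener.

(** * Regular variation and Breiman's lemma *)

Section regular_variation.
Context {R : realType}.
Variables (K : R -> R) (alpha : R).
Hypotheses (Kni : nonincreasing_fun K) (K0 : forall x, 0 <= K x).
Hypothesis rvK : regularly_varying K alpha.

(** The quotient at [y = 1] tends to 1 and would be 0 wherever [K] is 0, as division by 0 gives 0.
    So [K] is positive far out, and monotonicity carries this back to every [x]. *)
Lemma regularly_varying_gt0 x : 0 < K x.
Proof.
have [M [_ hM]] : \forall x \near +oo, 0 < K (x * 1) / (1 `^ (- alpha) * K x).
  by apply: (cvgr_gt (1 : R)) => //; exact: rvK.
have := hM (Num.max (M + 1) x); rewrite lt_max ltrDl ltr01 /= => /(_ isT).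
rewrite mulr1 powR1 mul1r => h.
have : 0 < K (Num.max (M + 1) x).
  rewrite lt_neqAle K0 andbT eq_sym; apply/eqP => e.
  by move: h; rewrite e mul0r ltxx.
by move=> /lt_le_trans; apply; apply: Kni; rewrite le_max lexx orbT.
Qed.
Let Kp := regularly_varying_gt0.

Lemma regularly_varying_ratio y : 0 < y -> K (x * y) / K x @[x --> +oo] --> y `^ (- alpha).
Proof.
move=> y0; have := rvK y0 => h.
have p : 0 < y `^ (- alpha) := powR_gt0 _ y0.
rewrite (_ : (fun x => K (x * y) / K x) =
  (fun x => y `^ (- alpha) * (K (x * y) / (y `^ (- alpha) * K x)))); last first.
  by apply/funext => x; have k := Kp x; field; rewrite !gt_eqF.
by rewrite -[X in _ --> X]mulr1; apply: cvgM; [exact: cvg_cst|exact: h].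
Qed.

Lemma regularly_varying_ratioV y : 0 < y -> K (x / y) / K x @[x --> +oo] --> y `^ alpha.
Proof.
move=> y0; have := @regularly_varying_ratio y^-1; rewrite invr_gt0 => /(_ y0).
by rewrite -powR_inv1 ?(ltW y0) // -powRrM mulN1r opprK.
Qed.

Variable (p : R).
Hypotheses (ap : alpha < p) (p0 : 0 < p) (K1 : forall x, K x <= 1).

(** A Potter-type bound. As [alpha < p], doubling the argument eventually divides [K] by at most
    [2 ^ p], and iterating this controls [K (x / y)] for [y >= 1] as long as [x / y] stays beyond
    [A]. For [y <= 1] monotonicity suffices, which is the summand 1. *)
Lemma potter_bound : exists C A : R, [/\ 0 <= C, 0 < A &
  forall x y, A <= x -> 0 < y -> K (x / y) <= C * (1 + y `^ p) * K x].
Proof.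
have two0 : (0 : R) < 2 by [].
have [M [_ hM]] : \forall x \near +oo, 2 `^ (- p) < K (x * 2) / K x.
  apply: (cvgr_gt (2 `^ (- alpha)) (@regularly_varying_ratio 2 two0)).
  by rewrite /powR gt_eqF // ltr_expR ltr_pM2r ?ltrN2 // ln_gt0 // ltr1n.
pose A := Num.max 1 (M + 1).
have A1 : 1 <= A by rewrite le_max lexx.
have double x : A <= x -> K x <= 2 `^ p * K (2 * x).
  move=> Ax; have /hM : M < x by rewrite (lt_le_trans _ Ax) // lt_max ltrDl ltr01 orbT.
  rewrite ltr_pdivlMr // powRN mulrC ltr_pdivrMr ?powR_gt0 // => /ltW h.
  by rewrite mulrC [2 * x]mulrC.
have twop : 1 <= 2 `^ p.
  by rewrite -[leLHS](powRr0 2) ler_powR // ?ler1n // ltW.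
(* The number [n] bounds the doublings needed; the extra factor [2 ^ p] pays for the last,
   incomplete one. *)
have pot n : forall z y, A <= z -> 1 <= y <= 2 ^+ n -> K z <= 2 `^ p * y `^ p * K (z * y).
  elim: n => [z y Az|n IH z y Az].
    rewrite expr0 -eq_le => /eqP <-; rewrite powR1 !mulr1.
    by rewrite ler_peMl.
  move=> /andP[y1 yn]; have [y2|y2] := leP y 2.
    apply: (le_trans (double _ Az)); rewrite -mulrA; apply: ler_wpM2l; first exact: powR_ge0.
    apply: (@le_trans _ _ (K (z * y))).
      by apply: Kni; rewrite mulrC ler_wpM2r // (le_trans _ Az) // (le_trans _ A1).
    by rewrite ler_peMl // -[leLHS](powRr0 y) ler_powR // ltW.
  apply: (le_trans (double _ Az)).
  have h : K (2 * z) <= 2 `^ p * (y / 2) `^ p * K (2 * z * (y / 2)).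
    apply: IH; first by apply: (le_trans Az); rewrite ler_peMl ?ler1n // (le_trans _ Az) // (le_trans _ A1).
    rewrite ler_pdivlMr // ler_pdivrMr // mul1r (ltW y2) /=.
    by rewrite -exprSr.
  rewrite -powRM // ?divr_ge0 ?(le_trans _ y1) // in h.
  rewrite (_ : 2 * z * (y / 2) = z * y) in h; last by field.
  rewrite (_ : 2 * (y / 2) = y) in h; last by field.
  by rewrite -mulrA; apply: ler_wpM2l => //; exact: powR_ge0.
have {}pot z y : A <= z -> 1 <= y -> K z <= 2 `^ p * y `^ p * K (z * y).
  move=> Az y1.
  have [n yn] : exists n : nat, y <= 2 ^+ n.
    exists (Num.bound y); apply/ltW; apply: (lt_le_trans (_ : y < (Num.bound y)%:R)).
      by apply: archi_boundP; exact: le_trans y1.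
    by rewrite -natrX ler_nat; apply/ltnW/ltn_expl.
  by apply: (pot n) => //; rewrite y1.
have A0 : 0 < A by exact: lt_le_trans A1.
have KA0 := Kp A.
(* Dividing by [K A] serves only the case [x / y < A], where [K (x / y)] is merely bounded by 1. *)
exists (2 `^ p / K A), A; split => //.
  by rewrite divr_ge0 ?powR_ge0.
move=> x y Ax y0.
have x0 : 0 < x by exact: lt_le_trans Ax.
have yp : 0 <= y `^ p := powR_ge0 _ _.
have C1 : 2 `^ p <= 2 `^ p / K A.
  by rewrite ler_pdivlMr // ler_piMr // powR_ge0.
have [y1|y1] := leP y 1.
  apply: (@le_trans _ _ (K x)).
    by apply: Kni; rewrite ler_pdivlMr // ler_piMr // ltW.
  rewrite ler_peMl ?K0 // -[leLHS]mulr1; apply: ler_pM => //.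
    exact: le_trans C1.
  by rewrite lerDl.
apply: (@le_trans _ _ (2 `^ p / K A * y `^ p * K x)); last first.
  apply: ler_wpM2r => //; apply: ler_wpM2l; last by rewrite lerDr.
  by rewrite divr_ge0 ?powR_ge0.
have [xy|xy] := leP A (x / y).
  apply: (le_trans (pot _ _ xy (ltW y1))); rewrite divfK ?gt_eqF //.
  by apply: ler_wpM2r => //; apply: ler_wpM2r.
(* Here [x / y < A], so [x / A < y]: comparing [K A] with [K x] costs [(x / A) ^ p], which is at
   most [y ^ p]. *)
apply: (le_trans (K1 _)).
have xA1 : 1 <= x / A by rewrite ler_pdivlMr ?mul1r.
have h := pot _ _ (lexx A) xA1.
rewrite (_ : A * (x / A) = x) in h; last by field; rewrite gt_eqF.
rewrite (_ : _ / _ * _ * _ = (2 `^ p * y `^ p * K x) / K A); last ring.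
rewrite ler_pdivlMr // mul1r; apply: (le_trans h).
apply: ler_wpM2r => //; apply: ler_wpM2l; first exact: powR_ge0.
have xAy : x / A <= y by rewrite ler_pdivrMr // mulrC -ler_pdivrMr // ltW.
by apply: ge0_ler_powR => //; rewrite ?nnegrE; [exact: ltW|exact: le_trans xA1|exact: ltW].
Qed.

End regular_variation.

Section breiman.
Context {R : realType}.

(* Multiplying by [ind0 y] discards [y = 0], where [x / y] is the junk value 0. *)
Definition ind0 (y : R) : R := \1_`]0, +oo[%classic y.

Lemma ind0_gt0 y : 0 < y -> ind0 y = 1.
Proof. by move=> y0; rewrite /ind0 indicE mem_set //= in_itv /= y0. Qed.

Lemma ind0_le0 y : y <= 0 -> ind0 y = 0.
Proof.
move=> y0; rewrite /ind0 indicE memNset //= in_itv /= andbT => h.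
by move: y0; rewrite leNgt h.
Qed.

Lemma ind0_ge0 y : 0 <= ind0 y.
Proof. by rewrite /ind0 indicE. Qed.

Lemma ind0_le1 y : ind0 y <= 1.
Proof. by rewrite /ind0 indicE; case: (y \in _). Qed.

Lemma measurable_ind0 : measurable_fun [set: R] ind0.
Proof. by apply: measurable_indic; exact: measurable_itv. Qed.

(** Turns the inverse into a power, which is a measurable function of [y]; the two agree for [y > 0]
    and [ind0] removes the other values. *)
Lemma ind0_divE (K : R -> R) x y : ind0 y * K (x / y) = ind0 y * K (x * y `^ (-1)).
Proof.
have [y0|y0] := ltP 0 y; last by rewrite ind0_le0 // !mul0r.
by rewrite powR_inv1 // ltW.
Qed.

Context d {T : measurableType d} (P : probability T R).
Variables (Y : T -> R).
Hypothesis mY : measurable_fun setT Y.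

Lemma measurable_ind0_div (K : R -> R) x : measurable_fun setT K ->
  measurable_fun setT (fun w => ind0 (Y w) * K (x / Y w)).
Proof.
move=> mK; rewrite (funext (fun w => ind0_divE K x (Y w))).
apply: measurable_funM; first exact: measurableT_comp measurable_ind0 mY.
apply: (measurableT_comp mK); apply: measurable_funM => //.
exact: measurableT_comp (measurable_powR _) mY.
Qed.

Variables (K : R -> R) (alpha p : R).
Hypotheses (Kni : nonincreasing_fun K) (K0 : forall x, 0 <= K x) (K1 : forall x, K x <= 1).
Hypothesis rvK : regularly_varying K alpha.
Hypotheses (ap : alpha < p) (p0 : 0 < p).
Hypothesis Yp : P.-integrable setT (EFin \o (fun w => Y w `^ p)).

Let Kp := regularly_varying_gt0 Kni K0 rvK.
Let mK : measurable_fun setT K. Proof. exact: nonincreasing_measurable. Qed.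

Let mYa : measurable_fun setT (fun w => ind0 (Y w) * Y w `^ alpha).
Proof.
apply: measurable_funM; first exact: measurableT_comp measurable_ind0 mY.
exact: measurableT_comp (measurable_powR _) mY.
Qed.

Let Ya_le w : 0 < alpha -> ind0 (Y w) * Y w `^ alpha <= 1 + Y w `^ p.
Proof.
move=> al0; have p1 : 0 <= 1 + Y w `^ p by rewrite addr_ge0 // powR_ge0.
have [y0|y0] := ltP 0 (Y w); last by rewrite ind0_le0 // mul0r.
rewrite ind0_gt0 // mul1r; have [y1|y1] := leP (Y w) 1.
  rewrite (@le_trans _ _ 1) //; last by rewrite lerDl powR_ge0.
  rewrite -[leRHS](congr1 (fun f => f alpha) (powR1 R)).
  by apply: ge0_ler_powR; rewrite ?nnegrE // ltW.
rewrite (@le_trans _ _ (Y w `^ p)) //; last by rewrite lerDr.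
by apply: ler_powR; exact: ltW.
Qed.

Let IYp1 (c : R) : P.-integrable setT (EFin \o (fun w => c * (1 + Y w `^ p))).
Proof.
apply: integrableRZ; apply: integrableRD => //.
exact: finite_measure_integrable_cst.
Qed.

Lemma integrable_ind0_powR (al0 : 0 < alpha) :
  P.-integrable setT (EFin \o (fun w => ind0 (Y w) * Y w `^ alpha)).
Proof.
apply: (integrable_bounded_by _ (IYp1 1)) => //.
apply: aeW => w; rewrite mul1r ger0_norm ?mulr_ge0 ?ind0_ge0 ?powR_ge0 //.
exact: Ya_le.
Qed.

(** The quotient [K (x / Y) / K x] tends to [Y ^ alpha] and is dominated through the Potter bound,
    so the bounded weight [g x] may vary with [x] without converging. This generality is what later
    allows a weight containing the quotient still to be determined. *)
Lemma breiman_uniform (g : R -> T -> R) (b : R) : 0 < alpha ->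
  (forall x, measurable_fun setT (g x)) ->
  (forall x w, `|g x w| <= b) ->
  (\int[P]_w (ind0 (Y w) * K (x / Y w) * g x w)) / K x -
    \int[P]_w (ind0 (Y w) * Y w `^ alpha * g x w) @[x --> +oo] --> (0 : R).
Proof.
move=> al0 mg gb; have b0 : 0 <= b := le_trans (normr_ge0 _) (gb 0 point).
have [C [A [C0 A0 hCA]]] := potter_bound Kni K0 rvK ap p0 K1.
have mf x : measurable_fun setT (fun w => ind0 (Y w) * K (x / Y w) * g x w).
  by apply: measurable_funM => //; exact: measurable_ind0_div.
have If x : P.-integrable setT (EFin \o (fun w => ind0 (Y w) * K (x / Y w) * g x w)).
  apply: (@integrable_bounded_by _ _ _ P _ (fun=> b)) => //.
    exact: finite_measure_integrable_cst.
  apply: aeW => w; have gw := gb x w; rewrite normrM; apply: (le_trans _ gw).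
  by rewrite ler_piMl // ger0_norm ?mulr_ge0 ?ind0_ge0 // mulr_ile1 ?ind0_ge0 ?ind0_le1.
have Ia x : P.-integrable setT (EFin \o (fun w => ind0 (Y w) * Y w `^ alpha * g x w)).
  apply: (@integrable_bounded_by _ _ _ P _ (fun w => b * (ind0 (Y w) * Y w `^ alpha))).
  - exact: measurable_funM.
  - exact/integrableRZ/integrable_ind0_powR.
  - apply: aeW => w; have gw := gb x w; rewrite normrM mulrC (ger0_norm (x := ind0 _ * _)).
      by apply: ler_wpM2r => //; rewrite mulr_ge0 ?ind0_ge0 ?powR_ge0.
    by rewrite mulr_ge0 ?ind0_ge0 ?powR_ge0.
rewrite (_ : (fun x => _) = fun x =>
    \int[P]_w (ind0 (Y w) * (K (x / Y w) / K x - Y w `^ alpha) * g x w)); last first.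
  apply/funext => x; rewrite -RintegralZr // -RintegralB //; last first.
    by under eq_fun do rewrite mulrC; exact: integrableRZ.
  by apply: eq_Rintegral => w _; ring.
have -> : (0 : R) = \int[P]_w (cst 0 w) by rewrite Rintegral_cst // mul0r.
apply: (@Rintegral_cvg_pinfty _ _ _ P _ _ (fun w => (C + 1) * b * (1 + Y w `^ p))) => //.
- move=> x; rewrite (_ : (fun w => _) = (fun w => ind0 (Y w) * K (x / Y w) * g x w * (K x)^-1 -
     ind0 (Y w) * Y w `^ alpha * g x w)); last by apply/funext => w; ring.
  by apply: measurable_funB; exact: measurable_funM.
- exists A; split; first exact: num_real.
  move=> x /ltW Ax; apply: aeW => w; have gw := gb x w.
  have p1 : 0 <= 1 + Y w `^ p by rewrite addr_ge0 // powR_ge0.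
  have [y0|y0] := ltP 0 (Y w); last first.
    by rewrite ind0_le0 // !mul0r normr0 !mulr_ge0 // addr_ge0.
  have h1 := Ya_le w al0; rewrite ind0_gt0 // mul1r in h1.
  have h2 : K (x / Y w) / K x <= C * (1 + Y w `^ p) by rewrite ler_pdivrMr //; exact: hCA.
  have h3 : 0 <= K (x / Y w) / K x by rewrite divr_ge0.
  have h4 := powR_ge0 (Y w) alpha.
  rewrite ind0_gt0 // mul1r normrM [leRHS](_ : _ = ((C + 1) * (1 + Y w `^ p)) * b); last ring.
  apply: ler_pM => //; apply: (le_trans (ler_normB _ _)).
  by rewrite !ger0_norm // mulrDl mul1r lerD.
- apply: aeW => w; have [y0|y0] := ltP 0 (Y w); last first.
    rewrite ind0_le0 // (_ : (fun x => _) = fun=> 0); first exact: cvg_cst.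
    by apply/funext => x; rewrite !mul0r.
  rewrite ind0_gt0 //.
  have h : (K (x / Y w) / K x - Y w `^ alpha) * b @[x --> +oo] --> (0 : R).
    rewrite (_ : 0 = (Y w `^ alpha - Y w `^ alpha) * b); last by rewrite subrr mul0r.
    apply: cvgM; last exact: cvg_cst.
    by apply: cvgB; [exact: regularly_varying_ratioV|exact: cvg_cst].
  apply/cvgr0Pnorm_le => e e0; move/cvgr0Pnorm_le: h => /(_ e e0).
  apply: filterS => x; apply: le_trans; rewrite mul1r !normrM; apply: ler_wpM2l => //.
  by rewrite (ger0_norm b0).
Qed.

(** With weight 1 this gives Breiman's constant; with the indicator of an event that eventually
    excludes every outcome it gives 0. *)
Lemma breiman (g : R -> T -> R) (g0 : T -> R) (b : R) : 0 < alpha ->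
  (forall x, measurable_fun setT (g x)) -> measurable_fun setT g0 ->
  (forall x w, `|g x w| <= b) ->
  {ae P, forall w, 0 < Y w -> g x w @[x --> +oo] --> g0 w} ->
  (\int[P]_w (ind0 (Y w) * K (x / Y w) * g x w)) / K x @[x --> +oo] -->
  \int[P]_w (ind0 (Y w) * Y w `^ alpha * g0 w).
Proof.
move=> al0 mg mg0 gb gg0.
rewrite (_ : (fun x => _) = fun x =>
  ((\int[P]_w (ind0 (Y w) * K (x / Y w) * g x w)) / K x -
   \int[P]_w (ind0 (Y w) * Y w `^ alpha * g x w)) +
   \int[P]_w (ind0 (Y w) * Y w `^ alpha * g x w)); last first.
  by apply/funext => x; rewrite subrK.
rewrite -[X in _ --> X]add0r; apply: cvgD; first exact: breiman_uniform gb.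
apply: (@Rintegral_cvg_pinfty _ _ _ P _ _ (fun w => b * (ind0 (Y w) * Y w `^ alpha))).
- by move=> x; exact: measurable_funM.
- exact: measurable_funM.
- exact/integrableRZ/integrable_ind0_powR.
- apply: nearW => x; apply: aeW => w; rewrite normrM mulrC (ger0_norm (x := ind0 _ * _)).
    by apply: ler_wpM2r => //; rewrite mulr_ge0 ?ind0_ge0 ?powR_ge0.
  by rewrite mulr_ge0 ?ind0_ge0 ?powR_ge0.
- apply: filterS gg0 => w gw; have [y0|y0] := ltP 0 (Y w); last first.
    rewrite ind0_le0 // !mul0r (_ : (fun x => _) = fun=> 0); first exact: cvg_cst.
    by apply/funext => x; rewrite !mul0r.
  by apply: cvgM; [exact: cvg_cst|exact: gw].
Qed.

End breiman.

(** * The single big jump *)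

Section asymptotics.
Context {R : realType}.
Implicit Types (K H B J : R -> R).

Lemma cvg_comp_scale (f : R -> R) (c l : R) : 0 < c ->
  f x @[x --> +oo] --> l -> f (c * x) @[x --> +oo] --> l.
Proof.
move=> c0; apply: cvg_comp; apply/cvgryPge => M.
exists (M / c); split; first exact: num_real.
by move=> x; rewrite ltr_pdivrMr // mulrC => /ltW.
Qed.

(** The quotient of [H] is the product of [H / K] at [y * x], the quotient of [K], and [K / H] at
    [x]; the constants [c] and [c^-1] cancel. *)
Lemma regularly_varying_equiv K H (alpha c : R) :
  (forall x, 0 < K x) -> regularly_varying K alpha -> 0 < c ->
  H x / K x @[x --> +oo] --> c -> regularly_varying H alpha.
Proof.
move=> Kp rvK c0 HK y y0; rewrite /asym_equiv.
have yp : 0 < y `^ (- alpha) := powR_gt0 _ y0.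
have c1 := cvg_comp_scale y0 HK.
have c2 := rvK _ y0; rewrite /asym_equiv in c2.
have c3 : (H x / K x)^-1 @[x --> +oo] --> c^-1 by apply: cvgV => //; rewrite gt_eqF.
have h : (H (y * x) / K (y * x)) * (K (x * y) / (y `^ (- alpha) * K x)) *
    (H x / K x)^-1 @[x --> +oo] --> (1 : R).
  rewrite (_ : 1 = c * 1 * c^-1); last by rewrite mulr1 divff // gt_eqF.
  by apply: cvgM => //; exact: cvgM.
apply: cvg_trans h; apply: near_eq_cvg; near=> x.
have Hx : H x != 0.
  have : 0 < H x / K x by near: x; exact: (cvgr_gt c HK).
  by apply: contraTneq => ->; rewrite mul0r ltxx.
have k1 := Kp x; have k2 := Kp (y * x).
by rewrite [x * y]mulrC /=; field; rewrite Hx !gt_eqF.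
Unshelve. all: by end_near. Qed.

(** Here [K], [H], [B] are the tails of a sum and of its two summands, and [J] is the tail of their
    joint exceedance. The upper bound on [H / K] is immediate from the first inequality; the lower
    one comes from the second, where regular variation makes the loss of a factor [1 - e] in the
    argument harmless as [e] tends to 0. *)
Lemma single_big_jump K H B J (alpha m1 : R) :
  nonincreasing_fun K -> (forall x, 0 < K x) -> regularly_varying K alpha -> 0 < alpha ->
  B x / K x @[x --> +oo] --> m1 -> J x / K x @[x --> +oo] --> (0 : R) ->
  (forall x, 0 < x -> H x + B x - J x <= K x) ->
  (forall x e, 0 < x -> 0 < e < 1 ->
    K x <= H ((1 - e) * x) + B ((1 - e) * x) + J (e * x)) ->
  H x / K x @[x --> +oo] --> 1 - m1.
Proof.
move=> Kni Kp rvK al0 BK JK le2 le1.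
have K0 x : 0 <= K x by exact: ltW.
apply/cvgrPdist_le => del del0.
have up : \forall x \near +oo, H x / K x <= 1 - m1 + del.
  have h : 1 - B x / K x + J x / K x @[x --> +oo] --> 1 - m1 + 0.
    by apply: cvgD => //; apply: cvgB => //; exact: cvg_cst.
  rewrite addr0 in h.
  near=> x; apply: (@le_trans _ _ (1 - B x / K x + J x / K x)); last first.
    by near: x; apply: (cvgr_le _ h); lra.
  have k := Kp x; have x0 : 0 < x by near: x; apply: nbhs_pinfty_gt; exact: num_real.
  rewrite ler_pdivrMr //.
  rewrite (_ : _ * K x = K x - B x + J x); last by field; rewrite gt_eqF.
  have := le2 _ x0; lra.
pose de := Num.min (del / 2) (1 / 2).
have de0 : 0 < de by rewrite lt_min !divr_gt0.
have de1 : de <= 1 / 2 by rewrite ge_min lexx orbT.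
have de2 : de <= del / 2 by rewrite ge_min lexx.
(* Plays the role of [1 - e]; the exponent makes the limit [q ^ alpha] of [K (x / q) / K x] equal to
   [1 - de]. *)
pose q := (1 - de) `^ alpha^-1.
have q0 : 0 < q by rewrite powR_gt0 //; lra.
have q1 : q < 1.
  rewrite /q /powR gt_eqF; last lra.
  have l : ln (1 - de) < 0 by apply: ln_lt0; apply/andP; split; lra.
  by rewrite -[ltRHS]expR0 ltr_expR pmulr_rlt0 // invr_gt0.
have qa : q `^ alpha = 1 - de.
  by rewrite /q -powRrM mulVf ?gt_eqF // powRr1 //; lra.
(* The second inequality will be used at [x / q], where the arguments [(1 - e) * x] and [e * x]
   become [x] and [c * x]. *)
pose c := (1 - q) / q.
have c0 : 0 < c by apply: divr_gt0 => //; lra.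
have low : \forall x \near +oo, 1 - m1 - del <= H x / K x.
  have h : K (x / q) / K x - B x / K x - J (c * x) / K (c * x) * (K (x * c) / K x)
      @[x --> +oo] --> q `^ alpha - m1 - 0 * c `^ (- alpha).
    apply: cvgB; first by apply: cvgB => //; exact: regularly_varying_ratioV.
    apply: cvgM; first exact: cvg_comp_scale c0 JK.
    exact: regularly_varying_ratio.
  rewrite mul0r subr0 qa in h.
  near=> x.
  apply: (@le_trans _ _ (K (x / q) / K x - B x / K x - J (c * x) / K (c * x) * (K (x * c) / K x))).
    by near: x; apply: (cvgr_ge _ h); lra.
  have k := Kp x; have k2 := Kp (c * x).
  have x0 : 0 < x by near: x; apply: nbhs_pinfty_gt; exact: num_real.
  rewrite ler_pdivlMr //.
  rewrite (_ : _ * K x = K (x / q) - B x - J (c * x)); last first.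
    by rewrite [x * c]mulrC; field; rewrite !gt_eqF.
  have := le1 (x / q) (1 - q) (divr_gt0 x0 q0) _.
  rewrite (_ : (1 - (1 - q)) * (x / q) = x); last by field; rewrite gt_eqF.
  rewrite (_ : (1 - q) * (x / q) = c * x); last by rewrite /c; ring.
  move=> h3; have : K (x / q) <= H x + B x + J (c * x) by apply: h3; apply/andP; split; lra.
  lra.
by near=> x; rewrite ler_norml; apply/andP; split; [have : H x / K x <= 1 - m1 + del by near: x|
  have : 1 - m1 - del <= H x / K x by near: x]; lra.
Unshelve. all: by end_near. Qed.

End asymptotics.

(** * The perpetuity *)

Section perpetuity.
Context {d : measure_display} {T : measurableType d} {R : realType} (P : probability T R).
Variables (X Y : nat -> {RV P >-> R}).
Notation Z := (fun i w => (X i w, Y i w)).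
Hypothesis iidZ : iid P Z.

(* [perp n k] is the sum of the first [n] terms of the series started at index [k]. *)
Fixpoint perp (n k : nat) (w : T) : R :=
  if n is n'.+1 then Y k w * (X k w + perp n' k.+1 w) else 0.

Lemma perpE n k w :
  perp n k w = \sum_(0 <= i < n) X (k + i)%N w * \prod_(0 <= j < i.+1) Y (k + j)%N w.
Proof.
elim: n k => [k|n IH k]; first by rewrite big_nil.
rewrite /= IH big_nat_recl // big_nat1 addn0 mulrDr [Y k w * X k w]mulrC; congr (_ + _).
rewrite mulr_sumr; apply: eq_bigr => i _.
rewrite [in RHS]big_nat_recl // addn0 [RHS]mulrCA addSnnS; congr (_ * (_ * _)).
by apply: eq_bigr => j _; rewrite addSnnS.
Qed.

Lemma measurable_pair k : measurable_fun setT (Z k).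
Proof. by apply: measurable_fun_pair. Qed.

Lemma measurable_perp n k : measurable_fun setT (perp n k).
Proof.
elim: n k => [k|n IH k] /=; first exact: measurable_cst.
by apply: measurable_funM => //; apply: measurable_funD.
Qed.

Definition pairRV k : {RV P >-> (R * R)%type} :=
  HB.pack (Z k) (isMeasurableFun.Build _ _ _ _ (Z k) (measurable_pair k)).

Definition perpRV n k : {RV P >-> R} :=
  HB.pack (perp n k) (isMeasurableFun.Build _ _ _ _ (perp n k) (measurable_perp n k)).

(** The cylinder events of the first [k] vectors. Independence of the later terms from the past is
    only ever tested on them. *)
Definition past (A : nat -> set (R * R)) (k : nat) : set T :=
  \bigcap_(j in [set j | (j < k)%N]) (Z j @^-1` A j).

Lemma pastE A k : past A k = \bigcap_(j in [set` iota 0 k]) (Z j @^-1` A j).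
Proof.
rewrite /past (_ : [set j | (j < k)%N] = [set` iota 0 k]) //.
by apply/seteqP; split => j; rewrite /= mem_iota add0n.
Qed.

Lemma measurable_past A k : (forall j, measurable (A j)) -> measurable (past A k).
Proof.
move=> mA; apply: bigcap_measurableType => j _.
by rewrite -[X in measurable X]setTI; exact: measurable_pair.
Qed.

Lemma pastS A k : past A k.+1 = past A k `&` (Z k @^-1` A k).
Proof.
rewrite /past; apply/seteqP; split => w.
  by move=> h; split; [move=> j /= jk; apply: h; exact: ltnW|exact: (h k (ltnSn k))].
move=> [h1 h2] j /=; rewrite ltnS leq_eqVlt => /predU1P[->//|jk].
exact: h1.
Qed.

Lemma eq_past A A' k : (forall j, (j < k)%N -> A j = A' j) -> past A k = past A' k.
Proof. by move=> AA'; apply: eq_bigcapr => j jk; rewrite AA'. Qed.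

Lemma past_indep A k : (forall j, measurable (A j)) ->
  P (past A k.+1) = (P (past A k) * P (Z 0%N @^-1` A k))%E.
Proof.
move=> mA; have [ind ident] := iidZ.
rewrite !pastE (ind _ _ (iota_uniq 0 k.+1) mA) (ind _ _ (iota_uniq 0 k) mA).
by rewrite -addn1 iotaD big_cat /= big_seq1 add0n (ident k 0%N).
Qed.

Local Notation zeta := (distribution P (pairRV 0)).
Local Notation nu n := (distribution P (perpRV n 0)).

(** For a rectangle [U = B * C] the event is a past event of length [k + 1] intersected with a
    condition on the sum started at [k + 1]; uniqueness of the product measure extends the formula
    to all [U]. The independence for [n] terms is a premise so that the induction on [n] can supply
    it. *)
Lemma past_joint n k A (U : set ((R * R) * R)) :
  (forall A k B, (forall j, measurable (A j)) -> measurable B ->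
     P (past A k `&` (perp n k @^-1` B)) = (P (past A k) * nu n B)%E) ->
  (forall j, measurable (A j)) -> measurable U ->
  P (past A k `&` [set w | U (Z k w, perp n k.+1 w)]) =
  (P (past A k) * (zeta \x nu n)%E U)%E.
Proof.
move=> IH mA mU.
have mE := measurable_past k mA.
(* The probability of the past as a nonnegative number, by which the first factor is scaled to make
   the product measure comparable with [m']. *)
pose r : {nonneg R} := NngNum (fine_ge0 (measure_ge0 P (past A k))).
have rE : (r%:num)%:E = P (past A k) by rewrite /= fineK // fin_num_measure.
have mf : measurable_fun setT (fun w => (Z k w, perp n k.+1 w)).
  by apply: measurable_fun_pair; [exact: measurable_pair|exact: measurable_perp].
pose pf : {measure set ((R * R) * R) -> \bar R} :=
  pushforward (mrestr P mE) (fun w => (Z k w, perp n k.+1 w)).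
pose m' := pf mf.
have h1 : (mscale r zeta \x nu n)%E U = m' U.
  apply: product_measure_unique => // B C mB mC.
  (* Stores the condition [B] on the vector of index [k] as one more condition on the past. *)
  pose A' j := if j == k then B else A j.
  have mA' j : measurable (A' j) by rewrite /A'; case: eqP.
  have EA : past A' k = past A k.
    by apply: eq_past => j jk; rewrite /A' ltn_eqF.
  have Ak : A' k = B by rewrite /A' eqxx.
  transitivity (P (past A' k.+1 `&` (perp n k.+1 @^-1` C))).
    by rewrite pastS EA Ak /= /pushforward /mrestr; congr (P _); apply/seteqP; split => w /= []; tauto.
  by rewrite IH // past_indep // EA Ak -rE.
(* Scaling one factor scales the product measure: uniqueness once more. *)
have h2 : (mscale r zeta \x nu n)%E U = mscale r (zeta \x nu n)%E U.
  apply: product_measure_unique => // B C mB mC.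
  transitivity (r%:num%:E * (zeta \x nu n)%E (B `*` C))%E; first by [].
  by rewrite product_measure1E // muleA.
rewrite -[LHS](_ : m' U = _); last first.
  by rewrite /m' /pf /= /pushforward /mrestr /= setIC.
by rewrite -h1 h2 /mscale rE.
Qed.

(** The sum of [n + 1] terms started at [k] is a fixed function of the vector of index [k] and of
    the sum of [n] terms started at [k + 1]. The joint law just found factors out the past, and the
    same formula at index 0 with a trivial past identifies the other factor as the law of the sum
    started at 0. *)
Lemma perp_indep n A k B : (forall j, measurable (A j)) -> measurable B ->
  P (past A k `&` (perp n k @^-1` B)) = (P (past A k) * nu n B)%E.
Proof.
elim: n A k B => [|n IH] A k B mA mB.
  have -> : nu 0%N B = P (perp 0 k @^-1` B) by [].
  have [B0|B0] := pselect (B 0).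
    have -> : perp 0 k @^-1` B = setT by apply/seteqP; split.
    by rewrite setIT probability_setT mule1.
  have -> : perp 0 k @^-1` B = set0 by apply/seteqP; split.
  by rewrite setI0 measure0 mule0.
pose U := [set z : (R * R) * R | B (z.1.2 * (z.1.1 + z.2))].
have mU : measurable U.
  rewrite -[U]setTI; apply: measurable_funM mB => //.
    exact: measurableT_comp measurable_snd measurable_fst.
  apply: measurable_funD; last exact: measurable_snd.
  exact: measurableT_comp measurable_fst measurable_fst.
have h := past_joint k IH mA mU.
rewrite [LHS]h; congr (_ * _)%E.
have := past_joint 0 IH mA mU.
rewrite (_ : past A 0 = setT); last by rewrite /past; apply/seteqP; split => // w _ j.
by rewrite setTI probability_setT mul1e => <-.
Qed.

(** This provides both the independence of the first vector from the sum started at 1 and the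
    stationarity of the latter. *)
Lemma perp_joint n (U : set ((R * R) * R)) : measurable U ->
  P [set w | U (Z 0%N w, perp n 1 w)] = (zeta \x nu n)%E U.
Proof.
move=> mU.
have := past_joint 0 (A := fun=> setT) (@perp_indep n) (fun=> measurableT) mU.
rewrite (_ : past _ 0 = setT); last by rewrite /past; apply/seteqP; split => // w _ j.
by rewrite setTI probability_setT mul1e.
Qed.

End perpetuity.

Lemma measurable_gt {d : measure_display} {T : measurableType d} {R : realType}
    (f : T -> R) (x : R) : measurable_fun setT f -> measurable [set w | x < f w].
Proof.
move=> mf; rewrite (_ : [set w | _] = f @^-1` `]x, +oo[%classic).
  by rewrite -[X in measurable X]setTI; exact: mf.
by apply/seteqP; split => w; rewrite /= in_itv /= andbT.
Qed.

Section probabilities.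
Context {d : measure_display} {T : measurableType d} {R : realType} (P : probability T R).

Lemma fine_prob (A : set T) : measurable A -> fine (P A) = \int[P]_w \1_A w.
Proof. by move=> mA; rewrite /Rintegral integral_indic // setIT. Qed.

Lemma ae_prob0 (A : set T) : measurable A -> P A = 0%E -> {ae P, forall w, ~ A w}.
Proof. by move=> mA PA; exists A; split => // w /= /contrapT. Qed.

Lemma integrable_prob_bounded (f : T -> R) (b : R) : measurable_fun setT f ->
  {ae P, forall w, `|f w| <= b} -> P.-integrable setT (EFin \o f).
Proof.
move=> mf fb; apply: (integrable_bounded_by (h := fun=> b)) => //.
exact: finite_measure_integrable_cst.
Qed.

Lemma integrable_indicP (A : set T) : measurable A -> P.-integrable setT (EFin \o \1_A).
Proof.
move=> mA; apply: (@integrable_prob_bounded _ 1); first exact: measurable_indic.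
by apply: aeW => w; rewrite indicE; case: (w \in A); rewrite ?normr1 ?normr0.
Qed.

End probabilities.

Section perpetuity_tail.
Context {d : measure_display} {T : measurableType d} {R : realType} (P : probability T R).
Variables (X Y : nat -> {RV P >-> R}).
Notation Z := (fun i w => (X i w, Y i w)).
Hypothesis iidZ : iid P Z.
Notation perp := (perp X Y).

Lemma ident_ae (C : set (R * R)) i : measurable C ->
  {ae P, forall w, C (Z 0%N w)} -> {ae P, forall w, C (Z i w)}.
Proof.
move=> mC C0.
have mZ k : measurable (Z k @^-1` ~` C).
  rewrite -[X in measurable X]setTI; apply: (measurable_pair X Y k) => //.
  exact: measurableC.
have h : P (Z i @^-1` ~` C) = 0%E.
  rewrite (iidZ.2 i 0%N _ (measurableC mC)).
  have [N [mN N0 hN]] := C0; apply/eqP; rewrite -measure_le0 -N0.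
  by apply: le_measure => //; rewrite inE.
by apply: filterS (ae_prob0 (mZ i) h) => w /= /contrapT.
Qed.

Definition perp_tail n x : R := fine (P [set w | x < perp n 0 w]).

Lemma perp_tail_nonincreasing n : nonincreasing_fun (perp_tail n).
Proof.
move=> x y xy; apply: fine_le; [exact: fin_num_measure (measurable_gt _ (measurable_perp X Y n 0))..|].
apply: le_measure; rewrite ?inE; [exact: measurable_gt (measurable_perp X Y n 0)..|].
by move=> w /=; exact: le_lt_trans.
Qed.

Lemma perp_tail_ge0 n x : 0 <= perp_tail n x.
Proof. by rewrite fine_ge0. Qed.

Lemma perp_tail_le1 n x : perp_tail n x <= 1.
Proof.
rewrite -lee_fin fineK; first by apply: probability_le1; exact: measurable_gt (measurable_perp X Y n 0).
exact: fin_num_measure (measurable_gt _ (measurable_perp X Y n 0)).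
Qed.

(** The sum started at 1 is integrated out for a fixed first vector. Where [Y 0] vanishes the event
    is empty since [b > 0], in agreement with [ind0]. *)
Lemma perp_product_tail n (C : set (R * R)) b : measurable C -> 0 < b ->
  {ae P, forall w, 0 <= Y 0%N w} ->
  fine (P [set w | C (Z 0%N w) /\ b < Y 0%N w * perp n 1 w]) =
  \int[P]_w (ind0 (Y 0%N w) * perp_tail n (b / Y 0%N w) * \1_C (Z 0%N w)).
Proof.
move=> mC b0 Y0.
pose U := [set z : (R * R) * R | C z.1 /\ b < z.1.2 * z.2].
have mU : measurable U.
  rewrite (_ : U = (fst @^-1` C) `&` [set z | b < z.1.2 * z.2]); last by apply/seteqP; split.
  apply: measurableI.
    by rewrite -[X in measurable X]setTI; exact: measurable_fst.
  apply: (measurable_gt (f := fun z : (R * R) * R => z.1.2 * z.2)).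
  apply: measurable_funM => //.
  exact: measurableT_comp measurable_snd measurable_fst.
have -> : [set w | C (Z 0%N w) /\ b < Y 0%N w * perp n 1 w] = [set w | U (Z 0%N w, perp n 1 w)] by [].
rewrite (perp_joint iidZ n mU) /product_measure1.
rewrite ge0_integral_distribution; last 2 first.
- exact: measurable_fun_xsection.
- by move=> y; exact: measure_ge0.
rewrite /Rintegral; congr fine; apply: ae_eq_integral => //.
- apply: (measurableT_comp (measurable_fun_xsection _ mU)).
  exact: (measurable_pair X Y 0).
- apply/measurable_EFinP; apply: measurable_funM.
    apply: measurable_ind0_div => //; apply: nonincreasing_measurable => //.
    exact: perp_tail_nonincreasing.
  exact: (measurableT_comp (measurable_indic mC) (measurable_pair X Y 0)).
apply: filterS Y0 => w y0 _ /=.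
have [C0|C0] := pselect (C (Z 0%N w)); last first.
  rewrite indicE memNset // mulr0 (_ : xsection _ _ = set0) ?measure0 //.
  by apply/seteqP; split => s //=; rewrite /xsection /= inE => -[].
rewrite indicE mem_set // mulr1.
move: y0; rewrite le_eqVlt => /predU1P[y0|y0].
  rewrite -y0 ind0_le0 // mul0r (_ : xsection _ _ = set0) ?measure0 //.
  apply/seteqP; split => s //=; rewrite /xsection /= inE /U /= mul0r => -[_].
  by rewrite ltNge ltW.
rewrite ind0_gt0 // mul1r fineK; last first.
  exact: fin_num_measure (measurable_gt _ (measurable_perp X Y n 0)).
congr (P _); apply/seteqP; split => s /=; rewrite /xsection /= inE /U /= ltr_pdivrMr // [_ * Y 0%N w]mulrC.
  by case.
by [].
Qed.

End perpetuity_tail.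

Section perpetuity_limit.
Context {d : measure_display} {T : measurableType d} {R : realType} (P : probability T R).
Variables (X Y : nat -> {RV P >-> R}) (S : T -> \bar R).
Hypothesis iidZ : iid P (fun i w => (X i w, Y i w)).
Notation perp := (perp X Y).
Notation perp_tail := (perp_tail X Y).
Hypotheses (X0 : {ae P, forall w, 0 <= X 0%N w}) (Y0 : {ae P, forall w, 0 <= Y 0%N w}).
Hypothesis mS : measurable_fun setT S.
Hypothesis SE : \forall w \ae P,
    (\sum_(0 <= i < n) X i w * \prod_(0 <= j < i.+1) Y j w)%:E
      @[n --> \oo] --> S w.

Lemma ae_factors_ge0 : {ae P, forall w i, 0 <= X i w /\ 0 <= Y i w}.
Proof.
apply: ae_foralln => i.
have mC : measurable [set z : R * R | 0 <= z.1 /\ 0 <= z.2].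
  rewrite (_ : [set z | _] = (fst @^-1` `[0, +oo[%classic) `&` (snd @^-1` `[0, +oo[%classic)).
    apply: measurableI; rewrite -[X in measurable X]setTI.
      exact: measurable_fst.
    exact: measurable_snd.
  by apply/seteqP; split => z /=; rewrite !in_itv /= !andbT.
apply: (ident_ae iidZ i mC).
by apply: filterS2 X0 Y0 => w.
Qed.

Lemma perp_ge0 w : (forall i, 0 <= X i w /\ 0 <= Y i w) -> forall n k, 0 <= perp n k w.
Proof.
move=> h; elim=> [//|n IH] k /=; have [Xk Yk] := h k.
by rewrite mulr_ge0 // addr_ge0.
Qed.

Lemma perp_nondecreasing w : (forall i, 0 <= X i w /\ 0 <= Y i w) ->
  forall n k, perp n k w <= perp n.+1 k w.
Proof.
move=> h; elim=> [|n IH] k; first exact: (perp_ge0 h 1 k).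
rewrite [leLHS]/= [leRHS]/=; have [Xk Yk] := h k.
by apply: ler_wpM2l => //; rewrite lerD2l.
Qed.

Let K := etail P S.

Let mSx x : measurable [set w | (x%:E < S w)%E].
Proof.
rewrite -[X in measurable X]setTI.
by apply: emeasurable_fun_o_infty => //.
Qed.

Lemma etail_nonincreasing : nonincreasing_fun K.
Proof.
move=> x y xy; apply: fine_le; [exact: fin_num_measure..|].
apply: le_measure; rewrite ?inE //.
by move=> w /=; apply: le_lt_trans; rewrite lee_fin.
Qed.

Lemma etail_ge0 x : 0 <= K x.
Proof. by rewrite fine_ge0. Qed.

Lemma etail_le1 x : K x <= 1.
Proof.
rewrite -lee_fin fineK; first exact: probability_le1.
exact: fin_num_measure.
Qed.

(** The partial sums increase almost surely, so they eventually exceed [x] if [S] does and never do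
    otherwise: the indicators converge, also where [S] is infinite. *)
Lemma perp_tail_cvg x : perp_tail n x @[n --> \oo] --> K x.
Proof.
have mp n := measurable_gt x (measurable_perp X Y n 0).
rewrite (funext (fun n => fine_prob P (mp n))) /K /etail fine_prob //.
apply: (@Rintegral_cvg_seq _ _ _ P (fun n => \1_[set w | x < perp n 0 w]) _ (fun=> 1)).
- by move=> n; exact: measurable_indic.
- exact: measurable_indic.
- exact: finite_measure_integrable_cst.
- by move=> n; apply: aeW => w; rewrite indicE; case: (_ \in _); rewrite ?normr1 ?normr0.
apply: filterS2 ae_factors_ge0 SE => w h Sw.
have {}Sw : (perp n 0 w)%:E @[n --> \oo] --> S w.
  by rewrite (funext (fun n => congr1 EFin (perpE X Y n 0 w))).
have mono : nondecreasing_seq (fun n => perp n 0 w).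
  by apply/nondecreasing_seqP => n; exact: perp_nondecreasing.
have [xS|Sx] := ltP x%:E (S w).
  rewrite indicE mem_set //.
  have [n0 hn0] : exists n0, x < perp n0 0 w.
    apply: contrapT => /forallNP hn.
    have : (S w <= x%:E)%E.
      apply: (cvge_to_le Sw); apply: nearW => n; rewrite lee_fin leNgt.
      exact/negP/hn.
    by rewrite leNgt xS.
  apply: cvg_near_cst; exists n0 => // n /= n0n.
  by rewrite indicE mem_set //=; exact: lt_le_trans (mono _ _ n0n).
rewrite indicE memNset /=; last by apply/negP; rewrite -leNgt.
apply: cvg_near_cst; apply: nearW => n.
rewrite indicE memNset //=; apply/negP; rewrite -leNgt -lee_fin (le_trans _ Sx) //.
apply: (cvge_to_ge Sw); exists n => // m /= nm; rewrite lee_fin; exact: mono.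
Qed.

Definition product_tail x : R := fine (P [set w | x < X 0%N w * Y 0%N w]).
(** For [x > 0], this and [joint_tail] stand for the probabilities that [Y0 * S'] exceeds [x], alone
    or together with [X0 * Y0]; [S'] is already integrated out, so that only its tail [K]
    appears. *)
Definition remainder_tail x : R := \int[P]_w (ind0 (Y 0%N w) * K (x / Y 0%N w)).
Definition joint_tail x : R :=
  \int[P]_w (ind0 (Y 0%N w) * K (x / Y 0%N w) * \1_[set w | x < X 0%N w * Y 0%N w] w).

Let mXY x : measurable [set w | x < X 0%N w * Y 0%N w].
Proof. by apply: measurable_gt; exact: measurable_funM. Qed.

Let Rem n x : R := \int[P]_w (ind0 (Y 0%N w) * perp_tail n (x / Y 0%N w)).
Let Joint n x : R :=
  \int[P]_w (ind0 (Y 0%N w) * perp_tail n (x / Y 0%N w) * \1_[set w | x < X 0%N w * Y 0%N w] w).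

Let mYK (f : R -> R) x : nonincreasing_fun f ->
  measurable_fun setT (fun w => ind0 (Y 0%N w) * f (x / Y 0%N w)).
Proof. by move=> f_ni; apply: measurable_ind0_div => //; exact: nonincreasing_measurable. Qed.

Let boundYK (f : R -> R) x w : (forall y, 0 <= f y) -> (forall y, f y <= 1) ->
  `|ind0 (Y 0%N w) * f (x / Y 0%N w)| <= 1.
Proof.
move=> f0 f1; rewrite ger0_norm ?mulr_ge0 ?ind0_ge0 //.
by rewrite mulr_ile1 ?ind0_ge0 ?ind0_le1.
Qed.

Let Rem_cvg x : Rem n x @[n --> \oo] --> remainder_tail x.
Proof.
apply: (@Rintegral_cvg_seq _ _ _ P _ _ (fun=> 1)).
- by move=> n; apply: mYK; exact: perp_tail_nonincreasing.
- by apply: mYK; exact: etail_nonincreasing.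
- exact: finite_measure_integrable_cst.
- move=> n; apply: aeW => w; apply: boundYK => y; [exact: perp_tail_ge0|exact: perp_tail_le1].
- by apply: aeW => w; apply: cvgM; [exact: cvg_cst|exact: perp_tail_cvg].
Qed.

Let Joint_cvg x : Joint n x @[n --> \oo] --> joint_tail x.
Proof.
apply: (@Rintegral_cvg_seq _ _ _ P _ _ (fun=> 1)).
- move=> n; apply: measurable_funM; last exact: measurable_indic.
  by apply: mYK; exact: perp_tail_nonincreasing.
- apply: measurable_funM; last exact: measurable_indic.
  by apply: mYK; exact: etail_nonincreasing.
- exact: finite_measure_integrable_cst.
- move=> n; apply: aeW => w; rewrite normrM.
  have h : `|ind0 (Y 0%N w) * perp_tail n (x / Y 0%N w)| <= 1.
    by apply: boundYK => y; [exact: perp_tail_ge0|exact: perp_tail_le1].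
  by apply: (le_trans _ h); rewrite ler_piMr // indicE; case: (_ \in _); rewrite ?normr1 ?normr0.
- apply: aeW => w; apply: cvgM; last exact: cvg_cst.
  by apply: cvgM; [exact: cvg_cst|exact: perp_tail_cvg].
Qed.

Let A x := [set w | x < X 0%N w * Y 0%N w].
Let D n x := [set w | x < Y 0%N w * perp n 1 w].

Let mD n x : measurable (D n x).
Proof. by apply: measurable_gt; apply: measurable_funM => //; exact: measurable_perp. Qed.

Let RemE n x : 0 < x -> Rem n x = \int[P]_w \1_(D n x) w.
Proof.
move=> x0; rewrite -fine_prob //.
rewrite (_ : D n x = [set w | setT (X 0%N w, Y 0%N w) /\ x < Y 0%N w * perp n 1 w]); last first.
  by apply/seteqP; split => w //= [].
rewrite (perp_product_tail iidZ n measurableT x0 Y0).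
by apply: eq_Rintegral => w _; rewrite indicE in_setT mulr1.
Qed.

Let JointE n x : 0 < x -> Joint n x = \int[P]_w (\1_(A x) w * \1_(D n x) w).
Proof.
move=> x0; pose C := [set z : R * R | x < z.1 * z.2].
have mC : measurable C.
  apply: (measurable_gt (f := fun z : R * R => z.1 * z.2)).
  exact: measurable_funM.
transitivity (\int[P]_w \1_(A x `&` D n x) w).
  rewrite -fine_prob; last by apply: measurableI => //; exact: mXY.
  rewrite (perp_product_tail iidZ n mC x0 Y0).
  by apply: eq_Rintegral => w _; congr (_ * _); rewrite !indicE; congr (nat_of_bool _)%:R;
    apply/idP/idP; rewrite !inE.
by apply: eq_Rintegral => w _; rewrite indicI.
Qed.

(** Either nonnegative summand exceeding [x] makes the sum exceed it; inclusion-exclusion for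
    partial sums, then the limit in [n]. *)
Lemma product_tail_le x : 0 < x ->
  product_tail x + remainder_tail x - joint_tail x <= K x.
Proof.
move=> x0.
have h : product_tail x + Rem n x - Joint n x @[n --> \oo] -->
    product_tail x + remainder_tail x - joint_tail x.
  by apply: cvgB => //; apply: cvgD => //; exact: cvg_cst.
have hK : perp_tail n.+1 x @[n --> \oo] --> K x.
  by rewrite (cvg_shiftS (fun n => perp_tail n x)); exact: perp_tail_cvg.
apply: (ler_cvg_to h hK); apply: nearW => n.
have mp := measurable_gt x (measurable_perp X Y n.+1 0).
rewrite RemE // JointE // /perp_tail /product_tail !fine_prob //.
have IA := integrable_indicP P (mXY x).
have ID := integrable_indicP P (mD n x).
have IAD : P.-integrable setT (EFin \o (fun w => \1_(A x) w * \1_(D n x) w)).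
  rewrite (_ : _ \o _ = EFin \o \1_(A x `&` D n x)); last by apply/funext => w /=; rewrite indicI.
  by apply: integrable_indicP; apply: measurableI => //; exact: mXY.
rewrite -RintegralD // -RintegralB //; last exact: integrableRD.
apply: ae_le_Rintegral.
- by apply: integrableRB => //; exact: integrableRD.
- exact: integrable_indicP.
apply: filterS ae_factors_ge0 => w h0; have [Xw Yw] := h0 0%N.
have pw := perp_ge0 h0 n 1.
have XYw : 0 <= X 0%N w * Y 0%N w by rewrite mulr_ge0.
have Ypw : 0 <= Y 0%N w * perp n 1 w by rewrite mulr_ge0.
have E : perp n.+1 0 w = X 0%N w * Y 0%N w + Y 0%N w * perp n 1 w by rewrite /= mulrDr mulrC.
rewrite !indicE.
have [a|a] := pselect (A x w); have [b|b] := pselect (D n x w);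
  rewrite ?(mem_set a) ?(mem_set b) ?(memNset a) ?(memNset b) /=.
- rewrite mem_set /=; first by lra.
  by rewrite -/(perp n.+1 0 w) E; move: a b; rewrite /A /D /=; lra.
- rewrite mem_set /=; first by lra.
  by rewrite -/(perp n.+1 0 w) E; move: a; rewrite /A /=; lra.
- rewrite mem_set /=; first by lra.
  by rewrite -/(perp n.+1 0 w) E; move: b; rewrite /D /=; lra.
- by rewrite mulr0 !addr0 subr0.
Qed.

(** If the sum exceeds [x] while neither summand exceeds [(1 - e) * x], then both exceed [e * x]. *)
Lemma product_tail_ge x e : 0 < x -> 0 < e < 1 ->
  K x <= product_tail ((1 - e) * x) + remainder_tail ((1 - e) * x) + joint_tail (e * x).
Proof.
move=> x0 /andP[e0 e1].
have h : product_tail ((1 - e) * x) + Rem n ((1 - e) * x) + Joint n (e * x) @[n --> \oo] -->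
    product_tail ((1 - e) * x) + remainder_tail ((1 - e) * x) + joint_tail (e * x).
  by apply: cvgD => //; apply: cvgD => //; exact: cvg_cst.
have hK : perp_tail n.+1 x @[n --> \oo] --> K x.
  by rewrite (cvg_shiftS (fun n => perp_tail n x)); exact: perp_tail_cvg.
apply: (ler_cvg_to hK h); apply: nearW => n.
have mp := measurable_gt x (measurable_perp X Y n.+1 0).
have ex0 : 0 < e * x by rewrite mulr_gt0.
have e'x0 : 0 < (1 - e) * x by rewrite mulr_gt0 // subr_gt0.
rewrite RemE // JointE // /perp_tail /product_tail !fine_prob //.
have IA := integrable_indicP P (mXY ((1 - e) * x)).
have ID := integrable_indicP P (mD n ((1 - e) * x)).
have IAD : P.-integrable setT (EFin \o (fun w => \1_(A (e * x)) w * \1_(D n (e * x)) w)).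
  rewrite (_ : _ \o _ = EFin \o \1_(A (e * x) `&` D n (e * x))); last by apply/funext => w /=; rewrite indicI.
  by apply: integrable_indicP; apply: measurableI => //; exact: mXY.
rewrite -RintegralD // -RintegralD //; last exact: integrableRD.
apply: ae_le_Rintegral.
- exact: integrable_indicP.
- by apply: integrableRD => //; exact: integrableRD.
apply: aeW => w.
have E : perp n.+1 0 w = X 0%N w * Y 0%N w + Y 0%N w * perp n 1 w by rewrite /= mulrDr mulrC.
have i0 (B : set T) : 0 <= \1_B w :> R by rewrite indicE.
have [s|s] := pselect (x < perp n.+1 0 w); last first.
  by rewrite indicE memNset // addr_ge0 ?mulr_ge0 // addr_ge0.
rewrite indicE mem_set //=.
have [a|a] := pselect (A ((1 - e) * x) w).
  by rewrite -addrA indicE mem_set // lerDl addr_ge0 // mulr_ge0.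
have [b|b] := pselect (D n ((1 - e) * x) w).
  have -> : \1_(D n ((1 - e) * x)) w = 1 :> R by rewrite indicE mem_set.
  by rewrite addrAC lerDr addr_ge0 // mulr_ge0.
have a' : A (e * x) w.
  by move/negP: a; move/negP: b; rewrite -!leNgt E in s * => b a; rewrite /A /=; lra.
have b' : D n (e * x) w.
  by move/negP: a; move/negP: b; rewrite -!leNgt E in s * => b a; rewrite /D /=; lra.
by rewrite [\1_(A (e * x)) w]indicE [\1_(D n (e * x)) w]indicE (mem_set a') (mem_set b') mulr1 lerDr addr_ge0.
Qed.

End perpetuity_limit.

(** * Moments of the factor and the tail of the product *)

Section moments.
Context {d : measure_display} {T : measurableType d} {R : realType} (P : probability T R).
Variables (Y : T -> R) (alpha p : R).
Hypotheses (mY : measurable_fun setT Y) (Y0 : {ae P, forall w, 0 <= Y w}).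
Hypotheses (al0 : 0 < alpha) (ap : alpha < p).
Hypothesis Yp : P.-integrable setT (EFin \o (fun w => Y w `^ p)).

Lemma measurable_powR_comp q : measurable_fun setT (fun w => Y w `^ q).
Proof. exact: measurableT_comp (measurable_powR _) mY. Qed.

(** Young's inequality for the product of [y ^ alpha] and 1, with exponent [p / alpha]. The weights
    sum to 1, so a moment of order [p] below 1 forces the one of order [alpha] below 1. *)
Lemma powR_young y : 0 <= y -> y `^ alpha <= alpha / p * y `^ p + (1 - alpha / p).
Proof.
move=> y0; have p0 : 0 < p by exact: lt_trans ap.
have q0 : 0 < (1 - alpha / p)^-1 by rewrite invr_gt0 subr_gt0 ltr_pdivrMr // mul1r.
have := @conjugate_powR R (y `^ alpha) 1 (p / alpha) (1 - alpha / p)^-1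
  (powR_ge0 _ _) ler01 (divr_gt0 p0 al0) q0.
rewrite invf_div invrK addrC subrK => /(_ erefl).
rewrite mulr1 powR1 mul1r -powRrM [alpha * _]mulrC divfK ?gt_eqF //.
by rewrite mulrC.
Qed.

Lemma integrable_powR_lt : P.-integrable setT (EFin \o (fun w => Y w `^ alpha)).
Proof.
apply: (integrable_bounded_by (h := fun w => alpha / p * Y w `^ p + (1 - alpha / p))).
- exact: measurable_powR_comp.
- by apply: integrableRD; [exact: integrableRZ|exact: finite_measure_integrable_cst].
- by apply: filterS Y0 => w y0; rewrite ger0_norm ?powR_ge0 //; exact: powR_young.
Qed.

Lemma moment_lt1 : \int[P]_w (Y w `^ p) < 1 -> \int[P]_w (Y w `^ alpha) < 1.
Proof.
move=> Yp1; have p0 : 0 < p by exact: lt_trans ap.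
have ap0 : 0 < alpha / p by exact: divr_gt0.
apply: (@le_lt_trans _ _ (\int[P]_w (alpha / p * Y w `^ p + (1 - alpha / p)))).
  apply: ae_le_Rintegral.
  - exact: integrable_powR_lt.
  - by apply: integrableRD; [exact: integrableRZ|exact: finite_measure_integrable_cst].
  - by apply: filterS Y0 => w y0; exact: powR_young.
rewrite RintegralD //; [|exact: integrableRZ|exact: finite_measure_integrable_cst].
rewrite [X in X + _ < _]RintegralZl // [X in _ + X < _]Rintegral_cst //.
rewrite [X in fine X](@probability_setT _ _ _ P) /= mulr1.
have : alpha / p * \int[P]_w (Y w `^ p) < alpha / p * 1 by rewrite ltr_pM2l.
lra.
Qed.

Lemma ind0_powR y : 0 <= y -> ind0 y * y `^ alpha = y `^ alpha.
Proof.
rewrite le_eqVlt => /predU1P[<-|y0]; last by rewrite ind0_gt0 // mul1r.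
by rewrite powR0 ?gt_eqF // mulr0.
Qed.

End moments.

Section product_asymptotics.
Context {d : measure_display} {T : measurableType d} {R : realType} (P : probability T R).
Variables (X Y : nat -> {RV P >-> R}) (S : T -> \bar R) (alpha p : R).
Hypothesis iidZ : iid P (fun i w => (X i w, Y i w)).
Hypotheses (X0 : {ae P, forall w, 0 <= X 0%N w}) (Y0 : {ae P, forall w, 0 <= Y 0%N w}).
Hypothesis mS : measurable_fun setT S.
Hypothesis SE : \forall w \ae P,
    (\sum_(0 <= i < n) X i w * \prod_(0 <= j < i.+1) Y j w)%:E
      @[n --> \oo] --> S w.
Hypotheses (al0 : 0 < alpha) (ap : alpha < p).
Hypothesis Yp : P.-integrable setT (EFin \o (fun w => Y 0%N w `^ p)).
Hypothesis rvS : regularly_varying (etail P S) alpha.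

(** Breiman's lemma with weight 1 gives the limit for the remainder, and with the indicator of
    [x < X0 * Y0] the limit 0 for the joint tail. *)
Lemma product_tail_equiv :
  product_tail X Y x / etail P S x @[x --> +oo] --> 1 - \int[P]_w (Y 0%N w `^ alpha).
Proof.
have Kni := etail_nonincreasing P mS.
have K0 := @etail_ge0 _ _ _ P S.
have K1 := etail_le1 P mS.
have Kp := regularly_varying_gt0 Kni K0 rvS.
have p0 : 0 < p by exact: lt_trans ap.
have mY : measurable_fun setT (Y 0%N) by [].
have mXY x : measurable [set w | x < X 0%N w * Y 0%N w].
  by apply: measurable_gt; exact: measurable_funM.
apply: (single_big_jump Kni Kp rvS al0 (B := remainder_tail Y S) (J := joint_tail X Y S)).
- have := @breiman _ _ _ P _ mY _ _ _ Kni K0 K1 rvS ap p0 Yp (fun _ _ => 1) (fun=> 1) 1 al0.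
  rewrite (_ : (fun x => _ / _) = (fun x => remainder_tail Y S x / etail P S x)); last first.
    apply/funext => x; congr (_ / _); apply: eq_Rintegral => w _; exact: mulr1.
  rewrite (_ : Rintegral _ _ _ = \int[P]_w (Y 0%N w `^ alpha)).
    apply => //.
    - by move=> x w; rewrite normr1.
    - by apply: aeW => w _; exact: cvg_cst.
  apply: ae_eq_Rintegral.
  + apply: measurable_funM => //; apply: measurable_funM.
      exact: measurableT_comp measurable_ind0 mY.
    exact: measurable_powR_comp.
  + exact: measurable_powR_comp.
  + by apply: filterS Y0 => w y0; rewrite mulr1 ind0_powR.
(* For each outcome the indicator is 0 as soon as [x] passes the value of [X0 * Y0]. *)
- have := @breiman _ _ _ P _ mY _ _ _ Kni K0 K1 rvS ap p0 Yp
    (fun x => \1_[set w | x < X 0%N w * Y 0%N w]) (fun=> 0) 1 al0.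
  rewrite (_ : Rintegral _ _ _ = 0).
    apply => //.
    - by move=> x w; rewrite indicE; case: (_ \in _); rewrite ?normr1 ?normr0.
    - apply: aeW => w _; apply: cvg_near_cst.
      exists (X 0%N w * Y 0%N w); split; first exact: num_real.
      move=> x h; rewrite indicE memNset //=; apply/negP; rewrite -leNgt; exact: ltW.
  by under eq_Rintegral do rewrite mulr0; rewrite Rintegral_cst // mul0r.
- by move=> x; exact: (product_tail_le iidZ X0 Y0 mS SE).
- by move=> x e; exact: (product_tail_ge iidZ X0 Y0 mS SE).
Qed.

End product_asymptotics.

(** * Sarmanov tails *)

Section distribution_lemmas.
Context {d : measure_display} {T : measurableType d} {R : realType} (P : probability T R).

Lemma ae_distribution (X : {RV P >-> R}) (C : R -> Prop) :
  {ae distribution P X, forall x, C x} -> {ae P, forall w, C (X w)}.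
Proof.
move=> [N [mN N0 hN]]; exists (X @^-1` N); split => //.
- by rewrite -[X in measurable X]setTI; exact: measurable_funP.
- by move=> w h; apply: hN.
Qed.

Lemma integrable_distribution (X : {RV P >-> R}) (f : R -> R) : measurable_fun setT f ->
  P.-integrable setT (EFin \o (f \o X)) ->
  (distribution P X).-integrable setT (EFin \o f).
Proof.
by move=> mf If; apply: integrable_pushforward => //; exact/measurable_EFinP.
Qed.

Lemma Rintegral_distribution (X : {RV P >-> R}) (f : R -> R) : measurable_fun setT f ->
  P.-integrable setT (EFin \o (f \o X)) ->
  \int[distribution P X]_x f x = \int[P]_w f (X w).
Proof.
move=> mf If; rewrite /Rintegral integral_distribution //; exact/measurable_EFinP.
Qed.

(** A point outside the support lies in an interval with rational ends and measure 0, and there are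
    countably many of these. *)
Lemma ae_dist_support (X : {RV P >-> R}) : {ae distribution P X, forall x, dist_support X x}.
Proof.
pose mu : {measure set R -> \bar R} := distribution P X.
pose I (q : rat * rat) : set R := `]ratr q.1, ratr q.2[%classic.
pose N n : set R := if unpickle n is Some q then (if mu (I q) == 0%E then I q else set0) else set0.
suff h : mu.-negligible (\bigcup_n N n).
  apply: negligibleS h => x /= /existsNP[e /not_implyP[e0 /negP]].
  rewrite -leNgt => mu0.
  have /rat_in_itvoo[q1] : x - e < x by rewrite ltrBlDr ltrDl.
  rewrite in_itv /= => /andP[q1l q1r].
  have /rat_in_itvoo[q2] : x < x + e by rewrite ltrDl.
  rewrite in_itv /= => /andP[q2l q2r].
  have NE : N (pickle (q1, q2)) = if mu (I (q1, q2)) == 0%E then I (q1, q2) else set0.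
    by rewrite /N pickleK.
  exists (pickle (q1, q2)); first exact: Logic.I.
  rewrite NE.
  have -> : mu (I (q1, q2)) == 0%E.
    rewrite -measure_le0; apply: le_trans mu0; apply: le_measure; rewrite ?inE //.
    - exact: measurable_itv.
    - exact: measurable_ball.
    move=> z; rewrite /I /= in_itv /= => /andP[z1 z2].
    by rewrite /ball /= ltr_norml; apply/andP; split; lra.
  by rewrite /I /= in_itv /= q1r.
apply: negligible_bigcup => n; rewrite /N; case: unpickle => [q|]; last exact: negligible_set0.
have [I0|_] := eqVneq (mu (I q)) 0%E; last exact: negligible_set0.
by apply/negligibleP => //; exact: measurable_itv.
Qed.

Lemma ae_and_witness d' {T' : measurableType d'} (mu : {measure set T' -> \bar R})
    (A : set T') (C : T' -> Prop) :
  measurable A -> (0 < mu A)%E -> {ae mu, forall x, C x} -> exists x, A x /\ C x.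
Proof.
move=> mA A0 [N [mN N0 hN]]; apply: contrapT => /forallNP h.
have : (mu A <= mu N)%E.
  apply: le_measure; rewrite ?inE // => x Ax; apply: hN => Cx; exact: (h x).
by rewrite leNgt N0 A0.
Qed.

Lemma ae_eq0_of_integral d' {T' : measurableType d'} (mu : {measure set T' -> \bar R}) (f : T' -> R) :
  mu.-integrable setT (EFin \o f) -> {ae mu, forall x, 0 <= f x} ->
  \int[mu]_x f x = 0 -> {ae mu, forall x, f x = 0}.
Proof.
move=> If f0 int0.
have mf : measurable_fun setT (EFin \o f) by exact: measurable_int If.
have mf' : measurable_fun setT f by exact/measurable_EFinP.
have /(ae_eq_integral_abs _ measurableT mf) : (\int[mu]_(x in setT) `|(EFin \o f) x| = 0)%E.
  rewrite -[LHS]fineK; last exact/integrable_fin_num/integrable_abse.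
  rewrite -[fine _]/(\int[mu]_x `|f x|) (@ae_eq_Rintegral _ _ _ mu _ f) ?int0 //.
    exact: measurableT_comp.
  by apply: filterS f0 => x; exact: ger0_norm.
by apply: filterS => x /(_ I) /= [].
Qed.

End distribution_lemmas.

Section sarmanov_tails.
Context {d : measure_display} {T : measurableType d} {R : realType} (P : probability T R).
Variables (X Y : {RV P >-> R}) (phi1 phi2 : R -> R) (theta d1 : R).
Hypothesis sm : sarmanov X Y phi1 phi2 theta.
Hypothesis phi1d : phi1 x @[x --> +oo] --> d1.
Hypothesis tail_gt0 : forall x, 0 < tail X x.
Notation F := (distribution P X).
Notation G := (distribution P Y).

Let m1 : measurable_fun setT phi1 := sarmanov_measurable1 sm.
Let m2 : measurable_fun setT phi2 := sarmanov_measurable2 sm.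
Let I1 : F.-integrable setT (EFin \o phi1).
Proof. by apply: integrable_distribution => //; exact: sarmanov_integrable1 sm. Qed.
Let I2 : G.-integrable setT (EFin \o phi2).
Proof. by apply: integrable_distribution => //; exact: sarmanov_integrable2 sm. Qed.

Lemma ae_sarmanov_ge0 : {ae G, forall y, 0 <= y}.
Proof. by apply: filterS (ae_dist_support Y) => y; exact: sarmanov_supp_ge0 sm _. Qed.

Lemma tailE s : tail X s = \int[F]_u \1_`]s, +oo[%classic u.
Proof. by rewrite /tail /ccdf /Rintegral integral_indic // setIT. Qed.

Lemma tail_nonincreasing : nonincreasing_fun (tail X).
Proof.
move=> x y xy; apply: fine_le; [exact: fin_num_measure..|].
apply: le_measure; rewrite ?inE //.
by move=> w /=; rewrite !in_itv /= !andbT; exact: le_lt_trans.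
Qed.

Lemma tail_le1 s : tail X s <= 1.
Proof. by rewrite -lee_fin fineK; [exact: probability_le1|exact: fin_num_measure]. Qed.

Definition weighted_tail (s : R) : R := \int[F]_u (\1_`]s, +oo[%classic u * phi1 u).
Notation Phi := weighted_tail.

Let normr_indic_le1 (A : set R) (u : R) : `|\1_A u| <= 1 :> R.
Proof. by rewrite indicE; case: (_ \in _); rewrite ?normr1 ?normr0. Qed.

Let Iphi1 s : F.-integrable setT (EFin \o (fun u => \1_`]s, +oo[%classic u * phi1 u)).
Proof.
apply: (integrable_bounded_by (h := fun u => `|phi1 u|)).
- exact: measurable_funM.
- exact: integrable_norm.
- by apply: aeW => u; rewrite normrM ler_piMl.
Qed.

Let Iindic s : F.-integrable setT (EFin \o (\1_`]s, +oo[%classic : R -> R)).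
Proof. by apply: integrable_indicP; exact: measurable_itv. Qed.

(** With the threshold [s] as a second variable this is a partial integral of a function on the
    plane, integrable for the product of the marginals. *)
Lemma measurable_weighted_tail : measurable_fun setT Phi.
Proof.
pose f (z : R * R) : R := \1_[set z : R * R | z.2 < z.1] z * phi1 z.1.
have mlt : measurable [set z : R * R | z.2 < z.1].
  rewrite (_ : [set z | _] = [set z : R * R | 0 < z.1 - z.2]); last first.
    by apply/seteqP; split => z /=; rewrite subr_gt0.
  by apply: (measurable_gt (f := fun z : R * R => z.1 - z.2)); exact: measurable_funB.
have mf : measurable_fun setT f.
  apply: measurable_funM; first exact: measurable_indic.
  exact: measurableT_comp m1 measurable_fst.
have fle x y : `|f (x, y)| <= `|phi1 x| * 1.
  by rewrite mulr1 /f normrM ler_piMl // indicE; case: (_ \in _); rewrite ?normr1 ?normr0.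
have I1' := integrable_norm I1.
have Ic : G.-integrable setT (EFin \o (fun=> 1 : R)) by exact: finite_measure_integrable_cst.
have := measurable_Rintegral2 (integrable_prod_dominated mf I1' Ic fle).
apply: eq_measurable_fun => s _; apply: eq_Rintegral => u _.
rewrite /f; congr (_ * _); rewrite !indicE; congr (nat_of_bool _)%:R.
by apply/idP/idP; rewrite !inE /= in_itv /= andbT.
Qed.

(** For fixed [y > 0] the event is [u > x / y], and the density integrated over such [u] splits into
    the tail and the weighted tail. At [y = 0] the event is empty because [x > 0]. *)
Lemma sarmanov_product_tail x : 0 < x ->
  fine (P [set w | x < X w * Y w]) =
  \int[G]_y (ind0 y * (tail X (x / y) + theta * phi2 y * Phi (x / y))).
Proof.
move=> x0; pose A := [set z : R * R | x < z.1 * z.2].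
have mA : measurable A by apply: (measurable_gt (f := fun z : R * R => z.1 * z.2)); exact: measurable_funM.
rewrite (_ : [set w | x < X w * Y w] = [set w | A (X w, Y w)]) // (sarmanov_law sm mA).
pose f (z : R * R) : R := \1_A z * (1 + theta * phi1 z.1 * phi2 z.2).
have mf : measurable_fun setT f.
  apply: measurable_funM; first exact: measurable_indic.
  apply: measurable_funD => //; apply: measurable_funM.
    by apply: measurable_funM => //; exact: measurableT_comp m1 measurable_fst.
  exact: measurableT_comp m2 measurable_snd.
have fle u y : `|f (u, y)| <= (1 + `|phi1 u|) * (1 + `|theta| * `|phi2 y|).
  rewrite /f /= normrM (le_trans (ler_piMl (normr_ge0 _) _)) //.
    by rewrite indicE; case: (_ \in _); rewrite ?normr1 ?normr0.
  apply: (le_trans (ler_normD _ _)); rewrite normr1 !normrM.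
  have := normr_ge0 (phi1 u); have := normr_ge0 (phi2 y); have := normr_ge0 theta.
  set a := `|phi1 u|; set b := `|phi2 y|; set c := `|theta| => c0 b0 a0.
  have : 0 <= c * b by exact: mulr_ge0.
  nra.
have Ia : F.-integrable setT (EFin \o (fun u => 1 + `|phi1 u|)).
  by apply: integrableRD; [exact: finite_measure_integrable_cst|exact: integrable_norm].
have Ib : G.-integrable setT (EFin \o (fun y => 1 + `|theta| * `|phi2 y|)).
  apply: integrableRD; first exact: finite_measure_integrable_cst.
  by apply: integrableRZ; exact: integrable_norm.
have If := integrable_prod_dominated mf Ia Ib fle.
transitivity (\int[(F \x G)%E]_z f z).
  pose mu : {measure set (R * R) -> \bar R} := (F \x G)%E.
  transitivity (fine (\int[mu]_(z in A) (1 + theta * phi1 z.1 * phi2 z.2)%:E)%E); first by [].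
  rewrite -[RHS]/(\int[mu]_z f z) /Rintegral [in LHS]integral_mkcond.
  congr fine; apply: eq_integral => z _.
  by rewrite patchE /f indicE; case: (z \in A); rewrite ?mul1r ?mul0r.
rewrite -(Rintegral_prod2 If); last first.
  by move=> y; exact: (@integrable_section2 _ _ _ _ _ F _ _ _ mf Ia fle).
apply: ae_eq_Rintegral.
- exact: measurable_Rintegral2 If.
- rewrite (_ : (fun y => _) = fun y => ind0 y * tail X (x / y) + theta * phi2 y * (ind0 y * Phi (x / y))); last first.
    by apply/funext => y; ring.
  apply: measurable_funD.
    by apply: measurable_ind0_div => //; apply: nonincreasing_measurable => //; exact: tail_nonincreasing.
  apply: measurable_funM; first exact: measurable_funM.
  by apply: measurable_ind0_div => //; exact: measurable_weighted_tail.
apply: filterS ae_sarmanov_ge0 => y; rewrite le_eqVlt => /predU1P[<-|y0].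
  rewrite ind0_le0 // mul0r (_ : Rintegral _ _ _ = \int[F]_u 0).
    by rewrite Rintegral_cst // mul0r.
  apply: eq_Rintegral => u _.
  have nA : ~ A (u, 0) by rewrite /A /= mulr0; apply/negP; rewrite -leNgt ltW.
  by rewrite /f indicE memNset // mul0r.
rewrite ind0_gt0 // mul1r tailE /Phi.
rewrite -RintegralZl // -RintegralD //; last exact: integrableRZ.
apply: eq_Rintegral => u _; rewrite /f /=.
have -> : \1_A (u, y) = \1_`]x / y, +oo[%classic u :> R.
  rewrite !indicE; congr (nat_of_bool _)%:R.
  by apply/idP/idP; rewrite !inE /= in_itv /= andbT ltr_pdivrMr.
ring.
Qed.

Let unbounded_support (C : R -> Prop) A : {ae F, forall u, C u} -> exists u, A < u /\ C u.
Proof.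
move=> hC; have mA := measurable_itv `]A, +oo[ (R := R).
have h0 : (0 < F `]A, +oo[%classic)%E.
  have := tail_gt0 A; rewrite /tail /ccdf -lte_fin fineK //; exact: fin_num_measure.
have [u [/= h hu]] := ae_and_witness mA h0 hC.
by exists u; split => //; move: h; rewrite in_itv /= andbT.
Qed.

(** Unless [theta * phi1] is 0 almost everywhere, the centred function [phi1] takes both signs on
    the support of [X], and nonnegativity of the density at two such points bounds [theta * phi2]
    from below and from above on the support of [Y]. *)
Lemma sarmanov_bounded_weight : exists (pw : R -> R) (b : R),
  [/\ measurable_fun setT pw, forall y, `|pw y| <= b,
      {ae G, forall y, forall s, theta * phi2 y * Phi s = pw y * Phi s} &
      {ae G, forall y, theta * d1 * phi2 y = pw y * d1}].
Proof.
have [t0|t0] := pselect ({ae F, forall u, theta * phi1 u = 0}).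
  (* Degenerate case: the products with [Phi] and with [d1] both vanish, so the zero weight does,
     whatever the size of [phi2]. *)
  exists (fun=> 0), 0; split => //; first by move=> y; rewrite normr0.
    apply: aeW => y s; rewrite mul0r mulrAC.
    rewrite (_ : theta * Phi s = 0) ?mul0r // /Phi -RintegralZl //.
    rewrite (@ae_eq_Rintegral _ _ _ _ _ (fun=> 0)) //.
    - by rewrite Rintegral_cst // mul0r.
    - by apply: measurable_funM => //; exact: measurable_funM.
    - by apply: filterS t0 => u u0; rewrite mulrCA u0 mulr0.
  (* Otherwise [theta * phi1] would be nonzero far out, where [X] still has mass because its tail is
     positive. *)
  have td : theta * d1 = 0.
    have [//|td] := eqVneq (theta * d1) 0.
    have h : theta * phi1 x @[x --> +oo] --> theta * d1 by apply: cvgM; [exact: cvg_cst|].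
    have [M [_ hM]] : \forall x \near +oo, theta * phi1 x != 0.
      have := cvgr_neq0 _ h; exact.
    have [u [Mu u0]] := unbounded_support M t0.
    by have := hM _ Mu; rewrite u0 eqxx.
  by apply: aeW => y; rewrite td mul0r mul0r.
have th0 : theta != 0.
  by apply/eqP => e; apply: t0; apply: aeW => u; rewrite e mul0r.
have int0 : \int[F]_u phi1 u = 0.
  rewrite Rintegral_distribution //; last exact: sarmanov_integrable1 sm.
  by have := sarmanov_centered1 sm; rewrite unlock /Rintegral => ->.
have nz : ~ {ae F, forall u, phi1 u = 0}.
  by move=> h; apply: t0; apply: filterS h => u ->; rewrite mulr0.
have [u1 [su1 pu1]] : exists u, dist_support X u /\ 0 < phi1 u.
  apply: contrapT => /forallNP h; apply: nz.
  have N0 : {ae F, forall u, 0 <= - phi1 u}.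
    apply: filterS (ae_dist_support X) => u su; rewrite oppr_ge0 leNgt; apply/negP => pu.
    by apply: (h u).
  have IN : F.-integrable setT (EFin \o (fun u => - phi1 u)).
    by have := integrableRZ (-1) I1; under eq_fun do rewrite mulN1r.
  have := ae_eq0_of_integral IN N0.
  under eq_Rintegral do rewrite -mulN1r.
  rewrite RintegralZl // int0 mulr0 => /(_ erefl).
  by apply: filterS => u /eqP; rewrite oppr_eq0 => /eqP.
have [u2 [su2 pu2]] : exists u, dist_support X u /\ phi1 u < 0.
  apply: contrapT => /forallNP h; apply: nz; apply: ae_eq0_of_integral => //.
  apply: filterS (ae_dist_support X) => u su; rewrite leNgt; apply/negP => pu.
  by apply: (h u).
(* Nonnegativity of the density at [u1] gives the lower bound [- (phi1 u1)^-1] on [theta * phi2],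
   and at [u2] the upper bound [(- phi1 u2)^-1]. *)
pose b := Num.max (phi1 u1)^-1 (- (phi1 u2))^-1.
pose B := [set y | `|theta * phi2 y| <= b].
have mB : measurable B.
  rewrite (_ : B = (fun y => `|theta * phi2 y|) @^-1` `]-oo, b]%classic); last first.
    by apply/seteqP; split => y; rewrite /= in_itv.
  rewrite -[X in measurable X]setTI; apply: measurableT_comp => //; exact: measurable_funM.
have hB : {ae G, forall y, B y}.
  apply: filterS (ae_dist_support Y) => y sy; rewrite /B /= ler_norml; apply/andP; split.
    have := sarmanov_density_ge0 sm su1 sy => h.
    have : - (phi1 u1)^-1 <= theta * phi2 y.
      rewrite -(ler_pM2l pu1) mulrN divff ?gt_eqF //; lra.
    by apply: le_trans; rewrite lerN2 le_max lexx.
  have := sarmanov_density_ge0 sm su2 sy => h.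
  apply: (@le_trans _ _ (- phi1 u2)^-1); last by rewrite le_max lexx orbT.
  have pu2' : 0 < - phi1 u2 by rewrite oppr_gt0.
  by rewrite -(ler_pM2l pu2') divff ?gt_eqF //; lra.
exists (fun y => \1_B y * (theta * phi2 y)), b; split.
- by apply: measurable_funM; [exact: measurable_indic|exact: measurable_funM].
- move=> y; rewrite indicE; have [By|By] := pselect (B y).
    by rewrite mem_set // mul1r.
  by rewrite memNset // mul0r normr0 le_max invr_ge0 ltW.
- by apply: filterS hB => y By s; rewrite indicE mem_set // mul1r.
- by apply: filterS hB => y By; rewrite indicE mem_set // mul1r mulrAC.
Qed.

Lemma weighted_tail_near (e : R) : 0 < e -> \forall s \near +oo, `|Phi s - d1 * tail X s| <= e * tail X s.
Proof.
move=> e0; move/cvgrPdist_le : phi1d => /(_ _ e0)[A [_ hA]].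
exists A; split; first exact: num_real.
move=> s As; rewrite tailE /Phi -RintegralZl // -RintegralB //; last exact: integrableRZ.
rewrite -RintegralZl //; apply: normr_Rintegral_le.
- by apply: measurable_funB; exact: measurable_funM.
- exact: integrableRZ.
apply: aeW => u; rewrite indicE; case: (boolP (u \in _)) => [|_].
  rewrite inE /= in_itv /= andbT => su; rewrite mul1r !mulr1 distrC.
  by apply: hA; exact: lt_trans su.
by rewrite mul0r !mulr0 subr0 normr0.
Qed.

Lemma tail_ratio_cvg : Phi s / tail X s @[s --> +oo] --> d1.
Proof.
apply/cvgrPdist_le => e e0; apply: filterS (weighted_tail_near e0) => s h.
have t := tail_gt0 s.
rewrite distrC (_ : _ - d1 = (Phi s - d1 * tail X s) / tail X s); last by field; rewrite gt_eqF.
by rewrite normrM normfV (gtr0_norm t) ler_pdivrMr.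
Qed.

(** Beyond some [A] the quotient is within 1 of [d1]; up to [A] the numerator is at most the mean of
    [|phi1|] and the denominator at least the tail at [A]. *)
Lemma tail_ratio_bounded : exists b, forall s, `|Phi s / tail X s| <= b.
Proof.
have [A [_ hA]] := weighted_tail_near ltr01.
pose V := \int[F]_u `|phi1 u|.
have V0 : 0 <= V by apply: Rintegral_ge0.
have PV s : `|Phi s| <= V.
  apply: normr_Rintegral_le; [exact: measurable_funM|exact: integrable_norm|].
  by apply: aeW => u; rewrite normrM ler_piMl.
exists (V / tail X A + (`|d1| + 1)) => s; have t := tail_gt0 s; have tA := tail_gt0 A.
rewrite normrM normfV (gtr0_norm t) ler_pdivrMr //.
have [sA|As] := leP s A.
  apply: (le_trans (PV s)); rewrite mulrDl -[leLHS]addr0; apply: lerD; last first.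
    by rewrite mulr_ge0 ?addr_ge0 // ltW.
  rewrite mulrAC ler_pdivlMr //; apply: ler_wpM2l => //; exact: tail_nonincreasing.
have := hA _ As; rewrite mul1r => h.
rewrite -[Phi s](subrK (d1 * tail X s)) (le_trans (ler_normD _ _)) // normrM (gtr0_norm t).
have : 0 <= V / tail X A * tail X s by rewrite mulr_ge0 ?divr_ge0 // ltW.
by rewrite !mulrDl mul1r; lra.
Qed.

(** The support of [X] is unbounded, so the constraint on the density can be followed along it to
    infinity. *)
Lemma sarmanov_limit_density_ge0 : {ae G, forall y, 0 <= 1 + theta * d1 * phi2 y}.
Proof.
apply: filterS (ae_dist_support Y) => y sy; rewrite leNgt; apply/negP => neg.
have h : 1 + theta * phi1 x * phi2 y @[x --> +oo] --> 1 + theta * d1 * phi2 y.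
  by apply: cvgD; [exact: cvg_cst|apply: cvgM; [apply: cvgM; [exact: cvg_cst|]|exact: cvg_cst]].
have [M [_ hM]] := cvgr_lt _ h _ neg.
have [u [Mu su]] := unbounded_support M (ae_dist_support X).
by have := hM _ Mu; rewrite ltNge (sarmanov_density_ge0 sm su sy).
Qed.

(** It is the integral over [u > s] of the density, nonnegative on the supports. *)
Lemma sarmanov_conditional_tail_ge0 :
  {ae G, forall y, forall s, 0 <= tail X s + theta * phi2 y * Phi s}.
Proof.
apply: filterS (ae_dist_support Y) => y sy s.
rewrite tailE /Phi -RintegralZl // -RintegralD //; last exact: integrableRZ.
rewrite -[leLHS](_ : \int[F]_u 0 = 0); last by rewrite Rintegral_cst // mul0r.
apply: ae_le_Rintegral.
- exact: finite_measure_integrable_cst.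
- by apply: integrableRD => //; exact: integrableRZ.
apply: filterS (ae_dist_support X) => u su.
rewrite (_ : _ + _ = \1_`]s, +oo[%classic u * (1 + theta * phi1 u * phi2 y)); last ring.
by rewrite mulr_ge0 ?(sarmanov_density_ge0 sm) // indicE.
Qed.

End sarmanov_tails.

(** * Deconvolution of the product tail *)

Section log_moments.
Context {R : realType} (alpha p : R).
Hypotheses (al0 : 0 < alpha) (ap : alpha < p).

(** The inequality [z <= expR z] at [z = c * t / 2], squared. *)
Lemma sqr_le_expR (c t : R) : 0 < c -> 0 <= t -> t ^+ 2 <= 4 / c ^+ 2 * expR (c * t).
Proof.
move=> c0 t0; have h := expR_ge1Dx (c * t / 2).
have h1 : c * t / 2 <= expR (c * t / 2) by apply: le_trans h; rewrite lerDr.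
have h0 : 0 <= c * t / 2 by rewrite divr_ge0 // mulr_ge0 // ltW.
have h2 : (c * t / 2) ^+ 2 <= expR (c * t / 2) ^+ 2.
  by apply: lerXn2r; rewrite ?nnegrE ?expR_ge0.
have e : expR (c * t / 2) ^+ 2 = expR (c * t).
  by rewrite expr2 -expRD -splitr.
rewrite e in h2.
rewrite mulrAC ler_pdivlMr ?exprn_gt0 //.
have -> : t ^+ 2 * c ^+ 2 = 4 * (c * t / 2) ^+ 2 by field.
by apply: ler_wpM2l.
Qed.

(** The squared logarithm is absorbed by the gap [p - alpha] for [y >= 1] and by [y ^ alpha] for
    [y < 1]; this yields the two logarithmic moments. *)
Lemma powR_ln_sqr_le : exists2 c, 0 <= c & forall y, 0 < y ->
  y `^ alpha * ln y ^+ 2 <= c * (1 + y `^ p).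
Proof.
have del0 : 0 < p - alpha by rewrite subr_gt0.
exists (4 / (p - alpha) ^+ 2 + 4 / alpha ^+ 2).
  by rewrite addr_ge0 // divr_ge0 // sqr_ge0.
move=> y y0; rewrite /powR !gt_eqF //; set t := ln y.
have c1 : 0 <= 4 / (p - alpha) ^+ 2 by rewrite divr_ge0 // sqr_ge0.
have c2 : 0 <= 4 / alpha ^+ 2 by rewrite divr_ge0 // sqr_ge0.
have e0 : 0 <= expR (p * t) := expR_ge0 _.
have [t0|t0] := leP 0 t.
  have h := sqr_le_expR del0 t0.
  apply: (@le_trans _ _ (4 / (p - alpha) ^+ 2 * expR (p * t))).
    rewrite (_ : p * t = alpha * t + (p - alpha) * t); last ring.
    rewrite expRD [leRHS]mulrCA; apply: ler_wpM2l => //; exact: expR_ge0.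
  by apply: ler_pM => //; [rewrite lerDl|rewrite lerDr].
have t0' : 0 <= - t by rewrite oppr_ge0 ltW.
have h := sqr_le_expR al0 t0'; rewrite sqrrN in h.
apply: (@le_trans _ _ (4 / alpha ^+ 2 * 1)).
  rewrite [X in _ <= _ * X](_ : 1 = expR (alpha * t) * expR (alpha * - t)); last first.
    by rewrite -expRD mulrN subrr expR0.
  rewrite [leRHS]mulrCA; apply: ler_wpM2l => //; exact: expR_ge0.
by apply: ler_pM => //; [rewrite lerDr|rewrite lerDl].
Qed.

End log_moments.

Lemma dominatedly_varying_bound {R : realType} (F : R -> R) (y : R) :
  dominatedly_varying F -> 0 < y < 1 ->
  exists C, \forall x \near +oo, F (x * y) <= C * F x.
Proof.
move=> [F0 /[apply]]; rewrite /limf_esup => /ereal_inf_lt[_ [V nV <-]] sup.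
have [C hC] : exists C : R, (ereal_sup ((fun x => (F (x * y) / F x)%:E) @` V) <= C%:E)%E.
  case: (ereal_sup _) sup => [c _|//|_]; first by exists c.
  by exists 0; rewrite leNye.
exists C; apply: filterS nV => x Vx; rewrite -ler_pdivrMr // -lee_fin.
by apply: le_trans hC; apply: ereal_sup_ubound; exists x.
Qed.

Lemma cvg_expR_pinfty {R : realType} : @expR R t @[t --> +oo] --> +oo.
Proof.
apply/cvgryPge => M; exists M; split; first exact: num_real.
move=> t Mt; apply: le_trans (expR_ge1Dx t); rewrite -[leLHS]add0r; apply: lerD => //.
exact: ltW.
Qed.

Lemma cvg_ln_pinfty {R : realType} : @ln R x @[x --> +oo] --> +oo.
Proof.
apply/cvgryPge => M; exists (expR M); split; first exact: num_real.
move=> x Mx; rewrite -[leLHS]expRK ler_ln ?posrE ?expR_gt0 //; first exact: ltW.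
exact: lt_trans (expR_gt0 _) Mx.
Qed.

Section deconvolution.
Context {R : realType} (G : probability R R).
Variables (Fb H r pw : R -> R) (alpha p d1 br bp : R).
Hypotheses (al0 : 0 < alpha) (ap : alpha < p).
Hypotheses (Fni : nonincreasing_fun Fb) (F0 : forall x, 0 < Fb x) (F1 : forall x, Fb x <= 1).
Hypothesis FD : dominatedly_varying Fb.
Hypotheses (Hni : nonincreasing_fun H) (H0 : forall x, 0 <= H x) (H1 : forall x, H x <= 1).
Hypothesis rvH : regularly_varying H alpha.
Hypotheses (mr : measurable_fun setT r) (rb : forall s, `|r s| <= br).
Hypothesis rd1 : r s @[s --> +oo] --> d1.
Hypotheses (mpw : measurable_fun setT pw) (pwb : forall y, `|pw y| <= bp).
Hypothesis Gp : G.-integrable setT (EFin \o (fun y => y `^ p)).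
Hypothesis HE : forall x : R, 0 < x ->
  H x = \int[G]_y (ind0 y * (Fb (x / y) * (1 + pw y * r (x / y)))).
Hypothesis pos_s : {ae G, forall y, forall s, 0 <= 1 + pw y * r s}.
Hypothesis pos_d : {ae G, forall y, 0 <= 1 + pw y * d1}.

(** The bounded [pw y * d1] stands for [theta * d1 * phi2 y], and [ind0] keeps away the points
    [y <= 0], where [ln y] is meaningless. *)
Definition dweight (y : R) : R := ind0 y * y `^ alpha * (1 + pw y * d1).
Notation W := dweight.
Hypothesis CS0 : forall b, transform G W (@ln R) cos b ^+ 2 + transform G W (@ln R) sin b ^+ 2 != 0.

Let Hp := regularly_varying_gt0 Hni H0 rvH.
Let p0 : 0 < p := lt_trans al0 ap.
Let mF : measurable_fun setT Fb. Proof. exact: nonincreasing_measurable. Qed.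
Let mH : measurable_fun setT H. Proof. exact: nonincreasing_measurable. Qed.
Let mid : measurable_fun setT (fun y : R => y). Proof. exact: measurable_id. Qed.
Let Iya : G.-integrable setT (EFin \o (fun y => ind0 y * y `^ alpha)).
Proof. exact: (integrable_ind0_powR mid ap Gp al0). Qed.

Let d1br : `|d1| <= br.
Proof.
have h : `|r s| @[s --> +oo] --> `|d1| by exact: cvg_norm.
by apply: (cvgr_to_le h); apply: nearW.
Qed.

Let mwd : measurable_fun setT (fun y => 1 + pw y * d1).
Proof. by apply: measurable_funD => //; exact: measurable_funM. Qed.

Let br0 : 0 <= br. Proof. exact: le_trans (rb 0). Qed.
Let bp0 : 0 <= bp. Proof. exact: le_trans (pwb 0). Qed.

Let wbound y (s : R) : `|s| <= br -> `|1 + pw y * s| <= 1 + bp * br.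
Proof.
move=> sb; apply: (le_trans (ler_normD _ _)); rewrite normr1 lerD2l normrM.
exact: ler_pM.
Qed.

Let mW : measurable_fun setT W.
Proof.
by apply: measurable_funM => //; apply/measurable_EFinP; exact: measurable_int Iya.
Qed.

Let Wle y : `|W y| <= (1 + bp * br) * (ind0 y * y `^ alpha).
Proof.
rewrite /W normrM mulrC (ger0_norm (x := ind0 y * _)) ?mulr_ge0 ?ind0_ge0 ?powR_ge0 //.
by apply: ler_wpM2r; [rewrite mulr_ge0 ?ind0_ge0 ?powR_ge0|exact: wbound].
Qed.

Let IW : G.-integrable setT (EFin \o W).
Proof.
apply: (integrable_bounded_by (h := fun y => (1 + bp * br) * (ind0 y * y `^ alpha))) => //.
- exact: integrableRZ.
- exact: aeW.
Qed.

Let mln : measurable_fun setT (@ln R). Proof. exact: measurable_ln. Qed.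

Let IWLL : G.-integrable setT (EFin \o (fun y => W y * ln y * ln y)).
Proof.
have [c c0 hc] := powR_ln_sqr_le al0 ap.
apply: (integrable_bounded_by (h := fun y => (1 + bp * br) * c * (1 + y `^ p))).
- by apply: measurable_funM => //; exact: measurable_funM.
- apply: integrableRZ; apply: integrableRD => //; exact: finite_measure_integrable_cst.
- apply: aeW => y; rewrite -mulrA -expr2 normrM (ger0_norm (sqr_ge0 _)).
  apply: (le_trans (ler_wpM2r (sqr_ge0 _) (Wle y))).
  have B0 : 0 <= 1 + bp * br by rewrite addr_ge0 // mulr_ge0.
  have yp : 0 <= 1 + y `^ p by rewrite addr_ge0 // powR_ge0.
  have [y0|y0] := ltP 0 y; last by rewrite ind0_le0 // mul0r mulr0 mul0r !mulr_ge0.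
  rewrite ind0_gt0 // mul1r -!mulrA; apply: ler_wpM2l => //; exact: hc.
Qed.

Let IWL : G.-integrable setT (EFin \o (fun y => W y * ln y)).
Proof.
apply: (integrable_bounded_by (h := fun y => `|W y| + `|W y * ln y * ln y|)).
- exact: measurable_funM.
- by apply: integrableRD; exact: integrable_norm.
- apply: aeW => y; rewrite (normrM (W y * ln y)) (normrM (W y)).
  have := normr_ge0 (ln y); have := normr_ge0 (W y).
  set a := `|ln y|; set b := `|W y| => b0 a0.
  have h1 := mulr_ge0 b0 (sqr_ge0 (a - 1)); have h2 := mulr_ge0 b0 a0; nra.
Qed.

Let W0 : {ae G, forall y, 0 <= W y}.
Proof. by apply: filterS pos_d => y h; rewrite /W !mulr_ge0 ?ind0_ge0 ?powR_ge0. Qed.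

(** The nonvanishing condition at frequency 0, where the cosine transform is the mass and the sine
    transform is 0. *)
Let m_neq0 : \int[G]_y W y != 0.
Proof.
apply/eqP => m0; have := CS0 0; rewrite /transform.
under eq_Rintegral do rewrite mul0r cos0 mulr1.
rewrite m0; under eq_Rintegral do rewrite mul0r sin0 mulr0.
by rewrite Rintegral_cst // mul0r expr0n addr0 eqxx.
Qed.

Lemma dweight_gt0 : 0 < \int[G]_y W y.
Proof.
rewrite lt_neqAle eq_sym m_neq0 /=.
rewrite -[leLHS](_ : \int[G]_y 0 = 0); last by rewrite Rintegral_cst // mul0r.
by apply: ae_le_Rintegral => //; exact: finite_measure_integrable_cst.
Qed.

Let mind0r x : measurable_fun setT (fun y => ind0 y * r (x / y)).
Proof. exact: measurable_ind0_div. Qed.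


Let ind0_conv y a b s : ind0 y * (a * (1 + b * s)) = ind0 y * a * (1 + b * (ind0 y * s)) :> R.
Proof.
have [y0|y0] := ltP 0 y; first by rewrite ind0_gt0 // !mul1r.
by rewrite ind0_le0 // !mul0r.
Qed.

Let ind0r_le y s : `|s| <= br -> `|ind0 y * s| <= br.
Proof.
move=> h; apply: le_trans h; rewrite normrM (ger0_norm (ind0_ge0 y)).
by rewrite ler_piMl // ind0_le1.
Qed.

Let mfac x : measurable_fun setT (fun y => 1 + pw y * (ind0 y * r (x / y))).
Proof. by apply: measurable_funD => //; exact: measurable_funM. Qed.

(** Otherwise [1 + pw y * d1], being nonnegative, would vanish almost everywhere on each half-line
    []e n, +oo[], hence on [y > 0], and [W] would have mass 0. *)
Lemma limit_weight_positive_mass : exists2 eta : R, 0 < eta < 1 &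
  0 < \int[G]_y (\1_`]eta, +oo[%classic y * (1 + pw y * d1)).
Proof.
apply: contrapT => neg.
(* Starting from 2 keeps every [e n] below 1. *)
pose e n : R := n.+2%:R^-1.
have e01 n : 0 < e n < 1 by rewrite invr_gt0 ltr0Sn /= invf_lt1 ?ltr0Sn // ltr1n.
have h n : {ae G, forall y, \1_`](e n), +oo[%classic y * (1 + pw y * d1) = 0}.
  have mi : measurable_fun setT (\1_`](e n), +oo[%classic : R -> R).
    by apply: measurable_indic; exact: measurable_itv.
  have Iw : G.-integrable setT (EFin \o (fun y => \1_`](e n), +oo[%classic y * (1 + pw y * d1))).
    apply: (@integrable_prob_bounded _ _ _ G _ (1 + bp * br)); first exact: measurable_funM.
    apply: aeW => y; rewrite normrM indicE; case: (_ \in _).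
      by rewrite normr1 mul1r; exact: wbound.
    by rewrite normr0 mul0r addr_ge0 // mulr_ge0.
  have pos : {ae G, forall y, 0 <= \1_`](e n), +oo[%classic y * (1 + pw y * d1)}.
    by apply: filterS pos_d => y hy; rewrite mulr_ge0 // indicE.
  apply: (ae_eq0_of_integral Iw pos); apply/eqP; rewrite eq_le; apply/andP; split.
    by rewrite leNgt; apply/negP => lt; apply: neg; exists (e n).
  rewrite -[leLHS](_ : \int[G]_y 0 = 0); last by rewrite Rintegral_cst // mul0r.
  by apply: ae_le_Rintegral => //; exact: finite_measure_integrable_cst.
have := dweight_gt0; rewrite (@ae_eq_Rintegral _ _ _ _ _ (fun=> 0)) //.
  by rewrite Rintegral_cst // mul0r ltxx.
have /filterS := ae_foralln h; apply => y hy.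
rewrite /W; have [y0|y0] := ltP 0 y; last by rewrite ind0_le0 // !mul0r.
have [n yn] : exists n, e n < y.
  exists (Num.truncn y^-1); rewrite /e invf_plt ?posrE //.
  by apply: (lt_le_trans (truncnS_gt _)); rewrite ler_nat.
have := hy n; rewrite indicE mem_set /=; last by rewrite in_itv /= yn.
by rewrite mul1r => ->; rewrite mulr0.
Qed.

(* Far from the origin the limiting weight has positive mass, which bounds [H]
   below by a multiple of [Fb (x / eta)]; class D then replaces [x / eta] by [x]. *)
Lemma tail_dominated : exists2 C0, 0 <= C0 & forall x, Fb x <= C0 * H x.
Proof.
have [eta /andP[eta0 eta1]] := limit_weight_positive_mass.
set I : set R := `]eta, +oo[%classic; set M := \int[G]_y _ => M0.
have mi : measurable_fun setT (\1_I : R -> R) by apply: measurable_indic; exact: measurable_itv.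
have i_le y : `|\1_I y| <= 1 :> R by rewrite indicE; case: (_ \in _); rewrite ?normr1 ?normr0.
have iE0 y : y <= eta -> \1_I y = 0 :> R.
  by move=> y0; rewrite indicE memNset // /I /= in_itv /= ltNge y0.
have iE1 y : eta < y -> \1_I y = 1 :> R.
  by move=> y0; rewrite indicE mem_set // /I /= in_itv /= y0.
pose MI x := \int[G]_y (\1_I y * (1 + pw y * (ind0 y * r (x / y)))).
have fle x y : `|\1_I y * (1 + pw y * (ind0 y * r (x / y)))| <= 1 + bp * br.
  rewrite normrM -[leRHS]mul1r; apply: ler_pM => //; apply: wbound; exact: ind0r_le.
have MIc : MI x @[x --> +oo] --> M.
  apply: (Rintegral_cvg_pinfty (h := fun=> 1 + bp * br)).
  - by move=> x; exact: measurable_funM.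
  - exact: measurable_funM.
  - exact: finite_measure_integrable_cst.
  - by apply: nearW => x; apply: aeW.
  - apply: aeW => y; have [y0|y0] := leP y eta.
      rewrite iE0 //.
      by under eq_fun do rewrite mul0r; rewrite mul0r; exact: cvg_cst.
    have y00 := lt_trans eta0 y0.
    under eq_fun do rewrite ind0_gt0 // mul1r mulrC.
    have := cvg_comp_scale (c := y^-1); rewrite invr_gt0 => /(_ _ _ y00 rd1) h.
    rewrite (_ : (fun x => _) = fun x => \1_I y * (1 + pw y * r (y^-1 * x))); last first.
      by apply/funext => x; rewrite mulrC [y^-1 * x]mulrC.
    apply: cvgM; first exact: cvg_cst.
    by apply: cvgD; [exact: cvg_cst|apply: cvgM; [exact: cvg_cst|]].
have lower x : 0 < x -> Fb (x / eta) * MI x <= H x.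
  move=> x0; rewrite HE // -RintegralZl //; last first.
    by apply: (@integrable_prob_bounded _ _ _ G _ (1 + bp * br)); [exact: measurable_funM|exact: aeW].
  apply: ae_le_Rintegral.
  - by apply: integrableRZ; apply: (@integrable_prob_bounded _ _ _ G _ (1 + bp * br)); [exact: measurable_funM|exact: aeW].
  - rewrite (funext (fun y => ind0_conv y (Fb (x / y)) (pw y) (r (x / y)))).
    apply: (@integrable_prob_bounded _ _ _ G _ (1 * (1 + bp * br))).
      by apply: measurable_funM => //; exact: measurable_ind0_div.
    apply: aeW => y; rewrite normrM; apply: ler_pM => //; last by apply: wbound; exact: ind0r_le.
    rewrite normrM (ger0_norm (ind0_ge0 y)) (gtr0_norm (F0 _)) -[leRHS]mul1r.
    by apply: ler_pM; rewrite ?ind0_ge0 ?ind0_le1 // ltW.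
  - apply: filterS pos_s => y hy; have [y0|y0] := leP y eta.
      by rewrite iE0 // mul0r mulr0 mulr_ge0 ?ind0_ge0 // mulr_ge0 // ltW.
    have y00 := lt_trans eta0 y0.
    rewrite iE1 // ind0_gt0 // !mul1r; apply: ler_wpM2r => //; apply: Fni.
    by apply: ler_wpM2l; [exact: ltW|rewrite lef_pV2 ?posrE // ltW].
have eta01 : 0 < eta < 1 by rewrite eta0.
have [C [A1 [_ hA1]]] := dominatedly_varying_bound FD eta01.
have [A2 [_ hA2]] : \forall x \near +oo, M / 2 < MI x.
  by apply: (cvgr_gt M) => //; rewrite ltr_pdivrMr // ltr_pMr // ltr1n.
pose A := Num.max 1 (Num.max (A1 + 1) (A2 + 1)).
have [A10 [AA1 AA2]] : 1 <= A /\ A1 < A /\ A2 < A.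
  split; first by rewrite le_max lexx.
  by split; [apply: (@lt_le_trans _ _ (A1 + 1))|apply: (@lt_le_trans _ _ (A2 + 1))];
    rewrite ?ltrDl // !le_max lexx ?orbT.
have HA := Hp A; have c1 : 0 <= `|C| * (2 / M) by rewrite mulr_ge0 // divr_ge0 // ltW.
(* The first term is for [x > A], where the lower bound on [H] and class D hold; the second is for
   [x <= A], where [Fb] is at most 1 and [H] at least [H A]. *)
exists (`|C| * (2 / M) + (H A)^-1); first by rewrite addr_ge0 // invr_ge0 ltW.
move=> x; have Hx := Hp x; have [xA|Ax] := leP x A.
  apply: (le_trans (F1 x)); rewrite mulrDl -[leLHS]add0r; apply: lerD.
    by rewrite mulr_ge0 // ltW.
  by rewrite mulrC ler_pdivlMr // mul1r; exact: Hni.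
have x0 : 0 < x by apply: lt_le_trans (ltW Ax); apply: lt_le_trans A10.
have xe : x <= x / eta by rewrite ler_pdivlMr // ler_piMr // ltW.
have h1 : Fb x <= `|C| * Fb (x / eta).
  have := hA1 (x / eta) (lt_le_trans (lt_trans AA1 Ax) xe); rewrite divfK ?gt_eqF // => h.
  by apply: (le_trans h); rewrite ler_pM2r // ler_norm.
have h2 := hA2 _ (lt_trans AA2 Ax).
have h3 : Fb (x / eta) * (M / 2) <= H x.
  by apply: le_trans (lower _ x0); rewrite ler_pM2l // ltW.
apply: (@le_trans _ _ (`|C| * (2 / M) * H x)); last by rewrite ler_pM2r // lerDl invr_ge0 ltW.
apply: (le_trans h1); rewrite -mulrA; apply: ler_wpM2l => //.
rewrite -(ler_pM2r (x := M / 2)) ?divr_gt0 //; apply: (le_trans h3).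
by rewrite mulrAC (_ : 2 / M * (M / 2) = 1) ?mul1r //; field; rewrite gt_eqF.
Qed.

Let q x := Fb x / H x.

Let mq : measurable_fun setT q.
Proof.
rewrite (_ : q = fun x => Fb x * H x `^ (-1)); last first.
  by apply/funext => x; rewrite powR_inv1 ?(ltW (Hp x)).
by apply: measurable_funM => //; exact: measurableT_comp (measurable_powR _) mH.
Qed.

Let q0 x : 0 < q x. Proof. by rewrite divr_gt0. Qed.

(** The equation for [H] divided by [H x] reads 1 as an integral of [H (x / y) / H x] against a
    bounded weight built from the quotient [q (x / y)]. The uniform form of Breiman's lemma puts
    [y ^ alpha] in place of the ratio, and dominated convergence puts [d1] in place of
    [r (x / y)]. *)
Lemma weighted_quotient_cvg :
  \int[G]_y (W y * (ind0 y * q (x / y))) @[x --> +oo] --> (1 : R).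
Proof.
have [C0 C00 FC] := tail_dominated.
have qC x : q x <= C0 by rewrite ler_pdivrMr.
have qi x y : `|ind0 y * q (x / y)| <= C0.
  rewrite normrM (ger0_norm (ind0_ge0 y)) (gtr0_norm (q0 _)) -[leRHS]mul1r.
  by apply: ler_pM; rewrite ?ind0_ge0 ?ind0_le1 // ltW.
have mqi x : measurable_fun setT (fun y => ind0 y * q (x / y)) by exact: measurable_ind0_div.
(* The weight is bounded thanks to [tail_dominated], but its behaviour as [x] grows is unknown at
   this point. *)
pose g x y := (ind0 y * q (x / y)) * (1 + pw y * (ind0 y * r (x / y))).
have mg x : measurable_fun setT (g x) by exact: measurable_funM.
have gb x y : `|g x y| <= C0 * (1 + bp * br).
  by rewrite normrM; apply: ler_pM => //; apply: wbound; exact: ind0r_le.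
have br1 := breiman_uniform mid Hni H0 H1 rvH ap p0 Gp al0 mg gb.
have lim1 : \int[G]_y (ind0 y * y `^ alpha * g x y) @[x --> +oo] --> (1 : R).
  have : 1 - (\int[G]_y (ind0 y * H (x / y) * g x y) / H x - \int[G]_y (ind0 y * y `^ alpha * g x y))
      @[x --> +oo] --> (1 - 0 : R) by apply: cvgB => //; exact: cvg_cst.
  rewrite subr0; apply: cvg_trans; apply: near_eq_cvg.
  exists 0; split => // x x0.
  rewrite (_ : \int[G]_y (ind0 y * H (x / y) * g x y) = H x).
    by rewrite divff ?gt_eqF // opprB addrC subrK.
  rewrite HE //; apply: eq_Rintegral => y _; rewrite ind0_conv /g /q.
  have [y0|y0] := ltP 0 y; last by rewrite ind0_le0 // !mul0r.
  by rewrite ind0_gt0 // !mul1r mulrA mulrCA divff ?gt_eqF // mulr1.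
(* The error made in replacing [r (x / y)] by its limit; [q] needs only to be bounded. *)
have lim2 : \int[G]_y (ind0 y * y `^ alpha * ((ind0 y * q (x / y)) * (pw y * (ind0 y * r (x / y) - d1))))
    @[x --> +oo] --> (0 : R).
  rewrite (_ : 0 = \int[G]_y (fun=> 0 : R) y); last by rewrite Rintegral_cst // mul0r.
  apply: (Rintegral_cvg_pinfty (h := fun y => (C0 * (bp * (br + br))) * (ind0 y * y `^ alpha))) => //.
  - move=> x; apply: measurable_funM; first by apply/measurable_EFinP; exact: measurable_int Iya.
    by apply: measurable_funM => //; apply: measurable_funM => //; exact: measurable_funB.
  - exact: integrableRZ.
  - apply: nearW => x; apply: aeW => y.
    rewrite normrM mulrC (ger0_norm (x := ind0 y * y `^ _)) ?mulr_ge0 ?ind0_ge0 ?powR_ge0 //.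
    apply: ler_wpM2r; first by rewrite mulr_ge0 ?ind0_ge0 ?powR_ge0.
    rewrite normrM; apply: ler_pM => //; rewrite normrM; apply: ler_pM => //.
    by apply: (le_trans (ler_normB _ _)); apply: lerD => //; exact: ind0r_le.
  - apply: aeW => y; have [y0|y0] := leP y 0.
      by under eq_fun do rewrite ind0_le0 // !mul0r; exact: cvg_cst.
    have := cvg_comp_scale (c := y^-1); rewrite invr_gt0 => /(_ _ _ y0 rd1) h.
    have y1 : 0 <= y `^ alpha * C0 * bp by rewrite !mulr_ge0 ?powR_ge0.
    apply/cvgr0Pnorm_le => e e0.
    have [k k0 hk] : exists2 k, 0 < k & y `^ alpha * C0 * bp * k <= e.
      exists (e / (1 + y `^ alpha * C0 * bp)); first by rewrite divr_gt0 // ltr_wpDr.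
      rewrite mulrCA ger_pMr // ler_pdivrMr ?ltr_wpDr // mul1r lerDr //.
    move/cvgrPdist_le : h => /(_ _ k0); apply: filterS => x hx.
    rewrite ind0_gt0 // !mul1r; move: (qC (x / y)) (q0 (x / y)).
    move: (q (x / y)) => z zC z0.
    rewrite !normrM (ger0_norm (powR_ge0 _ _)) (gtr0_norm z0) !mulrA.
    apply: le_trans hk; apply: ler_pM => //.
    - by rewrite !mulr_ge0 ?powR_ge0 // ltW.
    - apply: ler_pM => //; first by rewrite mulr_ge0 ?powR_ge0 // ltW.
      by apply: ler_wpM2l; rewrite ?powR_ge0.
    - by rewrite distrC [x / y]mulrC.
rewrite (_ : 1 = 1 - 0 :> R); last by rewrite subr0.
rewrite [X in X @ _ --> _](_ : _ = fun x => \int[G]_y (ind0 y * y `^ alpha * g x y) -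
  \int[G]_y (ind0 y * y `^ alpha * ((ind0 y * q (x / y)) * (pw y * (ind0 y * r (x / y) - d1))))).
  exact: cvgB.
apply/funext => x; rewrite -RintegralB //.
- by apply: eq_Rintegral => y _; rewrite /W /g; ring.
- apply: (integrable_bounded_by (h := fun y => (C0 * (1 + bp * br)) * (ind0 y * y `^ alpha))).
  + by apply: measurable_funM => //; apply/measurable_EFinP; exact: measurable_int Iya.
  + exact: integrableRZ.
  + apply: aeW => y; rewrite normrM mulrC (ger0_norm (x := ind0 y * y `^ _)) ?mulr_ge0 ?ind0_ge0 ?powR_ge0 //.
    by apply: ler_wpM2r => //; rewrite mulr_ge0 ?ind0_ge0 ?powR_ge0.
- apply: (integrable_bounded_by (h := fun y => (C0 * (bp * (br + br))) * (ind0 y * y `^ alpha))).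
  + apply: measurable_funM; first by apply/measurable_EFinP; exact: measurable_int Iya.
    by apply: measurable_funM => //; apply: measurable_funM => //; exact: measurable_funB.
  + exact: integrableRZ.
  + apply: aeW => y.
    rewrite normrM mulrC (ger0_norm (x := ind0 y * y `^ _)) ?mulr_ge0 ?ind0_ge0 ?powR_ge0 //.
    apply: ler_wpM2r; first by rewrite mulr_ge0 ?ind0_ge0 ?powR_ge0.
    rewrite normrM; apply: ler_pM => //; rewrite normrM; apply: ler_pM => //.
    by apply: (le_trans (ler_normB _ _)); apply: lerD => //; exact: ind0r_le.
Qed.

Let Q t := q (expR t).

(** The numerator is nonincreasing, so [Q] can rise only through [H], and
    [H (expR t) / H (expR (t + eta))] tends to [expR (alpha * eta)]. *)
Lemma log_quotient_slowly_decreasing k : 1 < k -> exists2 eta : R, 0 < eta &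
  exists t0 : R, forall t s, t0 <= t -> 0 <= s <= eta -> Q (t + s) <= k * Q t.
Proof.
move=> k1; have k0 : 0 < k := lt_trans ltr01 k1; have lk : 0 < ln k by rewrite ln_gt0.
(* Then [expR (alpha * eta)] is the square root of [k], which leaves room below [k]. *)
exists (ln k / (2 * alpha)); first by rewrite divr_gt0 // mulr_gt0.
set eta := ln k / _.
have hlt : k^-1 < expR eta `^ (- alpha).
  rewrite -expRM -[ltLHS]lnK ?posrE ?invr_gt0 // ltr_expR lnV ?posrE //.
  have -> : eta * - alpha = - (ln k / 2) by rewrite /eta; field; rewrite gt_eqF.
  by rewrite ltrN2 ltr_pdivrMr // ltr_pMr // ltr1n.
have [A [_ hA]] := cvgr_gt _ (regularly_varying_ratio Hni H0 rvH (expR_gt0 eta)) _ hlt.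
exists A => t s At /andP[s0 seta].
have Ax : A < expR t by apply: lt_le_trans (expR_ge1Dx t); rewrite addrC ltr_pwDr.
have := hA _ Ax; rewrite -expRD ltr_pdivlMr // mulrC ltr_pdivrMr // mulrC => h.
rewrite /Q /q mulrA ler_pdivrMr // mulrAC ler_pdivlMr //.
have h1 : Fb (expR (t + s)) <= Fb (expR t) by apply: Fni; rewrite ler_expR lerDl.
have h2 : H (expR t) <= k * H (expR (t + s)).
  by apply: (le_trans (ltW h)); rewrite ler_pM2l //; apply: Hni; rewrite ler_expR lerD2l.
apply: (@le_trans _ _ (Fb (expR t) * (k * H (expR (t + s))))).
  by apply: ler_pM => //; exact: ltW.
by rewrite mulrCA mulrA.
Qed.

(** In the variable [t = ln x] the multiplicative convolution becomes additive, with [ln] in the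
    role of [L], and Wiener's argument applies with limit [c = 1]. *)
Lemma tail_quotient_cvg : Fb x / H x @[x --> +oo] --> (\int[G]_y W y)^-1.
Proof.
have [C0 C00 FC] := tail_dominated.
have Qb t : `|Q t| <= C0 by rewrite (gtr0_norm (q0 _)) /Q /q ler_pdivrMr.
have mQ : measurable_fun setT Q by apply: measurableT_comp.
have WQc : \int[G]_y (W y * Q (t - ln y)) @[t --> +oo] --> (1 : R).
  rewrite (_ : (fun t => _) = (fun x => \int[G]_y (W y * (ind0 y * q (x / y)))) \o expR).
    by apply: cvg_comp; [exact: cvg_expR_pinfty|exact: weighted_quotient_cvg].
  apply/funext => t /=; apply: eq_Rintegral => y _; rewrite /W.
  have [y0|y0] := ltP 0 y; last by rewrite ind0_le0 // !mul0r.
  by rewrite ind0_gt0 // !mul1r /Q expRB lnK.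
have := wiener_tauberian mln mW IW IWL IWLL CS0 mQ Qb WQc (fun t => ltW (q0 _))
  log_quotient_slowly_decreasing dweight_gt0.
rewrite mul1r => limQ.
have : (Q \o @ln R) x @[x --> +oo] --> (\int[G]_y W y)^-1.
  by apply: (@cvg_comp _ _ _ (@ln R) Q _ _ _ _ limQ); exact: cvg_ln_pinfty.
apply: cvg_trans; apply: near_eq_cvg.
by exists 0; split => // x x0; rewrite /= /Q lnK.
Qed.

End deconvolution.

(** * From the Sarmanov law to the two tail asymptotics *)

Lemma rexpectationE {d : measure_display} {T : measurableType d} {R : realType}
  (P : probability T R) (Z : T -> R) : rexpectation P Z = \int[P]_w Z w.
Proof. by rewrite /rexpectation /Rintegral unlock. Qed.

Lemma tail_eq {d : measure_display} {T : measurableType d} {R : realType}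
  (P : probability T R) (X Y : nat -> {RV P >-> R}) i :
  iid P (fun i w => (X i w, Y i w)) -> tail (X i) = tail (X 0%N).
Proof.
move=> [_ ident]; apply/funext => x; rewrite /tail /ccdf /distribution /pushforward.
have := ident i 0%N (`]x, +oo[%classic `*` setT).
have h k : (fun w => (X k w, Y k w)) @^-1` (`]x, +oo[%classic `*` setT) = X k @^-1` `]x, +oo[%classic.
  by apply/seteqP; split => w /= => [[]|].
by rewrite !h => -> //; apply: measurableX => //; exact: measurable_itv.
Qed.

Section weight_moments.
Context {d : measure_display} {T : measurableType d} {R : realType} (P : probability T R).
Variables (Y : {RV P >-> R}) (phi2 pw : R -> R) (c d1 alpha bp : R).
Notation G := (distribution P Y).
Hypothesis m2 : measurable_fun setT phi2.
Hypotheses (mpw : measurable_fun setT pw) (pwb : forall y, `|pw y| <= bp).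
Hypothesis cpw : {ae G, forall y, c * phi2 y = pw y * d1}.
Hypotheses (Y0 : {ae P, forall w, 0 <= Y w}) (al0 : 0 < alpha).
Hypothesis Ya : P.-integrable setT (EFin \o (fun w => Y w `^ alpha)).

(** With [e y] equal to [cos (b * ln y)] or [sin (b * ln y)] the right-hand side is the real or
    imaginary part of the expression assumed nonzero; with [e = 1] it is the numerator of the
    constant. *)
Lemma dweight_moment (e : R -> R) : measurable_fun setT e -> (forall y, `|e y| <= 1) ->
  \int[G]_y (dweight pw alpha d1 y * e y) =
  rexpectation P (fun w => Y w `^ alpha * e (Y w)) +
  c * rexpectation P (fun w => phi2 (Y w) * (Y w `^ alpha * e (Y w))).
Proof.
move=> me eb; rewrite !rexpectationE.
have mY : measurable_fun setT Y by [].
have mind : measurable_fun setT (fun y : R => ind0 y * y `^ alpha).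
  by apply: measurable_funM; [exact: measurable_ind0|exact: measurable_powR].
have mW : measurable_fun setT (fun y => dweight pw alpha d1 y * e y).
  apply: measurable_funM => //; apply: measurable_funM => //.
  by apply: measurable_funD => //; exact: measurable_funM.
have mYa : measurable_fun setT (fun w => Y w `^ alpha * e (Y w)).
  apply: measurable_funM; first exact: measurableT_comp (measurable_powR _) mY.
  exact: measurableT_comp me mY.
have mpY : measurable_fun setT (fun w => pw (Y w) * d1 * (Y w `^ alpha * e (Y w))).
  apply: measurable_funM => //; apply: measurable_funM => //; exact: measurableT_comp mpw mY.
have IYe : P.-integrable setT (EFin \o (fun w => Y w `^ alpha * e (Y w))).
  apply: (integrable_bounded_by mYa Ya); apply: aeW => w.
  by rewrite normrM ger0_norm ?powR_ge0 // ler_piMr ?powR_ge0.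
have IpY : P.-integrable setT (EFin \o (fun w => pw (Y w) * d1 * (Y w `^ alpha * e (Y w)))).
  apply: (integrable_bounded_by mpY (integrableRZ (bp * `|d1|) Ya)); apply: aeW => w.
  rewrite normrM; apply: ler_pM => //; first by rewrite normrM; apply: ler_wpM2r.
  by rewrite normrM ger0_norm ?powR_ge0 // ler_piMr ?powR_ge0.
have WE : {ae P, forall w, dweight pw alpha d1 (Y w) * e (Y w) =
    Y w `^ alpha * e (Y w) + pw (Y w) * d1 * (Y w `^ alpha * e (Y w))}.
  by apply: filterS Y0 => w y0; rewrite /dweight ind0_powR //; ring.
have mWY : measurable_fun setT (fun w => dweight pw alpha d1 (Y w) * e (Y w)).
  exact: (measurableT_comp mW mY).
rewrite Rintegral_distribution //; last first.
  apply: (integrable_bounded_by (h := fun w => `|Y w `^ alpha * e (Y w) + pw (Y w) * d1 * (Y w `^ alpha * e (Y w))|)) => //.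
    by apply: integrable_norm; exact: integrableRD.
  by apply: filterS WE => w /= ->.
rewrite (ae_eq_Rintegral (g := fun w => Y w `^ alpha * e (Y w) + pw (Y w) * d1 * (Y w `^ alpha * e (Y w)))) //; last first.
  exact: measurable_funD.
rewrite RintegralD //; congr (_ + _).
have cpwY := ae_distribution cpw.
have m2Y : measurable_fun setT (fun w => phi2 (Y w) * (Y w `^ alpha * e (Y w))).
  by apply: measurable_funM => //; exact: measurableT_comp m2 mY.
(* If [c = 0] the expectation with [phi2] may be undefined, but its coefficient is 0 and [pw y * d1]
   vanishes almost everywhere as well. *)
have [c0|c0] := eqVneq c 0.
  rewrite c0 mul0r (ae_eq_Rintegral (g := fun=> 0)) //.
    by rewrite Rintegral_cst // mul0r.
  by apply: filterS cpwY => w <-; rewrite c0 !mul0r.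
rewrite [X in c * X](ae_eq_Rintegral (g := fun w => c^-1 * (pw (Y w) * d1 * (Y w `^ alpha * e (Y w))))) //.
- by rewrite RintegralZl // mulrA divff // mul1r.
- exact: measurable_funM.
- by apply: filterS cpwY => w <-; rewrite -!mulrA mulKf.
Qed.

End weight_moments.

Theorem theorem4p3 (d : measure_display) (T : measurableType d) (R : realType)
    (P : probability T R) (X Y : nat -> {RV P >-> R})
    (phi1 phi2 : R -> R) (theta d1 : R) (S : T -> \bar R) (alpha : R) :
  iid P (fun i w => (X i w, Y i w)) ->
  sarmanov (X 0%N) (Y 0%N) phi1 phi2 theta ->
  phi1 x @[x --> +oo] --> d1 ->
  dominatedly_varying (tail (X 0%N)) ->
  tail (Y 0%N) x / tail (X 0%N) x @[x --> +oo] --> (0 : R) ->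
  (\int[distribution P (Y 0%N)]_(v in `]0%R, +oo[)
      tail_ratio_sup (etail P (fun w => (X 0%N w * Y 0%N w)%:E)) v < +oo)%E ->
  (\forall w \ae P, 0 <= X 0%N w) ->
  0 < alpha ->
  (exists2 eps : R, 0 < eps < alpha &
    ('E_P[fun w => (Y 0%N w `^ (alpha + eps))%R] < 1)%E) ->
  measurable_fun [set: T] S ->
  (\forall w \ae P,
    (\sum_(0 <= i < n) X i w * \prod_(0 <= j < i.+1) Y j w)%:E
      @[n --> \oo] --> S w) ->
  regularly_varying (etail P S) alpha ->
  (forall beta : R,
    cexpectation P (fun w => cpowR (Y 0%N w) (Complex alpha beta)) +
    (theta * d1)%:C%C *
      cexpectation P (fun w =>
        (phi2 (Y 0%N w))%:C%C * cpowR (Y 0%N w) (Complex alpha beta)) != 0) ->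
  (forall beta : R,
    cgeometric_sum
      (cexpectation P (fun w => cpowR (Y 0%N w) (Complex alpha beta))) != 0) ->
  (forall i : nat, regularly_varying (tail (X i)) alpha) /\
  asym_equiv (etail P S)
    (fun x =>
      (rexpectation P (fun w => Y 0%N w `^ alpha) +
       theta * d1 *
         rexpectation P (fun w => phi2 (Y 0%N w) * Y 0%N w `^ alpha)) /
      (1 - rexpectation P (fun w => Y 0%N w `^ alpha)) * tail (X 0%N) x).
Proof.
move=> iidZ sm phi1d domF _ _ X0 al0 [eps /andP[eps0 _] Yeps] mS SE rvS CS _.
have Y0 : {ae P, forall w, 0 <= Y 0%N w} := ae_distribution (ae_sarmanov_ge0 sm).
have mY : measurable_fun setT (Y 0%N) by [].
have ap : alpha < alpha + eps by rewrite ltrDl.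
have mYp : measurable_fun setT (fun w => Y 0%N w `^ (alpha + eps)) := measurable_powR_comp mY _.
have Ep : (\int[P]_w (Y 0%N w `^ (alpha + eps))%:E < 1)%E by move: Yeps; rewrite unlock.
have Yp : P.-integrable setT (EFin \o (fun w => Y 0%N w `^ (alpha + eps))).
  apply/integrableP; split; first exact/measurable_EFinP.
  apply: le_lt_trans (lt_trans Ep (ltry 1)).
  by under eq_integral do rewrite /= ger0_norm ?powR_ge0 //.
have Ya := integrable_powR_lt mY Y0 al0 ap Yp.
have m1 : \int[P]_w (Y 0%N w `^ alpha) < 1.
  apply: (moment_lt1 mY Y0 al0 ap Yp); rewrite -lte_fin /Rintegral fineK //.
  by apply: integrable_fin_num => //.
have HK := product_tail_equiv iidZ X0 Y0 mS SE al0 ap Yp rvS.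
set m := 1 - _ in HK; have m0 : 0 < m by rewrite subr_gt0.
have Kni := etail_nonincreasing P mS.
have K0 := @etail_ge0 _ _ _ P S.
have Kp := regularly_varying_gt0 Kni K0 rvS.
set H := product_tail X Y in HK.
have rvH : regularly_varying H alpha := regularly_varying_equiv Kp rvS m0 HK.
have HE0 : H = etail P (fun w => (X 0%N w * Y 0%N w)%:E) by [].
have mXY : measurable_fun setT (fun w => (X 0%N w * Y 0%N w)%:E).
  by apply/measurable_EFinP; exact: measurable_funM.
have Hni : nonincreasing_fun H by rewrite HE0; exact: etail_nonincreasing.
have H0 x : 0 <= H x by rewrite HE0; exact: etail_ge0.
have H1 x : H x <= 1 by rewrite HE0; exact: etail_le1.
have F0 : forall x, 0 < tail (X 0%N) x := domF.1.
have [pw [bp [mpw pwb pwPhi pwd]]] := sarmanov_bounded_weight sm phi1d F0.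
have [br rb] := tail_ratio_bounded sm phi1d F0.
have rd1 := tail_ratio_cvg sm phi1d F0.
pose r s := weighted_tail (X 0%N) phi1 s / tail (X 0%N) s.
have Fni := @tail_nonincreasing _ _ _ P (X 0%N).
have mr : measurable_fun setT r.
  rewrite (_ : r = fun s => weighted_tail (X 0%N) phi1 s * tail (X 0%N) s `^ (-1)); last first.
    by apply/funext => s; rewrite powR_inv1 ?(ltW (F0 s)).
  apply: measurable_funM; first exact: measurable_weighted_tail sm.
  exact: measurableT_comp (measurable_powR _) (nonincreasing_measurable _ Fni).
have Gp : (distribution P (Y 0%N)).-integrable setT (EFin \o (fun y => y `^ (alpha + eps))).
  by apply: integrable_distribution => //; exact: measurable_powR.
have mPhi := measurable_weighted_tail sm.
have mF : measurable_fun setT (tail (X 0%N)) := nonincreasing_measurable measurableT Fni.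
have HE x : 0 < x -> H x = \int[distribution P (Y 0%N)]_y
    (ind0 y * (tail (X 0%N) (x / y) * (1 + pw y * r (x / y)))).
  move=> x0; rewrite /H /product_tail (sarmanov_product_tail sm x0).
  have mi (f : R -> R) : measurable_fun setT f -> measurable_fun setT (fun y => ind0 y * f (x / y)).
    by apply: (measurable_ind0_div (Y := fun y => y)); exact: measurable_id.
  apply: ae_eq_Rintegral.
  - rewrite (_ : (fun y => _) = fun y => ind0 y * tail (X 0%N) (x / y) +
        theta * phi2 y * (ind0 y * weighted_tail (X 0%N) phi1 (x / y))); last first.
      by apply/funext => y; ring.
    apply: measurable_funD; first exact: mi.
    apply: measurable_funM; last exact: mi.
    by apply: measurable_funM => //; exact: sarmanov_measurable2 sm.
  - rewrite (_ : (fun y => _) = fun y => ind0 y * tail (X 0%N) (x / y) +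
        pw y * (ind0 y * (tail (X 0%N) (x / y) * r (x / y)))); last first.
      by apply/funext => y; ring.
    apply: measurable_funD; first exact: mi.
    apply: measurable_funM => //; apply: (mi (fun s => tail (X 0%N) s * r s)).
    exact: measurable_funM.
  - apply: filterS pwPhi => y hy; rewrite hy; congr (_ * _); rewrite /r.
    by field; rewrite gt_eqF.
have pos_s : {ae distribution P (Y 0%N), forall y, forall s, 0 <= 1 + pw y * r s}.
  apply: filterS2 pwPhi (sarmanov_conditional_tail_ge0 sm) => y h1 h2 s.
  rewrite -(pmulr_rge0 _ (F0 s)) mulrDr mulr1 (_ : _ * (pw y * r s) = pw y * weighted_tail (X 0%N) phi1 s).
    by rewrite -h1.
  by rewrite /r; field; rewrite gt_eqF.
have pos_d : {ae distribution P (Y 0%N), forall y, 0 <= 1 + pw y * d1}.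
  by apply: filterS2 pwd (sarmanov_limit_density_ge0 sm phi1d F0) => y <-.
have moment := dweight_moment (sarmanov_measurable2 sm) mpw pwb pwd Y0 al0 Ya.
have CS0 b : transform (distribution P (Y 0%N)) (dweight pw alpha d1) (@ln R) cos b ^+ 2 +
    transform (distribution P (Y 0%N)) (dweight pw alpha d1) (@ln R) sin b ^+ 2 != 0.
  have mbl : measurable_fun setT (fun y => b * ln y) by apply: measurable_funM => //; exact: measurable_ln.
  rewrite /transform !moment; first last.
  - by move=> y; exact: normr_cos_le1.
  - exact: measurableT_comp (continuous_measurable_fun (@continuous_cos R)) mbl.
  - by move=> y; exact: normr_sin_le1.
  - exact: measurableT_comp (continuous_measurable_fun (@continuous_sin R)) mbl.
  (* A common zero of the two transforms annihilates both the real and the imaginary part of the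
     complex quantity in the assumption. *)
  apply: contra (CS b); rewrite paddr_eq0 ?sqr_ge0 // !sqrf_eq0 => /andP[/eqP c0 /eqP s0].
  have eRe : (fun w => complex.Re ((phi2 (Y 0%N w))%:C%C * cpowR (Y 0%N w) (Complex alpha b))) =
      fun w => phi2 (Y 0%N w) * (Y 0%N w `^ alpha * cos (b * ln (Y 0%N w))).
    by apply/funext => w /=; rewrite mul0r subr0.
  have eIm : (fun w => complex.Im ((phi2 (Y 0%N w))%:C%C * cpowR (Y 0%N w) (Complex alpha b))) =
      fun w => phi2 (Y 0%N w) * (Y 0%N w `^ alpha * sin (b * ln (Y 0%N w))).
    by apply/funext => w /=; rewrite mul0r addr0.
  by rewrite eq_complex /cexpectation eRe eIm /= !mul0r subr0 addr0 c0 s0 eqxx.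
have limF := tail_quotient_cvg al0 ap Fni F0 (tail_le1 _) domF Hni H0 H1 rvH mr rb rd1 mpw pwb
  Gp HE pos_s pos_d CS0.
have W0 := dweight_gt0 al0 ap rb rd1 mpw pwb Gp pos_d CS0.
set M := Rintegral _ _ _ in limF W0.
have ME : M = rexpectation P (fun w => Y 0%N w `^ alpha) +
    theta * d1 * rexpectation P (fun w => phi2 (Y 0%N w) * Y 0%N w `^ alpha).
  have := moment (fun=> 1) (measurable_cst _); under eq_Rintegral do rewrite mulr1.
  rewrite -/M => -> //; last by move=> y; rewrite normr1.
  by congr (rexpectation P _ + _ * rexpectation P _); apply/funext => w; rewrite mulr1.
have Hp := regularly_varying_gt0 Hni H0 rvH.
(* The two stages combine as [F / K = (F / H) * (H / K)]; the reciprocal [M / m] of the limit is the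
   constant claimed. *)
have limFK : tail (X 0%N) x / etail P S x @[x --> +oo] --> M^-1 * m.
  rewrite (_ : (fun x => _) = fun x => (tail (X 0%N) x / H x) * (H x / etail P S x)); first exact: cvgM.
  by apply/funext => x; rewrite mulrA divfK ?gt_eqF.
have Mm : 0 < M^-1 * m by rewrite mulr_gt0 ?invr_gt0.
split=> [i|]; first by rewrite (tail_eq i iidZ); exact: regularly_varying_equiv Kp rvS Mm limFK.
rewrite -ME rexpectationE -/m /asym_equiv.
rewrite (_ : (fun x => _) = fun x => (tail (X 0%N) x / etail P S x * (M / m))^-1); last first.
  by apply/funext => x; have k := Kp x; have f := F0 x; field; rewrite !gt_eqF.
rewrite -[X in _ --> X]invr1; apply: cvgV; first exact: oner_neq0.
rewrite [X in _ --> X](_ : 1 = M^-1 * m * (M / m)); last by field; rewrite !gt_eqF.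
by apply: cvgM => //; exact: cvg_cst.
Qed.
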